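(* Let $\Pi_{\mathsf{FEUTK}}$ be a functional encryption scheme with untelegraphable keys (FE-UTK) with function space $\mathsf{P}/\mathsf{poly}$, let $\Pi_{\mathsf{SKFE}}$ be a (classical) secret-key functional encryption scheme with message space $\{\mathcal{M}_\lambda\}$ and function space $\{\mathcal{F}_\lambda\}$, and let $\Pi_{\mathsf{UTSKFE}}$ be the untelegraphable secret-key functional encryption scheme built from them (defined in the context). Suppose $\Pi_{\mathsf{SKFE}}$ satisfies adaptive security (against QPT adversaries) and $\Pi_{\mathsf{FEUTK}}$ satisfies UTK security. Then $\Pi_{\mathsf{UTSKFE}}$ satisfies single-ciphertext untelegraphable security with unrestricted key queries.
   Context: $\lambda$ is the security parameter; QPT means quantum polynomial time; $\mathrm{negl}$ is a negligible function. FE-UTK. QPT algorithms $\mathsf{Setup}(1^\lambda)\to(\mathsf{pk},\mathsf{msk})$ (classical); $\mathsf{KeyGen}(\mathsf{msk},f)\to|\mathsf{sk}_f\rangle$ (quantum function key); $\mathsf{Enc}(\mathsf{pk},m)\to\mathsf{ct}$ (classical); $\mathsf{Dec}(|\mathsf{sk}_f\rangle,\mathsf{ct})$, outputting $f(m)$ with probability $1-\mathrm{negl}(\lambda)$ on honest inputs. UTK security: in the game with bit $b$ and adversary $(\mathcal{A},\mathcal{B}=(\mathcal{B}_0,\mathcal{B}_1))$, $\mathcal{A}$ gets $\mathsf{pk}$, outputs one function $f$, receives $|\mathsf{sk}_f\rangle\leftarrow\mathsf{KeyGen}(\mathsf{msk},f)$, and outputs a classical string $\mathsf{st}$; $\mathcal{B}_0(\mathsf{st})$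 outputs messages $m_0,m_1$ and a state $\mathsf{st}_{\mathcal{B}}$; $\mathcal{B}_1$ receives $\mathsf{st}_{\mathcal{B}}$ and $\mathsf{ct}\leftarrow\mathsf{Enc}(\mathsf{pk},m_b)$ and outputs $b'$. (There is no requirement relating $f(m_0)$ and $f(m_1)$.) For all QPT $(\mathcal{A},\mathcal{B})$, $|\Pr[b'=1\mid b=0]-\Pr[b'=1\mid b=1]|=\mathrm{negl}(\lambda)$. Untelegraphable secret-key functional encryption (UTSKFE). QPT algorithms $\mathsf{Setup}(1^\lambda)\to\mathsf{msk}$ (classical); $\mathsf{KeyGen}(\mathsf{msk},f)\to\mathsf{sk}_f$; $\mathsf{Enc}(\mathsf{msk},m)\to|\mathsf{ct}\rangle$ (quantum); $\mathsf{Dec}(\mathsf{sk}_f,|\mathsf{ct}\rangle)$, outputting $f(m)$ with probability $1-\mathrm{negl}(\lambda)$ on honest inputs. Untelegraphable security with unrestricted key queries: in the game with bit $b$ and adversary $(\mathcal{A},\mathcal{B})$, the challenger samples $\mathsf{msk}$; $\mathcal{A}$ may make key queries $f$ (answered by $\mathsf{KeyGen}(\mathsf{msk},f)$) and encryption queries $m$ (answered by $\mathsf{Enc}(\mathsf{msk},m)$) throughout; $\mathcal{A}$ outputs $m_0,m_1$ and receives $\mathsf{Enc}(\mathsf{msk},m_b)$, where all its key queries (before and after) must satisfy $f(m_0)=f(m_1)$; $\mathcal{A}$ outputs a classical string $\mathsf{st}$; $\mathcal{B}$ receives $\mathsf{st}$, may make encryption queries and key queries on arbitrary $f\in\mathcal{F}_\lambda$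 (with no restriction), and outputs $b_{\mathcal{B}}$. Security: $|\Pr[b_{\mathcal{B}}=1\mid b=0]-\Pr[b_{\mathcal{B}}=1\mid b=1]|=\mathrm{negl}(\lambda)$ for all QPT $(\mathcal{A},\mathcal{B})$. Single-ciphertext: the adversary has no encryption oracle and only receives the one challenge ciphertext. Plain SKFE: same syntax with classical ciphertexts; adaptive security is the same game except that there is no second stage and $\mathcal{A}$ itself outputs the bit. Construction of $\Pi_{\mathsf{UTSKFE}}$. - $\mathsf{Setup}(1^\lambda)$: $(\mathsf{pk}_{\mathsf{FEUTK}},\mathsf{msk}_{\mathsf{FEUTK}})\leftarrow\mathsf{FEUTK.Setup}(1^\lambda)$, $\mathsf{msk}_{\mathsf{SKFE}}\leftarrow\mathsf{SKFE.Setup}(1^\lambda)$; output $\mathsf{msk}=(\mathsf{pk}_{\mathsf{FEUTK}},\mathsf{msk}_{\mathsf{FEUTK}},\mathsf{msk}_{\mathsf{SKFE}})$. - $\mathsf{KeyGen}(\mathsf{msk},f)$: $\mathsf{sk}'_f\leftarrow\mathsf{SKFE.KeyGen}(\mathsf{msk}_{\mathsf{SKFE}},f)$; output $\mathsf{sk}_f\leftarrow\mathsf{FEUTK.Enc}(\mathsf{pk}_{\mathsf{FEUTK}},\mathsf{sk}'_f)$. - $\mathsf{Enc}(\mathsf{msk},m)$: $\mathsf{ct}_{\mathsf{SKFE}}\leftarrow\mathsf{SKFE.Enc}(\mathsf{msk}_{\mathsf{SKFE}},m)$; output $|\mathsf{ct}\rangle\leftarrow\mathsf{FEUTK.KeyGen}(\mathsf{msk}_{\mathsf{FEUTK}},G[\mathsf{ct}_{\mathsf{SKFE}}])$,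 where $G[\mathsf{ct}_{\mathsf{SKFE}}]$ maps an SKFE function key $\mathsf{sk}'_f$ to the SKFE decryption of $\mathsf{ct}_{\mathsf{SKFE}}$ under $\mathsf{sk}'_f$. - $\mathsf{Dec}(\mathsf{sk}_f,|\mathsf{ct}\rangle)$: output $\mathsf{FEUTK.Dec}(|\mathsf{ct}\rangle,\mathsf{sk}_f)$. *)

(* Defs.v *)
From HB Require Import structures.
From mathcomp Require Import all_boot all_order all_algebra.
From mathcomp Require Import reals.
From mathcomp.real_closed Require Import complex.

Set Implicit Arguments.
Unset Strict Implicit.
Unset Printing Implicit Defensive.

Import Order.TTheory GRing.Theory Num.Theory.
Local Open Scope ring_scope.

(* A register is a finite type of bit positions: ['I_n] for n-bit strings,
   [I + J] for the concatenation of two registers, [void] for no data. *)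

Notation bits I := {ffun I%type -> bool}.

Definition pull (I J : finType) (h : J -> I) (u : bits I) : bits J :=
  [ffun j => u (h j)].
Definition fstb (I J : finType) (u : bits (I + J)) : bits I := pull inl u.
Definition sndb (I J : finType) (u : bits (I + J)) : bits J := pull inr u.
Definition pairb (I J : finType) (x : bits I) (y : bits J) : bits (I + J) :=
  [ffun w => match w with inl i => x i | inr j => y j end].
Definition zerob (I : finType) : bits I := [ffun=> false].

(* Operators on the qubits of register Q, by their matrix entries in the
   computational basis.  The trace of a branch is its probability: density
   operators are kept subnormalized. *)
Definition op (R : realType) (Q : finType) := bits Q -> bits Q -> R[i].

Arguments op R Q%_type.

Definition unit_op (R : realType) : op R void := fun _ _ => 1.
Definition tr (R : realType) (Q : finType) (rho : op R Q) : R[i] :=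
  \sum_(u : bits Q) rho u u.
Definition scale_op (R : realType) (Q : finType) (a : R[i]) (rho : op R Q) :
  op R Q := fun u u' => a * rho u u'.
Definition tens (R : realType) (P Q : finType) (rho : op R P) (kappa : op R Q) :
  op R (P + Q) :=
  fun u u' => rho (fstb u) (fstb u') * kappa (sndb u) (sndb u').

(* The universal set {H, T, CNOT}, together with NOT and Toffoli. *)
Inductive gate (W : Type) : Type :=
| Had of W
| Tgate of W
| Not of W
| Cnot of W & W
| Toffoli of W & W & W.

Arguments gate W%_type.

(* A controlled gate one of whose controls is its target acts as the identity,
   so that every gate is unitary. *)
Definition flip_if (W : finType) (c : bool) (t : W) (u : bits W) : bits W :=
  [ffun w => u w (+) ((w == t) && c)].

Definition gate_mx (R : realType) (W : finType) (g : gate W) (u v : bits W) :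
  R[i] :=
  let r : R := (Num.sqrt 2)^-1 in
  match g with
  | Had t => if [forall w, (w != t) ==> (u w == v w)]
             then (r%:C)%C * (-1) ^+ (u t && v t) else 0
  | Tgate t => if u == v then (if u t then (r +i* r)%C else 1) else 0
  | Not t => (u == flip_if true t v)%:R
  | Cnot c t => (u == flip_if ((c != t) && v c) t v)%:R
  | Toffoli c d t =>
      (u == flip_if [&& c != t, d != t, v c & v d] t v)%:R
  end.

Definition apply_gate (R : realType) (W : finType) (rho : op R W) (g : gate W) :
  op R W :=
  fun u u' => \sum_(v : bits W) \sum_(v' : bits W)
     gate_mx R g u v * rho v v' * conjc (gate_mx R g u' v').

(* A quantum circuit with classical input I, quantum input Q, classical output
   J and quantum output Q'.  Ancillas start in |0>; at the end the wires
   [cwire] are measured, the wires [qwire] are kept and all others are traced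
   out.  By deferred measurement, measuring only at the end is no restriction.
   [qwire] need not be injective: an output wire listed twice is copied in the
   computational basis by a CNOT onto a fresh qubit. *)
Record qalg (I Q J Q' : finType) := QAlg {
  anc : finType;
  gates : seq (gate (I + Q + anc));
  cwire : J -> (I + Q + anc)%type;
  qwire : Q' -> (I + Q + anc)%type
}.

Arguments qalg (I Q J Q')%_type.

Definition qsize (I Q J Q' : finType) (a : qalg I Q J Q') : nat :=
  (#|I| + #|Q| + #|J| + #|Q'| + #|anc a| + size (gates a))%N.

Definition init_op (R : realType) (I Q A : finType) (x : bits I) (rho : op R Q) :
  op R (I + Q + A) :=
  fun u u' =>
    ([&& fstb (fstb u) == x, fstb (fstb u') == x,
         sndb u == zerob A & sndb u' == zerob A])%:R
    * rho (sndb (fstb u)) (sndb (fstb u')).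

(* [run a x rho y] is the quantum output on the branch where the classical
   output is y; its trace is the probability of that branch. *)
Definition run (R : realType) (I Q J Q' : finType) (a : qalg I Q J Q')
    (x : bits I) (rho : op R Q) (y : bits J) : op R Q' :=
  fun z z' =>
    \sum_(u : bits (I + Q + anc a) |
            (pull (cwire a) u == y) && (pull (qwire a) u == z))
    \sum_(u' : bits (I + Q + anc a) |
            [&& pull (cwire a) u' == y, pull (qwire a) u' == z' &
                [forall w, (w \notin codom (qwire a)) ==> (u w == u' w)]])
      foldl (@apply_gate R _) (init_op x rho) (gates a) u u'.

Definition poly_in (T : Type) (mu f : T -> nat) : Prop :=
  exists c : nat, forall t : T, (f t <= mu t ^ c + c)%N.

Definition poly_bounded (f : nat -> nat) : Prop := poly_in id f.

Definition negligible (R : realType) (f : nat -> R) : Prop :=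
  forall c : nat, exists N : nat, forall l : nat, (N <= l)%N ->
    `|f l| < (l%:R ^+ c)^-1.

(* Quantum polynomial time: (non-uniform) families of quantum circuits, indexed
   by T and of size polynomial in mu; registers are counted in the size.  T is
   the security parameter, or its pair with the size of an input circuit. *)
Definition qpt_sampler (R : realType) (T : Type) (mu : T -> nat)
    (I J : T -> finType) (k : forall t, bits (I t) -> bits (J t) -> R[i]) : Prop :=
  exists a : forall t, qalg (I t) void (J t) void,
    poly_in mu (fun t => qsize (a t)) /\
    forall t x y, k t x y = tr (run (a t) x (unit_op R) y).

Definition qpt_preparation (R : realType) (T : Type) (mu : T -> nat)
    (I Q : T -> finType) (k : forall t, bits (I t) -> op R (Q t)) : Prop :=
  exists a : forall t, qalg (I t) void void (Q t),
    poly_in mu (fun t => qsize (a t)) /\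
    forall t x z z', k t x z z' = run (a t) x (unit_op R) (zerob void) z z'.

Definition qpt_measurement (R : realType) (T : Type) (mu : T -> nat)
    (I Q J : T -> finType)
    (k : forall t, bits (I t) -> op R (Q t) -> bits (J t) -> R[i]) : Prop :=
  exists a : forall t, qalg (I t) (Q t) (J t) void,
    poly_in mu (fun t => qsize (a t)) /\
    forall t x rho y, k t x rho y = tr (run (a t) x rho y).

(* A Boolean circuit over unbounded fan-in NAND, with inputs I, s internal gates
   and outputs J, is described by its adjacency matrix: the rows are the internal
   and output gates, the columns are the wires feeding them.  The description is
   thus itself a bit string, of length polynomial in the size of the circuit. *)
Definition bdesc (I : finType) (s : nat) (J : finType) : finType :=
  (('I_s + J) * (I + 'I_s))%type.
Notation bcirc I s J := (bits (bdesc I%type s J%type)).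

Definition nand_row (I : finType) (s : nat) (J : finType) (c : bcirc I s J)
    (x : bits I) (v : seq bool) (r : 'I_s + J) : bool :=
  ~~ [forall w : I + 'I_s, c (r, w) ==>
        match w with inl i => x i | inr k => nth true v k end].

(* Internal gates are evaluated in increasing order; when gate k is reached, the
   wires of gates >= k take the neutral value [true], i.e. such entries of the
   adjacency matrix are ignored. *)
Definition gate_values (I : finType) (s : nat) (J : finType) (c : bcirc I s J)
    (x : bits I) : seq bool :=
  foldl (fun v k => rcons v (nand_row c x v (inl k))) [::] (enum 'I_s).

Definition beval (I : finType) (s : nat) (J : finType) (c : bcirc I s J)
    (x : bits I) : bits J :=
  [ffun j => nand_row c x (gate_values c x) (inr j)].

(* The circuit c(-, y), with y hardwired.  Gate 0 has no input, so is constantly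
   false; gate 1 + i is the constant y i, as the NAND of gate 0 if y i and of
   nothing otherwise; then come the gates of c. *)
Definition hardwire (I : finType) (n s : nat) (J : finType)
    (c : bcirc (I + 'I_n) s J) (y : bits 'I_n) : bcirc I (1 + n + s) J :=
  let col (w : I + 'I_(1 + n + s)) : option ((I + 'I_n) + 'I_s) :=
    match w with
    | inl i => Some (inl (inl i))
    | inr k => match split k with
               | inr k' => Some (inr k')
               | inl k' => if split k' is inr i then Some (inl (inr i)) else None
               end
    end in
  let crow (r : 'I_s + J) (w : I + 'I_(1 + n + s)) : bool :=
    if col w is Some w' then c (r, w') else false in
  [ffun rw : bdesc I (1 + n + s) J =>
    match rw.1 with
    | inr j => crow (inr j) rw.2
    | inl k =>
        match split k with
        | inr k' => crow (inl k') rw.2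
        | inl k' => match split k' with
                    | inl _ => false
                    | inr i => y i && (if rw.2 is inr k0 then k0 == 0%N :> nat
                                       else false)
                    end
        end
    end].

Section Hardwire.
Variables (I : finType) (n s : nat) (J : finType).
Variables (c : bcirc (I + 'I_n) s J) (y : bits 'I_n) (x : bits I).
Let vals (I0 J0 : finType) s0 (d : bcirc I0 s0 J0) z k :=
  foldl (fun v g => rcons v (nand_row d z v (inl g))) [::] (take k (enum 'I_s0)).
Lemma valsS (I0 J0 : finType) s0 (d : bcirc I0 s0 J0) z (k : 'I_s0) :
  vals d z k.+1 = rcons (vals d z k) (nand_row d z (vals d z k) (inl k)).
Proof.
rewrite /vals (take_nth k) ?size_enum_ord // -cats1 foldl_cat /= nth_ord_enum //.
Qed.
Lemma valsE (I0 J0 : finType) s0 (d : bcirc I0 s0 J0) z : vals d z s0 = gate_values d z.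
Proof. by rewrite /vals take_oversize // size_enum_ord. Qed.
Lemma size_vals (I0 J0 : finType) s0 (d : bcirc I0 s0 J0) z k : (k <= s0)%N -> size (vals d z k) = k.
Proof.
elim: k => [|k IH] h; first by rewrite /vals take0.
by rewrite (valsS d z (Ordinal h)) size_rcons /= IH // ltnW.
Qed.

Let H := hardwire c y.
Lemma row_const (k : 'I_(1+n+s)) v : (k < 1)%N -> nand_row H x v (inl k) = false.
Proof.
move=> hk; apply/negbTE; rewrite negbK; apply/forallP => w.
rewrite ffunE /=; case: splitP => k' e; last by rewrite e in hk.
by case: splitP => // i e2; rewrite e e2 in hk.
Qed.
Lemma row_bit (i : 'I_n) v : (0 < size v)%N -> nth true v 0 = false ->
  nand_row H x v (inl (lshift s (rshift 1 i))) = y i.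
Proof.
move=> hv h0; rewrite /nand_row.
have E w : H (inl (lshift s (rshift 1 i)), w) = y i && (if w is inr k0 then k0 == 0%N :> nat else false).
  rewrite ffunE /=; case: splitP => k' e.
    have -> : k' = rshift 1 i by apply/val_inj; rewrite /= -e.
    case: splitP => i' e'; first by move: (ltn_ord i'); rewrite -e'.
    by have -> : i' = i by apply/val_inj; move: e' => /= [].
  by move: (ltn_ord i); rewrite /= in e; rewrite -(ltn_add2l 1) e ltnNge leq_addr.
case yi: (y i).
  apply/negP => /forallP /(_ (inr ord0 )).
  by rewrite E yi /= h0.
by apply/negbTE; rewrite negbK; apply/forallP => w; rewrite E yi.
Qed.
Lemma row_old (r : 'I_s + J) v v' :
  (size v = 1 + n + size v')%N -> (forall i : 'I_n, nth true v (1 + i) = y i) ->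
  (forall k, nth true v (1 + n + k) = nth true v' k) ->
  nand_row H x v (match r with inl k => inl (rshift (1+n) k) | inr j => inr j end)
  = nand_row c (pairb x y) v' r.
Proof.
move=> hs hy hv; rewrite /nand_row; congr (~~ _).
have E w : H (match r with inl k => inl (rshift (1+n) k) | inr j => inr j end, w) =
  match w with
  | inl i => c (r, inl (inl i))
  | inr k => match split k with inr k' => c (r, inr k')
     | inl k' => if split k' is inr i then c (r, inl (inr i)) else false end
  end.
  rewrite ffunE; case: r => [k|j] /=.
    case: splitP => k' e /=.
      by move: (ltn_ord k'); rewrite -e /= ltnNge leq_addr.
    have -> : k' = k by apply/val_inj; move/eqP: e; rewrite /= eqn_add2l => /eqP.
    by case: w => // k0; case: (split k0) => // k1; case: (split k1).
  by case: w => // k0; case: (split k0) => // k1; case: (split k1).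
apply/forallP/forallP => h.
- case=> [[i|i]|k].
  + by move: (h (inl i)); rewrite E ffunE.
  + move: (h (inr (lshift s (rshift 1 i)))); rewrite E ffunE.
    by rewrite -[lshift _ _]/(unsplit (inl _)) unsplitK -[rshift _ _]/(unsplit (inr _)) unsplitK /= hy.
  + move: (h (inr (rshift (1+n) k))); rewrite E.
    by rewrite -{1}[rshift _ _]/(unsplit (inr _)) unsplitK /= hv.
- case=> [i|k]; rewrite E.
  + by move: (h (inl (inl i))); rewrite ffunE.
  + case: splitP => k' e.
      case: splitP => [//|i e'].
      by move: (h (inl (inr i))); rewrite ffunE e e' hy.
    by move: (h (inr k')); rewrite e hv.
Qed.
Lemma beval_hardwire : beval (hardwire c y) x = beval c (pairb x y).
Proof.
have A k : (k <= n)%N -> nth true (vals H x (1 + k)) 0 = false /\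
   (forall i : 'I_n, (i < k)%N -> nth true (vals H x (1+k)) (1 + i) = y i).
  elim: k => [_|k IH hk].
    split=> //.
    have l1 : (0 < 1+n+s)%N by [].
    rewrite (valsS H x (Ordinal l1)) nth_rcons size_vals //= row_const //.
  have [h0 hi] := IH (ltnW hk).
  have lk : (1 + k < 1 + n + s)%N by rewrite -addnA ltn_add2l; apply: leq_trans hk (leq_addr _ _).
  have e := valsS H x (Ordinal lk); rewrite /= in e.
  have sz : size (vals H x (1+k)) = (1+k)%N by rewrite size_vals // ltnW.
  have rb := @row_bit (Ordinal hk) (vals H x (1 + k)).
  have ee : Ordinal lk = lshift s (rshift 1 (Ordinal hk)) by apply/val_inj.
  rewrite ee rb ?sz // in e.
  rewrite [(1 + k.+1)%N]addnS e; split; first by rewrite nth_rcons sz.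
  move=> i; rewrite ltnS leq_eqVlt => /orP [/eqP ik|ik].
    rewrite nth_rcons sz ik ltnn eqxx; congr (y _); exact/val_inj.
  by rewrite nth_rcons sz ltn_add2l ik hi.
have [_ hy] := A n (leqnn _).
have B k : (k <= s)%N ->
   (forall i : 'I_n, nth true (vals H x (1 + n + k)) (1 + i) = y i) /\
   forall j, nth true (vals H x (1+n+k)) (1+n+j) = nth true (vals c (pairb x y) k) j.
  elim: k => [_|k IH hk].
    rewrite addn0; split=> [i|j]; first exact: hy.
    by rewrite nth_default ?size_vals ?leq_addr // /vals take0 nth_default.
  have [a b] := IH (ltnW hk).
  have lk : (1 + n + k < 1 + n + s)%N by rewrite ltn_add2l.
  have e := valsS H x (Ordinal lk); rewrite /= in e.
  have sz : size (vals H x (1+n+k)) = (1+n+k)%N by rewrite size_vals // ltnW.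
  have szc : size (vals c (pairb x y) k) = k by rewrite size_vals // ltnW.
  have ee : Ordinal lk = rshift (1+n) (Ordinal hk) by apply/val_inj.
  have ro := @row_old (inl (Ordinal hk)) (vals H x (1+n+k)) (vals c (pairb x y) k).
  rewrite ee ro ?sz ?szc // in e.
  rewrite [(1+n+k.+1)%N]addnS e (valsS c _ (Ordinal hk)) /=; split=> [i|j].
    rewrite nth_rcons sz -addnA ltn_add2l.
    by rewrite (leq_trans (ltn_ord i) (leq_addr _ _)) addnA.
  by rewrite !nth_rcons sz szc ltn_add2l eqn_add2l b.
have [a b] := B s (leqnn _).
apply/ffunP => j; rewrite !ffunE -!valsE.
by rewrite -(@row_old (inr j) (vals H x (1+n+s))) // !size_vals.
Qed.
End Hardwire.

(* At each security parameter the functions are given by bit-string descriptions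
   in [funs], interpreted by [fev]. *)
Record fclass := FClass {
  mlen : nat -> nat;
  flen : nat -> nat;
  olen : nat -> nat;
  msgs : forall l, {set bits 'I_(mlen l)};
  funs : forall l, {set bits 'I_(flen l)};
  fev : forall l, bits 'I_(flen l) -> bits 'I_(mlen l) -> bits 'I_(olen l)
}.

(* Randomized algorithms are given by their output probabilities.  Decryption is
   a deterministic Boolean circuit, so that G[ct] is in P/poly. *)
Record skfe (R : realType) (FC : fclass) := SKFE {
  sk_msklen : nat -> nat;
  sk_keylen : nat -> nat;
  sk_ctlen : nat -> nat;
  sk_decsize : nat -> nat;
  sk_setup : forall l, bits 'I_(sk_msklen l) -> R[i];
  sk_keygen : forall l, bits 'I_(sk_msklen l) -> bits 'I_(flen FC l) ->
    bits 'I_(sk_keylen l) -> R[i];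
  sk_enc : forall l, bits 'I_(sk_msklen l) -> bits 'I_(mlen FC l) ->
    bits 'I_(sk_ctlen l) -> R[i];
  sk_dec : forall l,
    bcirc ('I_(sk_keylen l) + 'I_(sk_ctlen l)) (sk_decsize l) 'I_(olen FC l)
}.

Arguments sk_setup {R FC} _ {l} _.
Arguments sk_keygen {R FC} _ {l} _ _ _.
Arguments sk_enc {R FC} _ {l} _ _ _.

Definition skfe_qpt (R : realType) (FC : fclass) (S : skfe R FC) : Prop :=
  [/\ qpt_sampler id (fun l (_ : bits void) => sk_setup S (l := l)),
      qpt_sampler id (fun l (x : bits ('I_(sk_msklen S l) + 'I_(flen FC l))) =>
        sk_keygen S (fstb x) (sndb x)),
      qpt_sampler id (fun l (x : bits ('I_(sk_msklen S l) + 'I_(mlen FC l))) =>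
        sk_enc S (fstb x) (sndb x))
    & poly_bounded (fun l => sk_decsize S l + olen FC l)%N].

Definition skfe_correct (R : realType) (FC : fclass) (S : skfe R FC) : Prop :=
  exists2 eps : nat -> R, negligible eps &
  forall l f m, f \in funs FC l -> m \in msgs FC l ->
    1 - eps l <= complex.Re (
      \sum_(msk : bits 'I_(sk_msklen S l))
      \sum_(k : bits 'I_(sk_keylen S l)) \sum_(ct : bits 'I_(sk_ctlen S l))
         sk_setup S msk * sk_keygen S msk f k * sk_enc S msk m ct
         * (beval (sk_dec S l) (pairb k ct) == fev f m)%:R).

(* Functional encryption with untelegraphable keys for P/poly: the functions are
   all Boolean circuits from n bits to y bits, of any size s.  Setup outputs the
   pair (pk, msk). *)
Record feutk (R : realType) (n y : nat -> nat) := FEUTK {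
  fe_pklen : nat -> nat;
  fe_msklen : nat -> nat;
  fe_ctlen : nat -> nat;
  fe_keylen : nat -> nat -> nat;
  fe_setup : forall l, bits ('I_(fe_pklen l) + 'I_(fe_msklen l)) -> R[i];
  fe_keygen : forall l s, bits 'I_(fe_msklen l) -> bcirc 'I_(n l) s 'I_(y l) ->
    op R 'I_(fe_keylen l s);
  fe_enc : forall l, bits 'I_(fe_pklen l) -> bits 'I_(n l) ->
    bits 'I_(fe_ctlen l) -> R[i];
  fe_dec : forall l s, op R 'I_(fe_keylen l s) -> bits 'I_(fe_ctlen l) ->
    bits 'I_(y l) -> R[i]
}.

Arguments fe_setup {R n y} _ {l} _.
Arguments fe_keygen {R n y} _ {l s} _ _ _ _.
Arguments fe_enc {R n y} _ {l} _ _ _.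
Arguments fe_dec {R n y} _ {l s} _ _ _.

Definition feutk_qpt (R : realType) (n y : nat -> nat) (F : feutk R n y) : Prop :=
  let mu (t : nat * nat) := (t.1 + t.2)%N in
  [/\ qpt_sampler id (fun l (_ : bits void) => fe_setup F (l := l)),
      qpt_preparation mu
        (fun t (x : bits ('I_(fe_msklen F t.1) + bdesc 'I_(n t.1) t.2 'I_(y t.1))) =>
           fe_keygen F (fstb x) (sndb x)),
      qpt_sampler id (fun l (x : bits ('I_(fe_pklen F l) + 'I_(n l))) =>
        fe_enc F (fstb x) (sndb x))
    & qpt_measurement mu
        (fun t (ct : bits 'I_(fe_ctlen F t.1)) (key : op R 'I_(fe_keylen F t.1 t.2)) =>
           fe_dec F key ct)].

Definition feutk_correct (R : realType) (n y : nat -> nat) (F : feutk R n y) :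
  Prop :=
  forall s : nat -> nat, poly_bounded s ->
  exists2 eps : nat -> R, negligible eps &
  forall l (f : bcirc 'I_(n l) (s l) 'I_(y l)) (m : bits 'I_(n l)),
    1 - eps l <= complex.Re (
      \sum_(k : bits ('I_(fe_pklen F l) + 'I_(fe_msklen F l)))
      \sum_(ct : bits 'I_(fe_ctlen F l))
         fe_setup F k * fe_enc F (fstb k) m ct
         * fe_dec F (fe_keygen F (sndb k) f) ct (beval f m)).

Record utskfe (R : realType) (FC : fclass) := UTSKFE {
  ut_msk : nat -> finType;
  ut_key : nat -> finType;
  ut_ct : nat -> finType;
  ut_setup : forall l, bits (ut_msk l) -> R[i];
  ut_keygen : forall l, bits (ut_msk l) -> bits 'I_(flen FC l) ->
    bits (ut_key l) -> R[i];
  ut_enc : forall l, bits (ut_msk l) -> bits 'I_(mlen FC l) -> op R (ut_ct l);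
  ut_dec : forall l, bits (ut_key l) -> op R (ut_ct l) ->
    bits 'I_(olen FC l) -> R[i]
}.

Arguments ut_setup {R FC} _ {l} _.
Arguments ut_keygen {R FC} _ {l} _ _ _.
Arguments ut_enc {R FC} _ {l} _ _ _ _.
Arguments ut_dec {R FC} _ {l} _ _ _.

(* The master secret key is laid out as (pk_FEUTK, msk_FEUTK), msk_SKFE. *)
Definition utskfe_of (R : realType) (FC : fclass) (S : skfe R FC)
    (F : feutk R (sk_keylen S) (olen FC)) : utskfe R FC :=
  let msk l : finType :=
    ('I_(fe_pklen F l) + 'I_(fe_msklen F l) + 'I_(sk_msklen S l))%type in
  let size_G l := (1 + sk_ctlen S l + sk_decsize S l)%N in
  @UTSKFE R FC msk
    (fun l => 'I_(fe_ctlen F l))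
    (fun l => 'I_(fe_keylen F l (size_G l)))
    (fun l (k : bits (msk l)) => fe_setup F (fstb k) * sk_setup S (sndb k))
    (fun l (k : bits (msk l)) f key =>
       \sum_(key' : bits 'I_(sk_keylen S l))
          sk_keygen S (sndb k) f key' * fe_enc F (fstb (fstb k)) key' key)
    (fun l (k : bits (msk l)) m z z' =>
       \sum_(ct : bits 'I_(sk_ctlen S l))
          sk_enc S (sndb k) m ct
          * fe_keygen F (sndb (fstb k)) (hardwire (sk_dec S l) ct) z z')
    (fun l key ct => fe_dec F ct key).

(* An experiment is the list of its branches, each with classical data in X and
   the subnormalized state of the adversary's register Q. *)
Definition ens (R : realType) (Q : finType) (X : Type) := seq (X * op R Q).

Arguments ens R Q%_type X%_type.

Definition ret (R : realType) (Q : finType) (X : Type) (x : X) (rho : op R Q) :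
  ens R Q X := [:: (x, rho)].
Definition bind (R : realType) (Q Q' : finType) (X Y : Type) (e : ens R Q X)
    (k : X -> op R Q -> ens R Q' Y) : ens R Q' Y :=
  flatten [seq k b.1 b.2 | b <- e].
Notation "'let*' x , rho := e 'in' k" := (bind e (fun x rho => k))
  (at level 200, x name, rho name, k at level 200).

Definition Pr (R : realType) (Q : finType) (X : Type) (e : ens R Q X)
    (P : pred X) : R :=
  complex.Re (\sum_(b <- e | P b.1) tr b.2).

Definition draw (R : realType) (Q J : finType) (p : bits J -> R[i]) (rho : op R Q) :
  ens R Q (bits J) := [seq (y, scale_op (p y) rho) | y <- enum {: bits J}].

Definition exec (R : realType) (I Q J Q' : finType) (a : qalg I Q J Q')
    (x : bits I) (rho : op R Q) : ens R Q' (bits J) :=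
  [seq (y, run a x rho y) | y <- enum {: bits J}].

(* In round i, [ask i] outputs a classical query in Qry and [tell i] absorbs the
   classical answer in Ans; the workspace persists between rounds. *)
Record machine (I Q Qry Ans J Q' : finType) := Machine {
  work : finType;
  rounds : nat;
  start : qalg I Q void work;
  ask : nat -> qalg void work Qry work;
  tell : nat -> qalg Ans work void work;
  finish : qalg void work J Q'
}.

Arguments machine (I Q Qry Ans J Q')%_type.

Definition msize (I Q Qry Ans J Q' : finType) (M : machine I Q Qry Ans J Q') : nat :=
  (qsize (start M) + qsize (finish M) + rounds M
   + \sum_(i < rounds M) (qsize (ask M i) + qsize (tell M i)))%N.

(* The classical data of a branch is the log of the queries made so far. *)
Fixpoint converse (R : realType) (I Q Qry Ans J Q' : finType)
    (M : machine I Q Qry Ans J Q') (O : bits Qry -> bits Ans -> R[i])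
    (k : nat) (rho : op R (work M)) : ens R (work M) (seq (bits Qry)) :=
  if k is k'.+1 then
    let* log, rho1 := converse O k' rho in
    let* q, rho2 := exec (ask M k') (zerob void) rho1 in
    let* a, rho3 := draw (O q) rho2 in
    let* _, rho4 := exec (tell M k') a rho3 in
    ret (rcons log q) rho4
  else ret [::] rho.

Definition interact (R : realType) (I Q Qry Ans J Q' : finType)
    (M : machine I Q Qry Ans J Q') (O : bits Qry -> bits Ans -> R[i])
    (x : bits I) (rho : op R Q) : ens R Q' (seq (bits Qry) * bits J) :=
  let* _, rho1 := exec (start M) x rho in
  let* log, rho2 := converse O (rounds M) rho1 in
  let* y, rho3 := exec (finish M) (zerob void) rho2 in
  ret (log, y) rho3.

(* In each round the adversary may decline to query: the leading bit of the query
   register tells whether it makes one.  The answer is then the zero string. *)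
Definition optb (I : finType) (q : bits (unit + I)) : option (bits I) :=
  if q (inl tt) then Some (sndb q) else None.

Definition opt_oracle (R : realType) (I J : finType)
    (k : bits I -> bits J -> R[i]) (q : bits (unit + I)) (a : bits J) : R[i] :=
  if optb q is Some x then k x a else (a == zerob J)%:R.

Definition pair_oracle (R : realType) (I1 J1 I2 J2 : finType)
    (O1 : bits I1 -> bits J1 -> R[i]) (O2 : bits I2 -> bits J2 -> R[i])
    (q : bits (I1 + I2)) (a : bits (J1 + J2)) : R[i] :=
  O1 (fstb q) (fstb a) * O2 (sndb q) (sndb a).

Definition valid_challenge (FC : fclass) (l : nat) (m0 m1 : bits 'I_(mlen FC l))
    (fs : seq (bits 'I_(flen FC l))) : bool :=
  [&& m0 \in msgs FC l, m1 \in msgs FC l &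
      all (fun f => (f \in funs FC l) && (fev f m0 == fev f m1)) fs].

(* In each round the adversary makes at most one key query and at most one
   encryption query. *)
Definition sk_query (FC : fclass) (l : nat) : finType :=
  ((unit + 'I_(flen FC l)) + (unit + 'I_(mlen FC l)))%type.
Definition sk_answer (R : realType) (FC : fclass) (S : skfe R FC) (l : nat) :
  finType := ('I_(sk_keylen S l) + 'I_(sk_ctlen S l))%type.

Record sk_adversary (R : realType) (FC : fclass) (S : skfe R FC) := SKAdversary {
  ska_state : nat -> finType;
  ska_A1 : forall l, machine void void (sk_query FC l) (sk_answer S l)
    ('I_(mlen FC l) + 'I_(mlen FC l))%type (ska_state l);
  ska_A2 : forall l, machine 'I_(sk_ctlen S l) (ska_state l)
    (sk_query FC l) (sk_answer S l) unit void
}.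

Definition sk_adversary_qpt (R : realType) (FC : fclass) (S : skfe R FC)
    (A : sk_adversary S) : Prop :=
  poly_bounded (fun l => msize (ska_A1 A l) + msize (ska_A2 A l))%N.

(* Each branch yields whether all the queries were legitimate, and the output
   bit. *)
Definition sk_game (R : realType) (FC : fclass) (S : skfe R FC)
    (A : sk_adversary S) (b : bool) (l : nat) : ens R void (bool * bool) :=
  let* msk, r0 := draw (sk_setup S (l := l)) (unit_op R) in
  let O := pair_oracle (opt_oracle (sk_keygen S msk)) (opt_oracle (sk_enc S msk)) in
  let* t1, r1 := interact (ska_A1 A l) O (zerob void) r0 in
  let m0 := fstb t1.2 in
  let m1 := sndb t1.2 in
  let* ct, r2 := draw (sk_enc S msk (if b then m1 else m0)) r1 in
  let* t2, r3 := interact (ska_A2 A l) O ct r2 in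
  let log := t1.1 ++ t2.1 in
  let fs := pmap (fun q : bits (sk_query FC l) => optb (fstb q)) log in
  let ms := pmap (fun q : bits (sk_query FC l) => optb (sndb q)) log in
  ret (valid_challenge m0 m1 fs && all (fun m => m \in msgs FC l) ms, t2.2 tt) r3.

Definition sk_admissible (R : realType) (FC : fclass) (S : skfe R FC)
    (A : sk_adversary S) : Prop :=
  forall b l, Pr (sk_game A b l) (fun r => ~~ r.1) = 0.

Definition skfe_adaptive_secure (R : realType) (FC : fclass) (S : skfe R FC) :
  Prop :=
  forall A : sk_adversary S, sk_adversary_qpt A -> sk_admissible A ->
    negligible (fun l => Pr (sk_game A false l) (fun r => r.2)
                         - Pr (sk_game A true l) (fun r => r.2)).

(* [utka_size] is the size of the circuit for which A asks a key. *)
Record utk_adversary (R : realType) (n y : nat -> nat) (F : feutk R n y) :=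
  UTKAdversary {
  utka_size : nat -> nat;
  utka_stA : nat -> finType;
  utka_st : nat -> finType;
  utka_stB : nat -> finType;
  utka_A1 : forall l, qalg 'I_(fe_pklen F l) void
    (bdesc 'I_(n l) (utka_size l) 'I_(y l)) (utka_stA l);
  utka_A2 : forall l, qalg void
    (utka_stA l + 'I_(fe_keylen F l (utka_size l)))%type (utka_st l) void;
  utka_B0 : forall l, qalg (utka_st l) void ('I_(n l) + 'I_(n l))%type (utka_stB l);
  utka_B1 : forall l, qalg 'I_(fe_ctlen F l) (utka_stB l) unit void
}.

Definition utk_adversary_qpt (R : realType) (n y : nat -> nat) (F : feutk R n y)
    (A : utk_adversary F) : Prop :=
  poly_bounded (fun l => utka_size A l + qsize (utka_A1 A l) + qsize (utka_A2 A l)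
                         + qsize (utka_B0 A l) + qsize (utka_B1 A l))%N.

Definition utk_game (R : realType) (n y : nat -> nat) (F : feutk R n y)
    (A : utk_adversary F) (b : bool) (l : nat) : ens R void bool :=
  let* k, r0 := draw (fe_setup F (l := l)) (unit_op R) in
  let pk := fstb k in
  let msk := sndb k in
  let* f, r1 := exec (utka_A1 A l) pk r0 in
  let* st, r2 := exec (utka_A2 A l) (zerob void) (tens r1 (fe_keygen F msk f)) in
  let* m, r3 := exec (utka_B0 A l) st r2 in
  let* ct, r4 := draw (fe_enc F pk (if b then sndb m else fstb m)) r3 in
  let* b', r5 := exec (utka_B1 A l) ct r4 in
  ret (b' tt) r5.

Definition feutk_utk_secure (R : realType) (n y : nat -> nat) (F : feutk R n y) :
  Prop :=
  forall A : utk_adversary F, utk_adversary_qpt A ->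
    negligible (fun l => Pr (utk_game A false l) id - Pr (utk_game A true l) id).

Record ut_adversary (R : realType) (FC : fclass) (U : utskfe R FC) := UTAdversary {
  uta_state : nat -> finType;
  uta_st : nat -> finType;
  uta_A1 : forall l, machine void void (unit + 'I_(flen FC l))%type (ut_key U l)
    ('I_(mlen FC l) + 'I_(mlen FC l))%type (uta_state l);
  uta_A2 : forall l, machine void (uta_state l + ut_ct U l)%type
    (unit + 'I_(flen FC l))%type (ut_key U l) (uta_st l) void;
  uta_B : forall l, machine (uta_st l) void
    (unit + 'I_(flen FC l))%type (ut_key U l) unit void
}.

Definition ut_adversary_qpt (R : realType) (FC : fclass) (U : utskfe R FC)
    (A : ut_adversary U) : Prop :=
  poly_bounded (fun l => msize (uta_A1 A l) + msize (uta_A2 A l)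
                         + msize (uta_B A l))%N.

(* Single-ciphertext: there is no encryption oracle in either stage.
   The queries of A must satisfy f(m0) = f(m1); those of B only f \in [funs].
   B shares no register with A: it only receives the measured string t2.2. *)
Definition ut_game (R : realType) (FC : fclass) (U : utskfe R FC)
    (A : ut_adversary U) (b : bool) (l : nat) : ens R void (bool * bool) :=
  let* msk, r0 := draw (ut_setup U (l := l)) (unit_op R) in
  let O := opt_oracle (ut_keygen U msk) in
  let* t1, r1 := interact (uta_A1 A l) O (zerob void) r0 in
  let m0 := fstb t1.2 in
  let m1 := sndb t1.2 in
  let* t2, r2 := interact (uta_A2 A l) O (zerob void)
                   (tens r1 (ut_enc U msk (if b then m1 else m0))) in
  let* t3, r3 := interact (uta_B A l) O t2.2 r2 in
  let fsA := pmap (@optb _) (t1.1 ++ t2.1) in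
  let fsB := pmap (@optb _) t3.1 in
  ret (valid_challenge m0 m1 fsA && all (fun f => f \in funs FC l) fsB, t3.2 tt) r3.

Definition ut_admissible (R : realType) (FC : fclass) (U : utskfe R FC)
    (A : ut_adversary U) : Prop :=
  forall b l, Pr (ut_game A b l) (fun r => ~~ r.1) = 0.

Definition utskfe_single_ct_ut_secure (R : realType) (FC : fclass)
    (U : utskfe R FC) : Prop :=
  forall A : ut_adversary U, ut_adversary_qpt A -> ut_admissible A ->
    negligible (fun l => Pr (ut_game A false l) (fun r => r.2)
                         - Pr (ut_game A true l) (fun r => r.2)).

(* Main.v *)
(* After A has output the classical string st, the key queries of B can be answered
   one at a time by FE encryptions of 0 instead of encryptions of SKFE keys.  The
   replacement of one answer is undetectable by UTK security: the UTK adversary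
   samples msk_SKFE, plays A, receives the challenge ciphertext as the function key
   of G[ct_SKFE], and hands st over, together with pk and msk_SKFE, to its second
   stage, which plays B; no quantum state has to be transmitted.  Once all answers
   to B are independent of the SKFE scheme, an SKFE adversary which samples the FE
   keys itself can play the whole experiment, asking only the key queries of A.

   The adversaries are circuits.  A channel is implementable if it is composed of
   gates, fresh ancillas, relabellings and partial traces, which brings it into the
   form of an algorithm; classical data are kept in registers in which the state is
   block diagonal, so that a sequence of steps acts blockwise and the experiments
   become finite sums to which linearity applies.  Filtering the answers of the
   oracle by a predicate on the query amounts to keeping only the branches whose
   whole log satisfies it. *)

From mathcomp Require Import all_boot all_order all_algebra.
From mathcomp Require Import reals boolp.
From mathcomp.real_closed Require Import complex.
From mathcomp Require Import ring zify.
Require Import Defs.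

Set Implicit Arguments.
Unset Strict Implicit.
Unset Printing Implicit Defensive.

Import Order.TTheory GRing.Theory Num.Theory.
Local Open Scope ring_scope.

(** * Bit registers and gates *)

(** The obstacle is that B may ask for keys that separate the two messages, so SKFE security says
    nothing while its answers still carry SKFE keys. UTK security imposes no relation between f(m0)
    and f(m1): an FE ciphertext of a working SKFE key can be traded for one of 0 even though the
    function key of [G[ct]] would tell them apart, because the second stage no longer holds that
    key. Each of the two experiments is moved to its all-zero form separately, with the bit b built
    into the UTK adversary, and SKFE security only compares the two all-zero forms. The SKFE
    adversary must be admissible with error exactly 0, which does not follow from
    indistinguishability. It is derived from positivity of the states and from trace preservation:
    what B does with the string st cannot alter the weight of the branches in which A misbehaved.
    Every circuit built here has size at most quadratic in one parameter [sz]: the number of rounds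
    times the cost of simulating one oracle answer. *)

Lemma fstb_pairb (I J : finType) (x : bits I) (y : bits J) : fstb (pairb x y) = x.
Proof. by apply/ffunP => i; rewrite !ffunE. Qed.

Lemma sndb_pairb (I J : finType) (x : bits I) (y : bits J) : sndb (pairb x y) = y.
Proof. by apply/ffunP => i; rewrite !ffunE. Qed.

Lemma pairb_surj (I J : finType) (u : bits (I + J)) : pairb (fstb u) (sndb u) = u.
Proof. by apply/ffunP => -[i|j]; rewrite !ffunE. Qed.

Lemma pairb_eqE (I J : finType) (u v : bits (I + J)) :
  (u == v) = (fstb u == fstb v) && (sndb u == sndb v).
Proof.
apply/eqP/andP => [->|[/eqP e1 /eqP e2]]; first by rewrite !eqxx.
by rewrite -(pairb_surj u) e1 e2 pairb_surj.
Qed.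

Lemma pairb_eq2 (I J : finType) (x x' : bits I) (y y' : bits J) :
  (pairb x y == pairb x' y') = (x == x') && (y == y').
Proof. by rewrite pairb_eqE !fstb_pairb !sndb_pairb. Qed.

Lemma big_pairb (V : nmodType) (I J : finType) (P : pred (bits (I + J)))
    (F : bits (I + J) -> V) :
  \sum_(u | P u) F u = \sum_x \sum_(y | P (pairb x y)) F (pairb x y).
Proof.
rewrite pair_big_dep /= (reindex (fun p : bits I * bits J => pairb p.1 p.2)) //=.
exists (fun u => (fstb u, sndb u)) => [[x y] _|u _] /=.
  by rewrite fstb_pairb sndb_pairb.
exact: pairb_surj.
Qed.

Lemma bits_void (u : bits void) : u = zerob void.
Proof. by apply/ffunP => -[]. Qed.

Lemma big_void (V : nmodType) (F : bits void -> V) : \sum_u F u = F (zerob void).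
Proof.
rewrite (bigD1 (zerob void)) //= big1 ?addr0 // => u.
by rewrite (bits_void u) eqxx.
Qed.

Lemma pullE (I J : finType) (h : J -> I) (u : bits I) j : pull h u j = u (h j).
Proof. exact: ffunE. Qed.

Lemma pull_comp (I J K : finType) (h : J -> I) (h' : K -> J) (u : bits I) :
  pull h' (pull h u) = pull (h \o h') u.
Proof. by apply/ffunP => k; rewrite !ffunE. Qed.

Lemma pull_can (I J : finType) (h : J -> I) (h' : I -> J) :
  cancel h h' -> cancel (pull h') (pull h).
Proof. by move=> hK u; apply/ffunP => i; rewrite !ffunE hK. Qed.

Lemma pull_bij (I J : finType) (h : J -> I) : bijective h -> bijective (pull h).
Proof. by case=> h' hK hK'; exists (pull h'); exact: pull_can. Qed.

Lemma big_pull (V : nmodType) (I J : finType) (h : I -> J) (P : pred (bits I))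
    (F : bits I -> V) : bijective h ->
  \sum_(u : bits J | P (pull h u)) F (pull h u) = \sum_(u : bits I | P u) F u.
Proof.
by move=> bh; rewrite [RHS](reindex (pull h)) //; exact/onW_bij/pull_bij.
Qed.

Definition gmap (V W : Type) (h : V -> W) (g : gate V) : gate W :=
  match g with
  | Had t => Had (h t)
  | Tgate t => Tgate (h t)
  | Not t => Not (h t)
  | Cnot c t => Cnot (h c) (h t)
  | Toffoli c d t => Toffoli (h c) (h d) (h t)
  end.

Lemma gmap_comp (U V W : Type) (h : V -> W) (h' : U -> V) g :
  gmap h (gmap h' g) = gmap (h \o h') g.
Proof. by case: g. Qed.

Lemma gmap_id (V : Type) (g : gate V) : gmap id g = g.
Proof. by case: g. Qed.

(** * Operators on registers and the elementary steps of a circuit *)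

Section Ops.
Variable R : realType.
Implicit Types (I J K P Q W A B E : finType).

Lemma gate_mx_pull I J (h : I -> J) (g : gate I) (u v : bits J) : bijective h ->
  gate_mx R (gmap h g) u v = gate_mx R g (pull h u) (pull h v).
Proof.
move=> bh; have [h' hK hK'] := bh; have inj := bij_inj (pull_bij bh).
have hi := bij_inj bh.
have flipE c t (w : bits J) : pull h (flip_if c (h t) w) = flip_if c t (pull h w).
  by apply/ffunP => i; rewrite !ffunE (inj_eq hi).
case: g => [t|t|t|c t|c d t] /=.
- rewrite !pullE; congr (if _ then _ else _).
  apply/forallP/forallP => H w.
    by have := H (h w); rewrite !pullE (inj_eq hi).
  by have := H (h' w); rewrite !pullE hK' -(inj_eq hi) hK'.
- by rewrite !pullE (inj_eq inj).
- by rewrite -flipE (inj_eq inj).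
- by rewrite !pullE -(inj_eq inj) flipE (inj_eq hi).
- by rewrite !pullE -(inj_eq inj) flipE !(inj_eq hi).
Qed.

Lemma gate_mx_inl I J (g : gate I) (u v : bits (I + J)) :
  gate_mx R (gmap (@inl I J) g) u v =
  (sndb u == sndb v)%:R * gate_mx R g (fstb u) (fstb v).
Proof.
have flipE c t (w : bits (I + J)) :
    flip_if c (inl t) w = pairb (flip_if c t (fstb w)) (sndb w).
  by apply/ffunP => -[i|j]; rewrite !ffunE //= addbF.
have E c t (w : bits (I + J)) : (u == flip_if c (inl t) w) =
    (sndb u == sndb w) && (fstb u == flip_if c t (fstb w)).
  by rewrite flipE pairb_eqE fstb_pairb sndb_pairb andbC.
case: g => [t|t|t|c t|c d t] /=; rewrite ?E -?mulnb ?natrM ?ffunE //.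
- have -> : [forall w, (w != inl t) ==> (u w == v w)] =
    (sndb u == sndb v) && [forall w, (w != t) ==> (fstb u w == fstb v w)].
    apply/forallP/andP => [H|[/eqP e /forallP H] [w|w]].
    - split; first by apply/eqP/ffunP => j; rewrite !ffunE; exact/eqP/(H (inr j)).
      by apply/forallP => w; have := H (inl w); rewrite !ffunE.
    - by have := H w; rewrite !ffunE.
    - by have /ffunP/(_ w) := e; rewrite !ffunE => ->; rewrite eqxx implybT.
  by case: (_ == _) => /=; rewrite ?mul1r ?mul0r.
- rewrite pairb_eqE andbC.
  by case: (_ == _) => /=; rewrite ?mul1r ?mul0r.
Qed.

Definition relabel I J (h : I -> J) (rho : op R I) : op R J :=
  fun u u' => rho (pull h u) (pull h u').

Definition ptr Q E (rho : op R (Q + E)) : op R Q :=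
  fun z z' => \sum_e rho (pairb z e) (pairb z' e).

Definition anc_op Q A (rho : op R Q) : op R (Q + A) :=
  fun u u' => ((sndb u == zerob A) && (sndb u' == zerob A))%:R
              * rho (fstb u) (fstb u').

Arguments anc_op {Q} A rho.

Lemma opP Q (r s : op R Q) : (forall u u', r u u' = s u u') -> r = s.
Proof. by move=> h; apply/funext => u; apply/funext => u'. Qed.

Lemma apply_gate_rel I J (h : I -> J) (g : gate I) (rho : op R I) : bijective h ->
  apply_gate (relabel h rho) (gmap h g) = relabel h (apply_gate rho g).
Proof.
move=> bh; apply/opP => u u'; rewrite /relabel /apply_gate -(big_pull predT _ bh).
apply: eq_bigr => v _; rewrite -[RHS](big_pull predT _ bh).
by apply: eq_bigr => v' _; rewrite !gate_mx_pull.
Qed.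

Lemma apply_gate_inl I J (g : gate I) (rho : op R (I + J)) w w' :
  apply_gate rho (gmap (@inl I J) g) w w' =
  apply_gate (fun v v' => rho (pairb v (sndb w)) (pairb v' (sndb w'))) g
    (fstb w) (fstb w').
Proof.
rewrite /apply_gate big_pairb; apply: eq_bigr => v _.
rewrite (bigD1 (sndb w)) //= [X in _ + X]big1 ?addr0; last first.
  move=> a ne; apply: big1 => v' _; rewrite gate_mx_inl sndb_pairb eq_sym.
  by rewrite (negbTE ne) !mul0r.
rewrite big_pairb; apply: eq_bigr => v' _.
rewrite (bigD1 (sndb w')) //= [X in _ + X]big1 ?addr0; last first.
  move=> a ne; rewrite [gate_mx _ _ w' _]gate_mx_inl sndb_pairb eq_sym.
  by rewrite (negbTE ne) mul0r conjc0 mulr0.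
by rewrite !gate_mx_inl !sndb_pairb !fstb_pairb !eqxx !mul1r.
Qed.

Definition lincomb Q (X : finType) (c : X -> R[i]) (r : X -> op R Q) : op R Q :=
  fun u u' => \sum_x c x * r x u u'.

(** Stated for finite linear combinations at once, so that one rewriting pulls a sum over classical
    outcomes, with its weights, out of a channel. *)
Definition linear_op Q Q' (T : op R Q -> op R Q') : Prop :=
  forall (X : finType) c (r : X -> op R Q),
    T (lincomb c r) = lincomb c (fun x => T (r x)).

Lemma lin_gate Q (g : gate Q) : linear_op (fun rho => apply_gate rho g).
Proof.
move=> X c r; apply/opP => u u'; rewrite /apply_gate /lincomb.
under [RHS]eq_bigr do (rewrite mulr_sumr; under eq_bigr do rewrite mulr_sumr).
rewrite [RHS]exchange_big /=; apply: eq_bigr => v _.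
rewrite [RHS]exchange_big /=; apply: eq_bigr => v' _.
rewrite mulr_sumr mulr_suml; apply: eq_bigr => x _.
by rewrite !mulrA [_ * c x]mulrC.
Qed.

Lemma lin_rel I J (h : I -> J) : linear_op (relabel h).
Proof. by []. Qed.

Lemma lin_ptr Q E : linear_op (@ptr Q E).
Proof.
move=> X c r; apply/opP => u u'; rewrite /ptr /lincomb exchange_big /=.
by apply: eq_bigr => x _; rewrite mulr_sumr.
Qed.

Lemma lin_anc Q A : linear_op (@anc_op Q A).
Proof.
move=> X c r; apply/opP => u u'; rewrite /anc_op /lincomb mulr_sumr.
by apply: eq_bigr => x _; rewrite mulrCA.
Qed.

Lemma lin_comp Q Q' Q'' (T : op R Q -> op R Q') (T' : op R Q' -> op R Q'') :
  linear_op T -> linear_op T' -> linear_op (T' \o T).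
Proof. by move=> h h' X c r /=; rewrite h h'. Qed.

(* The number counts gates and ancillas. *)
Inductive impl Q : forall Q', nat -> (op R Q -> op R Q') -> Prop :=
| ImplId : impl 0 (fun rho : op R Q => rho)
| ImplGate Q' n (C : op R Q -> op R Q') (g : gate Q') :
    impl n C -> impl n.+1 (fun rho => apply_gate (C rho) g)
| ImplAnc Q' n (C : op R Q -> op R Q') A :
    impl n C -> impl (n + #|A|) (fun rho => anc_op A (C rho))
| ImplRel Q' Q'' n (C : op R Q -> op R Q') (h : Q' -> Q'') :
    bijective h -> impl n C -> impl n (fun rho => relabel h (C rho))
| ImplPtr Q' E n (C : op R Q -> op R (Q' + E)) :
    impl n C -> impl n (fun rho => ptr (C rho))
| ImplLe Q' n m (C : op R Q -> op R Q') : (n <= m)%N -> impl n C -> impl m C.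

Lemma impl_comp Q Q' Q'' n n' (C : op R Q -> op R Q') (C' : op R Q' -> op R Q'') :
  impl n C -> impl n' C' -> impl (n + n') (fun rho => C' (C rho)).
Proof.
move=> hC; elim: Q'' n' C' / => [|Q1 n1 C1 g _ IH|Q1 n1 C1 A _ IH|Q1 Q2 n1 C1 h bh _ IH|Q1 E n1 C1 _ IH|Q1 n1 n2 C1 le _ IH].
- by rewrite addn0.
- by rewrite addnS; exact: (ImplGate g).
- by rewrite addnA; exact: (ImplAnc A).
- exact: ImplRel.
- exact: (ImplPtr IH).
- by apply: ImplLe IH; rewrite leq_add2l.
Qed.

Lemma lin_impl Q Q' n (C : op R Q -> op R Q') : impl n C -> linear_op C.
Proof.
elim: Q' n C / => [|Q1 n1 C1 g _ IH|Q1 n1 C1 A _ IH|Q1 Q2 n1 C1 h bh _ IH|Q1 E n1 C1 _ IH|Q1 n1 n2 C1 le _ IH] //.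
- exact: (lin_comp IH (lin_gate g)).
- exact: (lin_comp IH (@lin_anc _ A)).
- exact: (lin_comp IH (@lin_rel _ _ h)).
- exact: (lin_comp IH (@lin_ptr _ E)).
Qed.

End Ops.
Arguments anc_op {R Q} A%_type rho.

Ltac bits_case :=
  match goal with |- forall x : ?T, _ =>
    let T' := eval hnf in T in
    match T' with
    | (_ + _)%type => case; bits_case
    | void => case
    | _ => intro
    end
  end.

Ltac bitsP := apply/ffunP; bits_case; rewrite ?ffunE //=.

Ltac bitsE := by bitsP; rewrite ?ffunE //=.

(** * Unitarity and positivity *)

Definition sum_swap (A B : Type) (x : A + B) : B + A :=
  match x with inl a => inr a | inr b => inl b end.

Lemma sum_swapK (A B : Type) : cancel (@sum_swap A B) (@sum_swap B A).
Proof. by case. Qed.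

Lemma sum_swap_bij (A B : Type) : bijective (@sum_swap A B).
Proof. exact: Bijective (@sum_swapK _ _) (@sum_swapK _ _). Qed.

Section Unitary.
Variable R : realType.
Implicit Types (I J K P Q W A B E : finType).

Definition gate_perm W (g : gate W) (u : bits W) : bits W :=
  match g with
  | Not t => flip_if true t u
  | Cnot c t => flip_if ((c != t) && u c) t u
  | Toffoli c d t => flip_if [&& c != t, d != t, u c & u d] t u
  | _ => u
  end.

Definition classical_gate W (g : gate W) : bool :=
  match g with Had _ | Tgate _ => false | _ => true end.

Lemma flip_ifK W c (t : W) (u : bits W) : flip_if c t (flip_if c t u) = u.
Proof. by apply/ffunP => w; rewrite !ffunE -addbA addbb addbF. Qed.

Lemma gate_permK W (g : gate W) : involutive (gate_perm g).
Proof.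
have flipF c (t w : W) u : w != t -> flip_if c t u w = u w.
  by move=> ne; rewrite ffunE (negbTE ne) addbF.
case: g => //= [t|c t|c d t] u; first exact: flip_ifK.
- case: (eqVneq c t) => [->|ne] /=; first by rewrite eqxx flip_ifK.
  by rewrite flipF // flip_ifK.
- case: (eqVneq c t) => [->|ne] /=; first by rewrite eqxx flip_ifK.
  case: (eqVneq d t) => [->|ne'] /=; first by rewrite ?eqxx ?andbF flip_ifK.
  by rewrite !flipF // flip_ifK.
Qed.

Lemma gate_mx_perm W (g : gate W) u v : classical_gate g ->
  gate_mx R g u v = (u == gate_perm g v)%:R.
Proof. by case: g. Qed.

(** Each of the two sums keeps a single term; since [gate_perm] is an involution, no inverse
    permutation appears. *)
Lemma apply_gate_perm W (g : gate W) (rho : op R W) : classical_gate g ->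
  apply_gate rho g = fun u u' => rho (gate_perm g u) (gate_perm g u').
Proof.
move=> cg; apply/opP => u u'; rewrite /apply_gate.
have E u0 v : (u0 == gate_perm g v) = (v == gate_perm g u0).
  by rewrite -(inj_eq (inv_inj (gate_permK g))) gate_permK eq_sym.
rewrite (bigD1 (gate_perm g u)) //= [X in _ + X]big1 ?addr0 => [|v ne]; last first.
  by apply: big1 => v' _; rewrite gate_mx_perm // E (negbTE ne) !mul0r.
rewrite (bigD1 (gate_perm g u')) //= [X in _ + X]big1 ?addr0 => [|v ne]; last first.
  by rewrite [gate_mx _ _ u' _]gate_mx_perm // E (negbTE ne) conjc0 mulr0.
by rewrite !gate_mx_perm // !gate_permK !eqxx conjc1 mul1r mulr1.
Qed.

Lemma sqr_half_sqrt2 : let r : R := (Num.sqrt 2)^-1 in r * r + r * r = 1.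
Proof.
move=> r; have h : r * r = 2^-1 by rewrite -expr2 exprVn sqr_sqrtr.
by rewrite h [RHS](splitr 1) mul1r.
Qed.

Lemma conjc_mul (x y : R[i]) : conjc (x * y) = conjc x * conjc y.
Proof. exact: rmorphM. Qed.

Lemma phase_conj (r : R) : r * r + r * r = 1 -> (r +i* r)%C * conjc (r +i* r)%C = 1 :> R[i].
Proof.
move=> rr; apply/eqP; rewrite eq_complex /=; apply/andP; split; apply/eqP.
  by rewrite mulrN opprK.
by rewrite mulrN addNr.
Qed.

(** A classical gate has one nonzero entry per column and [Tgate] is diagonal with entries of
    modulus 1; only [Had] needs the interference of two rows. *)
Lemma gate_mx_unitary W (g : gate W) (v v' : bits W) :
  \sum_u gate_mx R g u v * conjc (gate_mx R g u v') = (v == v')%:R.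
Proof.
have rr := sqr_half_sqrt2.
have [cg|] := boolP (classical_gate g).
  rewrite (bigD1 (gate_perm g v)) //= big1 ?addr0 => [|u ne]; last first.
    by rewrite gate_mx_perm // (negbTE ne) mul0r.
  by rewrite !gate_mx_perm // eqxx mul1r (inj_eq (inv_inj (gate_permK g))) conjc_nat.
case: g => // [t _|t _]; last first.
  rewrite /= (bigD1 v) //= big1 ?addr0 => [|u ne]; last first.
    by rewrite (negbTE ne) mul0r.
  rewrite eqxx; case: (eqVneq v v') => _; last by rewrite conjc0 mulr0.
  case: ifP => _; last by rewrite conjc1 mulr1.
  exact: phase_conj.
(* If [v] and [v'] differ away from the target, no row meets both columns. *)
have [H|H] := boolP [forall w, (w != t) ==> (v w == v' w)]; last first.
  have -> : (v == v') = false.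
    by apply: contraNF H => /eqP ->; apply/forallP => w; rewrite eqxx implybT.
  rewrite big1 // => u _ /=; case: ifP => [/forallP h1|_]; last by rewrite mul0r.
  case: ifP => [/forallP h2|_]; last by rewrite conjc0 mulr0.
  case/negP: H; apply/forallP => w; apply/implyP => ne.
  by rewrite -(eqP (implyP (h1 w) ne)) (implyP (h2 w) ne).
(* Only two rows reach both columns: those that agree with [v] away from [t]. *)
pose s b : bits W := [ffun w => if w == t then b else v w].
have sT b : s b t = b by rewrite ffunE eqxx.
have sP b : [forall w, (w != t) ==> (s b w == v w)].
  by apply/forallP => w; apply/implyP => ne; rewrite ffunE (negbTE ne).
have sP' b : [forall w, (w != t) ==> (s b w == v' w)].
  apply/forallP => w; apply/implyP => ne; rewrite ffunE (negbTE ne).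
  exact: (implyP (forallP H w)).
have ne : s true != s false by apply/eqP => /ffunP/(_ t); rewrite !sT.
rewrite (bigD1 (s true)) // (bigD1 (s false)) /=; last by rewrite eq_sym.
rewrite big1 ?addr0 => [|u /andP[n1 n2]]; last first.
  case: ifP => [/forallP h|_]; last by rewrite mul0r.
  have us : u = s (u t).
    apply/ffunP => w; rewrite ffunE; case: eqVneq => [->//|ne'].
    exact/eqP/(implyP (h w)).
  by case: (u t) us n1 n2 => ->; rewrite eqxx.
rewrite !sP !sP' !sT !andTb !andFb.
have -> : (v == v') = (v t == v' t).
  apply/eqP/eqP => [->//|e]; apply/ffunP => w; case: (eqVneq w t) => [->//|ne'].
  exact/eqP/(implyP (forallP H w)).
have sg (b : bool) : conjc ((-1) ^+ b) = (-1) ^+ b :> R[i].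
  by rewrite (rmorphXn (@conjc R)) (rmorphN1 (@conjc R)).
set r := (_^-1)%R; rewrite !conjc_mul !sg !expr0 ?conjc1 ?mulr1.
have E : (r%:C)%C * conjc (r%:C)%C + (r%:C)%C * conjc (r%:C)%C = 1 :> R[i].
  by rewrite conjc_real -!rmorphM -rmorphD rr.
case: (v t); case: (v' t);
  by rewrite ?andbT ?andbF ?expr0 ?expr1 ?mulrN1 ?mulr1 ?mulrNN ?mulrN ?mulNr ?subrr ?addNr //.
Qed.

Lemma tr_gate Q (g : gate Q) (rho : op R Q) : tr (apply_gate rho g) = tr rho.
Proof.
rewrite /tr /apply_gate exchange_big /=; apply: eq_bigr => v _.
rewrite exchange_big /= (bigD1 v) //= [X in _ + X]big1 => [|v' ne].
  under eq_bigr => u _ do rewrite mulrAC.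
  by rewrite -mulr_suml gate_mx_unitary eqxx mul1r addr0.
under eq_bigr => u _ do rewrite mulrAC.
by rewrite -mulr_suml gate_mx_unitary eq_sym (negbTE ne) mul0r.
Qed.

Lemma tr_rel I J (h : I -> J) (rho : op R I) : bijective h -> tr (relabel h rho) = tr rho.
Proof. by move=> bh; rewrite /tr -(big_pull predT _ bh). Qed.

Lemma tr_ptr Q E (rho : op R (Q + E)) : tr (ptr rho) = tr rho.
Proof. by rewrite /tr big_pairb. Qed.

Lemma tr_anc Q A (rho : op R Q) : tr (anc_op A rho) = tr rho.
Proof.
rewrite /tr big_pairb; apply: eq_bigr => u _.
rewrite (bigD1 (zerob A)) //= big1 => [|a ne].
  by rewrite /anc_op fstb_pairb sndb_pairb eqxx mul1r addr0.
by rewrite /anc_op sndb_pairb (negbTE ne) mul0r.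
Qed.

Lemma tr_impl Q Q' n (C : op R Q -> op R Q') rho : impl n C -> tr (C rho) = tr rho.
Proof.
elim: Q' n C / => [|Q1 n1 C1 g _ IH|Q1 n1 C1 A _ IH|Q1 Q2 n1 C1 h bh _ IH|Q1 E n1 C1 _ IH|Q1 n1 n2 C1 le _ IH] //.
- by rewrite tr_gate.
- by rewrite tr_anc.
- by rewrite tr_rel.
- by rewrite tr_ptr.
Qed.

(** Positivity matters because [Pr] only adds up traces: without it, illegal branches could cancel
    each other in an admissibility condition. *)
Definition psd Q (rho : op R Q) : Prop :=
  forall x : bits Q -> R[i], 0 <= \sum_u \sum_u' conjc (x u) * rho u u' * x u'.

Lemma psd_gate Q (g : gate Q) (rho : op R Q) : psd rho -> psd (apply_gate rho g).
Proof.
move=> h x; have := h (fun v => \sum_u conjc (gate_mx R g u v) * x u).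
set s := (X in 0 <= X) => hs; set t := (X in 0 <= X).
suff -> : t = s by [].
rewrite /t /s /apply_gate !pair_big /=.
transitivity (\sum_(p : bits Q * bits Q) \sum_(q : bits Q * bits Q)
   conjc (x p.1) * (gate_mx R g p.1 q.1 * rho q.1 q.2 * conjc (gate_mx R g p.2 q.2)) * x p.2).
  by apply: eq_bigr => p _; rewrite pair_big /= mulr_sumr mulr_suml.
rewrite exchange_big /=; apply: eq_bigr => q _.
rewrite rmorph_sum /= mulrAC big_distrlr /= pair_big /= mulr_suml.
apply: eq_bigr => p _; rewrite conjc_mul conjcK; ring.
Qed.

Lemma psd_rel I J (h : I -> J) (rho : op R I) : bijective h -> psd rho -> psd (relabel h rho).
Proof.
case=> h' hK hK' H x; have bh' : bijective h' by exists h.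
rewrite (reindex (pull h')) /=; last exact/onW_bij/pull_bij.
have := H (x \o pull h'); congr (0 <= _); apply: eq_bigr => u _.
rewrite [RHS](reindex (pull h')) /=; last exact/onW_bij/pull_bij.
by apply: eq_bigr => u' _; rewrite /relabel !(pull_can hK).
Qed.

Lemma psd_anc Q A (rho : op R Q) : psd rho -> psd (anc_op A rho).
Proof.
move=> H x; have := H (fun u => x (pairb u (zerob A))).
congr (0 <= _); rewrite big_pairb; apply: eq_bigr => u _.
rewrite (bigD1 (zerob A)) //= [X in _ = _ + X]big1 ?addr0 => [|a ne]; last first.
  by apply: big1 => u' _; rewrite /anc_op sndb_pairb (negbTE ne) mul0r mulr0 mul0r.
rewrite big_pairb; apply: eq_bigr => u' _.
rewrite (bigD1 (zerob A)) //= [X in _ = _ + X]big1 ?addr0 => [|a ne]; last first.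
  by rewrite /anc_op !sndb_pairb (negbTE ne) andbF mul0r mulr0 mul0r.
by rewrite /anc_op !sndb_pairb !fstb_pairb eqxx mul1r.
Qed.

(** The form of the partial trace is a sum over [e] of forms of [rho], taken at test vectors
    supported where E holds [e]. *)
Lemma psd_ptr Q E (rho : op R (Q + E)) : psd rho -> psd (ptr rho).
Proof.
move=> H x.
have -> : \sum_u \sum_u' conjc (x u) * ptr rho u u' * x u' =
   \sum_e \sum_u \sum_u' conjc (x u) * rho (pairb u e) (pairb u' e) * x u'.
  rewrite [RHS]exchange_big /=; apply: eq_bigr => u _; rewrite [RHS]exchange_big /=.
  by apply: eq_bigr => u' _; rewrite /ptr mulr_sumr mulr_suml.
apply: sumr_ge0 => e _; have := H (fun w => (sndb w == e)%:R * x (fstb w)).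
congr (0 <= _); rewrite big_pairb; apply: eq_bigr => u _.
rewrite (bigD1 e) //= [X in _ + X = _]big1 ?addr0 => [|a ne]; last first.
  apply: big1 => u' _; rewrite sndb_pairb (negbTE ne) mul0r conjc0 !mul0r //.
rewrite big_pairb; apply: eq_bigr => u' _.
rewrite (bigD1 e) //= [X in _ + X = _]big1 ?addr0 => [|a ne]; last first.
  by rewrite !sndb_pairb (negbTE ne) mul0r mulr0.
by rewrite !sndb_pairb !fstb_pairb eqxx !mul1r.
Qed.

Lemma psd_impl Q Q' n (C : op R Q -> op R Q') rho : impl n C -> psd rho -> psd (C rho).
Proof.
move=> hC h; elim: Q' n C / hC => [|Q1 n1 C1 g _ IH|Q1 n1 C1 A _ IH|Q1 Q2 n1 C1 k bh _ IH|Q1 E n1 C1 _ IH|Q1 n1 n2 C1 le _ IH] //.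
- exact: psd_gate.
- exact: psd_anc.
- exact: psd_rel.
- exact: psd_ptr.
Qed.

Lemma psd_tr Q (rho : op R Q) : psd rho -> 0 <= tr rho.
Proof.
move=> h; apply: sumr_ge0 => u _; have := h (fun v => (v == u)%:R).
rewrite (bigD1 u) //= [X in _ + X]big1 ?addr0 => [|v ne]; last first.
  by apply: big1 => u' _; rewrite (negbTE ne) conjc0 !mul0r.
rewrite (bigD1 u) //= [X in _ + X]big1 ?addr0 => [|v ne]; last first.
  by rewrite (negbTE ne) mulr0.
by rewrite eqxx conjc1 mul1r mulr1.
Qed.

Lemma psd_scale Q (a : R[i]) (rho : op R Q) : 0 <= a -> psd rho -> psd (scale_op a rho).
Proof.
move=> ha h x; have -> : \sum_u \sum_u' conjc (x u) * scale_op a rho u u' * x u' =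
   a * \sum_u \sum_u' conjc (x u) * rho u u' * x u'.
  rewrite mulr_sumr; apply: eq_bigr => u _; rewrite mulr_sumr; apply: eq_bigr => u' _.
  by rewrite /scale_op; ring.
exact: mulr_ge0.
Qed.

Lemma psd_unit : psd (unit_op R).
Proof. by move=> x; rewrite !big_void /unit_op mulr1 mulrC mulcJ_ge0. Qed.

(** The identity of P tensored with [C], written blockwise: [C] is applied to the block of [rho] at
    each pair of values of P, off-diagonal pairs included, so that coherence between P and Q
    survives. *)
Definition idle P Q Q' (C : op R Q -> op R Q') (rho : op R (P + Q)) : op R (P + Q') :=
  fun w w' => C (fun v v' => rho (pairb (fstb w) v) (pairb (fstb w') v')) (sndb w) (sndb w').

Lemma apply_gate_inr I J (g : gate J) (rho : op R (I + J)) w w' :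
  apply_gate rho (gmap (@inr I J) g) w w' =
  apply_gate (fun v v' => rho (pairb (fstb w) v) (pairb (fstb w') v')) g
    (sndb w) (sndb w').
Proof.
have -> : gmap (@inr I J) g = gmap (@sum_swap J I) (gmap inl g) by rewrite gmap_comp.
have -> : rho = relabel (@sum_swap J I) (relabel (@sum_swap I J) rho).
  by apply/opP => u u'; rewrite /relabel !(pull_can (@sum_swapK _ _)).
rewrite apply_gate_rel; last exact: sum_swap_bij.
rewrite /relabel apply_gate_inl. 
have E1 (x : bits (I + J)) : fstb (pull (@sum_swap J I) x) = sndb x by bitsE.
have E2 (x : bits (I + J)) v : pull (@sum_swap I J) (pairb v (sndb (pull (@sum_swap J I) x))) = pairb (fstb x) v by bitsE.
have E3 (x : bits (I + J)) : pull (@sum_swap I J) (pull (@sum_swap J I) x) = x by bitsE.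
by rewrite !E1; congr (apply_gate _ _ _ _); apply/opP => v v'; rewrite !E2 !E3.
Qed.

End Unitary.

(** * Channels of circuits *)

Section Circuits.
Variable R : realType.
Implicit Types (I J K P Q W A B E : finType).

Definition sum_assoc A B E (x : A + B + E) : A + (B + E) :=
  match x with inl (inl a) => inl a | inl (inr b) => inr (inl b) | inr e => inr (inr e) end.
Definition sum_assocV A B E (x : A + (B + E)) : A + B + E :=
  match x with inl a => inl (inl a) | inr (inl b) => inl (inr b) | inr (inr e) => inr e end.

Lemma sum_assocK A B E : cancel (@sum_assoc A B E) (@sum_assocV A B E).
Proof. by do 2?case. Qed.
Lemma sum_assocVK A B E : cancel (@sum_assocV A B E) (@sum_assoc A B E).
Proof. by do 2?case. Qed.
Lemma sum_assoc_bij A B E : bijective (@sum_assoc A B E).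
Proof. exact: Bijective (@sum_assocK _ _ _) (@sum_assocVK _ _ _). Qed.
Lemma sum_assocV_bij A B E : bijective (@sum_assocV A B E).
Proof. exact: Bijective (@sum_assocVK _ _ _) (@sum_assocK _ _ _). Qed.

Definition sum_map A A' B B' (f : A -> A') (g : B -> B') (x : A + B) : A' + B' :=
  match x with inl a => inl (f a) | inr b => inr (g b) end.

Lemma sum_map_bij A A' B B' (f : A -> A') (g : B -> B') :
  bijective f -> bijective g -> bijective (sum_map f g).
Proof.
move=> [f' fK f'K] [g' gK g'K]; exists (sum_map f' g') => -[x|x] /=;
by rewrite ?fK ?f'K ?gK ?g'K.
Qed.

Lemma pull_sum_map A A' B B' (f : A -> A') (g : B -> B') (u : bits (A' + B')) :
  pull (sum_map f g) u = pairb (pull f (fstb u)) (pull g (sndb u)).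
Proof. bitsE. Qed.

Lemma pull_assoc A B E (u : bits (A + (B + E))) :
  pull (@sum_assoc A B E) u = pairb (pairb (fstb u) (fstb (sndb u))) (sndb (sndb u)).
Proof. bitsE. Qed.

Lemma pull_assocV A B E (u : bits (A + B + E)) :
  pull (@sum_assocV A B E) u = pairb (fstb (fstb u)) (pairb (sndb (fstb u)) (sndb u)).
Proof. bitsE. Qed.

(** Each step in the construction of [C] becomes the same step on the larger register, up to a
    relabelling, which costs nothing. *)
Lemma impl_idle P Q Q' n (C : op R Q -> op R Q') : impl n C -> impl n (@idle R P Q Q' C).
Proof.
elim: Q' n C / => [|Q1 n1 C1 g _ IH|Q1 n1 C1 A _ IH|Q1 Q2 n1 C1 h bh _ IH|Q1 E n1 C1 _ IH|Q1 n1 n2 C1 le _ IH].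
- have -> : idle (P := P) (fun rho : op R Q => rho) = fun rho => rho.
    by apply/funext => rho; apply/opP => u u'; rewrite /idle !pairb_surj.
  exact: ImplId.
- have -> : idle (P := P) (fun rho => apply_gate (C1 rho) g) =
            fun rho => apply_gate (idle C1 rho) (gmap inr g).
    apply/funext => rho; apply/opP => u u'; rewrite apply_gate_inr /idle.
    by congr (apply_gate _ _ _ _); apply/opP => v v'; rewrite !sndb_pairb !fstb_pairb.
  exact: ImplGate.
- have -> : idle (P := P) (fun rho => anc_op A (C1 rho)) =
            fun rho => relabel (@sum_assoc P Q1 A) (anc_op A (idle C1 rho)).
    apply/funext => rho; apply/opP => u u'; rewrite /relabel /anc_op /idle.
    by rewrite !pull_assoc !(fstb_pairb, sndb_pairb).
  by apply: ImplRel; [exact: sum_assoc_bij | exact: ImplAnc].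
- have -> : idle (P := P) (fun rho => relabel h (C1 rho)) =
            fun rho => relabel (sum_map id h) (idle C1 rho).
    apply/funext => rho; apply/opP => u u'; rewrite /relabel /idle !pull_sum_map.
    by rewrite !(fstb_pairb, sndb_pairb); congr (C1 _ _ _); apply/opP => v v'; congr (rho _ _); bitsE.
  by apply: ImplRel => //; apply: sum_map_bij => //; exists id.
- have -> : idle (P := P) (fun rho => ptr (C1 rho)) =
            fun rho => ptr (relabel (@sum_assocV P Q1 E) (idle C1 rho)).
    apply/funext => rho; apply/opP => u u'; rewrite /ptr /relabel /idle.
    by apply: eq_bigr => e _; rewrite !pull_assocV !(fstb_pairb, sndb_pairb).
  by apply/ImplPtr/ImplRel => //; exact: sum_assocV_bij.
- exact: ImplLe IH.
Qed.

(** * Reversible computation of classical data *)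

Lemma impl_gates Q (gs : seq (gate Q)) :
  impl (size gs) (fun rho : op R Q => foldl (@apply_gate R Q) rho gs).
Proof.
elim/last_ind: gs => [|gs g IH]; first exact: ImplId.
rewrite size_rcons; under [X in impl _ X]funext do rewrite foldl_rcons.
exact: ImplGate.
Qed.

Lemma foldl_gate_perm Q (gs : seq (gate Q)) (rho : op R Q) :
  all (@classical_gate Q) gs ->
  foldl (@apply_gate R Q) rho gs =
  fun u u' => rho (foldr (@gate_perm Q) u gs) (foldr (@gate_perm Q) u' gs).
Proof.
by elim: gs rho => //= g gs IH rho /andP[cg cgs]; rewrite IH // apply_gate_perm.
Qed.

(* [inl c] stands for the constant bit c, [inr (i, j)] for the conjunction of
   the source bits i and j. *)
Definition bspec A B := B -> (bool + A * A)%type.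

Arguments bspec (A B)%_type.

Definition bspec_eval A B (s : bspec A B) (a : bits A) : bits B :=
  [ffun b => match s b with inl c => c | inr cd => a cd.1 && a cd.2 end].

Definition bxor W (u v : bits W) : bits W := [ffun w => u w (+) v w].

Lemma bxorK W (v : bits W) : involutive (fun u => bxor u v).
Proof. by move=> u; apply/ffunP => w; rewrite !ffunE -addbA addbb addbF. Qed.

Definition xorw A B (s : bspec A B) (u : bits (A + B)) : bits (A + B) :=
  pairb (fstb u) (bxor (sndb u) (bspec_eval s (fstb u))).

(** At most one gate per target bit: [Not] for the constant 1, [Toffoli] for a conjunction. The
    conjunction of a bit with itself is a copy. *)
Lemma impl_xor A B (s : bspec A B) :
  impl #|B| (fun rho : op R (A + B) => fun u u' => rho (xorw s u) (xorw s u')).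
Proof.
pose g b : seq (gate (A + B)) := match s b with
  | inl c => if c then [:: Not (inr b)] else [::]
  | inr cd => [:: Toffoli (inl cd.1) (inl cd.2) (inr b)] end.
pose gs := flatten [seq g b | b <- enum B].
have le : (size gs <= #|B|)%N.
  rewrite cardE /gs; elim: (enum B) => //= b bs IH; rewrite size_cat.
  rewrite -[X in (_ <= X)%N]add1n; apply: leq_add IH.
  by rewrite /g; case: (s b) => [[]|].
apply: ImplLe le _; have := impl_gates gs; congr (impl _ _).
apply/funext => rho; rewrite foldl_gate_perm; last first.
  rewrite /gs; elim: (enum B) => //= b bs IH; rewrite all_cat IH andbT /g.
  by case: (s b) => [[]|].
have E u : foldr (@gate_perm _) u gs = xorw s u.
  (* The gates read A and write B, so they can be followed target by target; the absence of
     repetitions in [bs] ensures that no target is treated twice. *)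
  have key bs : uniq bs -> foldr (@gate_perm _) u (flatten [seq g b | b <- bs]) =
    pairb (fstb u) [ffun b => sndb u b (+) ((b \in bs) && bspec_eval s (fstb u) b)].
    elim: bs => [|b bs IH] /=.
      by move=> _; rewrite -[LHS]pairb_surj; congr pairb; apply/ffunP => b; rewrite !ffunE addbF.
    case/andP=> nb ub; rewrite foldr_cat IH //.
    have step c : flip_if c (inr b) (pairb (fstb u)
       [ffun b => sndb u b (+) ((b \in bs) && bspec_eval s (fstb u) b)]) =
       pairb (fstb u) [ffun b' => sndb u b' (+) (((b' \in bs) && bspec_eval s (fstb u) b') (+) ((b' == b) && c))].
      by bitsP; rewrite ?ffunE ?addbF ?addbA.
    rewrite /g; case E: (s b) => [c|[c d]] /=; last rewrite !ffunE.
      have -> : (if c then [:: Not (inr b)] else [::]) = nseq c (Not (@inr A B b)) by case: c {E}.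
      have -> v : foldr (@gate_perm (A + B)%type) v (nseq c (Not (@inr A B b))) = flip_if c (inr b) v.
        by case: c {E} => //=; apply/ffunP => w; rewrite !ffunE andbF addbF.
      rewrite step; congr pairb; apply/ffunP => b'; rewrite !ffunE inE.
      case: eqVneq => [->|_] /=; last by rewrite addbF.
      by rewrite E (negbTE nb).
    rewrite step; congr pairb; apply/ffunP => b'; rewrite !ffunE inE.
    case: eqVneq => [->|_] /=; last by rewrite addbF.
    by rewrite E (negbTE nb) /= !ffunE.
  rewrite key ?enum_uniq // /xorw; congr pairb; apply/ffunP => b.
  by rewrite !ffunE mem_enum.
by apply/opP => u u'; rewrite !E.
Qed.

Definition copy_op A B (s : bspec A B) (rho : op R A) : op R (A + B) :=
  fun u u' => ((sndb u == bspec_eval s (fstb u)) && (sndb u' == bspec_eval s (fstb u')))%:R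
              * rho (fstb u) (fstb u').

(** A copy is a XOR onto fresh zeros; one summand counts the ancillas, the other the gates. *)
Lemma impl_copy A B (s : bspec A B) : impl (#|B| + #|B|) (copy_op s).
Proof.
have := impl_comp (ImplAnc B (ImplId R A)) (impl_xor s); congr (impl _ _).
apply/funext => rho; apply/opP => u u'; rewrite /anc_op /copy_op /xorw.
rewrite !(fstb_pairb, sndb_pairb).
have E (v w : bits B) : (bxor v w == zerob B) = (v == w).
  apply/eqP/eqP => [/ffunP e|->]; apply/ffunP => b; last by rewrite !ffunE addbb.
  by have := e b; rewrite !ffunE; case: (v b); case: (w b).
by rewrite !E.
Qed.

(* Summing over the pairs (u, u') which agree outside of the wires [q] and
   restrict to (z, z') on them amounts to summing over their common part. *)
Lemma big_wires (V : nmodType) Q W (q : Q -> W) (z z' : bits Q)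
    (F : bits W -> bits W -> V) :
  let ins (z : bits Q) : bits W := [ffun w => if [pick k | q k == w] is Some k then z k else false] in
  \sum_(e | (pull q (bxor e (ins z)) == z) && (pull q (bxor e (ins z')) == z'))
     F (bxor e (ins z)) (bxor e (ins z')) =
  \sum_(u | pull q u == z)
  \sum_(u' | (pull q u' == z') && [forall w, (w \notin codom q) ==> (u w == u' w)]) F u u'.
Proof.
move=> ins; rewrite [RHS](reindex (fun e => bxor e (ins z))) /=; last first.
  by apply/onW_bij; exists (fun e => bxor e (ins z)); exact: bxorK.
rewrite big_mkcondr; apply: eq_bigr => e /eqP ez.
have eK w k : q k = w -> bxor e (ins z) w = z k by move=> <-; have /ffunP/(_ k) := ez; rewrite pullE.
have E u' : (pull q u' == z') && [forall w, (w \notin codom q) ==> (bxor e (ins z) w == u' w)]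
   = (u' == bxor e (ins z')) && (pull q (bxor e (ins z')) == z').
  apply/andP/andP => [[/eqP h1 /forallP h2]|[/eqP -> ->]]; last first.
    split=> //; apply/forallP => w; apply/implyP => nw; rewrite !ffunE.
    by case: pickP => // k /eqP qk; rewrite -qk codom_f in nw.
  have u'E : u' = bxor e (ins z').
    apply/ffunP => w; have := eK w; rewrite !ffunE; case: pickP => [k /eqP qk|no].
      move=> /(_ k qk); rewrite -h1 pullE qk.
      by case: (e w); case: (z k); case: (u' w).
    move=> _; have := h2 w; rewrite !ffunE; case: pickP => [k /eqP qk|_].
      by have := no k; rewrite qk eqxx.
    rewrite !addbF => /implyP h; apply/esym/eqP/h/codomP => -[k wk].
    by have := no k; rewrite wk eqxx.
  by rewrite -u'E eqxx h1 eqxx.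
under [RHS]eq_bigl => u' do rewrite E.
case: ifP => h; last by rewrite big_pred0 // => u'; rewrite andbF.
by rewrite (big_pred1 (bxor e (ins z'))) // => u'; rewrite andbT.
Qed.

Definition ket I (x : bits I) : op R I := fun u u' => ((u == x) && (u' == x))%:R.

(* The algorithm a with a quantum input register I, and with its classical
   output stored in the dephased register J. *)
Definition channel_of I Q J Q' (a : qalg I Q J Q') (rho : op R (I + Q)) : op R (J + Q') :=
  fun w w' => (fstb w == fstb w')%:R *
    \sum_(u | (pull (cwire a) u == fstb w) && (pull (qwire a) u == sndb w))
    \sum_(u' | [&& pull (cwire a) u' == fstb w', pull (qwire a) u' == sndb w' &
                  [forall v, (v \notin codom (qwire a)) ==> (u v == u' v)]])
      foldl (@apply_gate R _) (anc_op (anc a) rho) (gates a) u u'.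

Lemma init_opE I Q A (x : bits I) (rho : op R Q) :
  init_op x rho = anc_op A (tens (ket x) rho).
Proof.
apply/opP => u u'; rewrite /init_op /anc_op /tens /ket mulrA -natrM mulnb.
by congr (_%:R * _); rewrite andbC -!andbA; do ![case: (_ == _)] => //=.
Qed.

Lemma channel_of_ket I Q J Q' (a : qalg I Q J Q') x rho w w' :
  channel_of a (tens (ket x) rho) w w' =
  (fstb w == fstb w')%:R * run a x rho (fstb w) (sndb w) (sndb w').
Proof.
by rewrite /channel_of /run; case: eqP => [<-|_]; rewrite ?mul0r // !mul1r init_opE.
Qed.

Lemma runE I Q J Q' (a : qalg I Q J Q') x (rho : op R Q) y z z' :
  run a x rho y z z' = channel_of a (tens (ket x) rho) (pairb y z) (pairb y z').
Proof. by rewrite channel_of_ket !fstb_pairb !sndb_pairb eqxx mul1r. Qed.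

(* The measured wires are copied twice, and one of the copies is traced out: this
   dephases the other.  The kept wires are copied once and then reset, so that
   tracing out the originals does no harm. *)
Lemma impl_channel_of I Q J Q' (a : qalg I Q J Q') : impl (4 * qsize a) (channel_of a).
Proof.
set A := anc a; set W : finType := (I + Q + A)%type.
pose s1 : bspec W (J + J) := fun j => let j0 := match j with inl j0 => j0 | inr j0 => j0 end in
  inr (cwire a j0, cwire a j0).
pose s2 : bspec (W + (J + J)) Q' := fun z => inr (inl (qwire a z), inl (qwire a z)).
pose h1 (x : W + (J + J) + Q') : (J + J) + Q' + W := match x with
  | inl (inl w) => inr w | inl (inr j) => inl (inl j) | inr z => inl (inr z) end.
pose h1' (x : (J + J) + Q' + W) : W + (J + J) + Q' := match x with
  | inr w => inl (inl w) | inl (inl j) => inl (inr j) | inl (inr z) => inr z end.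
have bh1 : bijective h1 by exists h1'; do 2?case.
(* Each kept wire receives the XOR of one of its own copies and is thereby reset. All copies of a
   wire carry the same value, so any choice by [pick] will do. *)
pose s3 : bspec ((J + J) + Q') W := fun w =>
  if [pick k | qwire a k == w] is Some k then inr (inr k, inr k) else inl false.
pose h2 (x : (J + J) + Q' + W) : (J + Q') + (J + W) := match x with
  | inl (inl (inl j)) => inl (inl j) | inl (inl (inr j)) => inr (inl j)
  | inl (inr z) => inl (inr z) | inr w => inr (inr w) end.
pose h2' (x : (J + Q') + (J + W)) : (J + J) + Q' + W := match x with
  | inl (inl j) => inl (inl (inl j)) | inr (inl j) => inl (inl (inr j))
  | inl (inr z) => inl (inr z) | inr (inr w) => inr w end.
have bh2 : bijective h2 by exists h2'; do 3?case.
have H := ImplPtr (ImplRel bh2 (impl_comp (ImplRel bh1 (impl_comp (impl_comp (impl_comp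
  (ImplAnc A (ImplId R (I + Q)%type)) (impl_gates (gates a))) (impl_copy s1)) (impl_copy s2)))
  (impl_xor s3))).
apply: ImplLe (_ : impl _ _); last first.
  move: H; congr (impl _ _); apply/funext => rho; apply/opP => w w'.
  rewrite /channel_of /ptr.
  set S := foldl _ _ _.
  pose ins (z : bits Q') : bits W :=
    [ffun w => if [pick k | qwire a k == w] is Some k then z k else false].
  have key (u : bits (J + Q')) y2 v : pull h1 (xorw s3 (pull h2 (pairb u (pairb y2 v)))) =
      pairb (pairb (bxor v (ins (sndb u))) (pairb (fstb u) y2)) (sndb u).
    have -> : pull h2 (pairb u (pairb y2 v)) = pairb (pairb (pairb (fstb u) y2) (sndb u)) v.
      bitsE.
    rewrite /xorw fstb_pairb sndb_pairb.
    have -> : bspec_eval s3 (pairb (pairb (fstb u) y2) (sndb u)) = ins (sndb u).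
      by apply/ffunP => x; rewrite !ffunE /s3; case: pickP => [k _|//]; rewrite /= !ffunE andbb.
    bitsE.
  have d1 u : bspec_eval s1 u = pairb (pull (cwire a) u) (pull (cwire a) u).
    by bitsP; rewrite ?ffunE /= andbb.
  have d2 u y : bspec_eval s2 (pairb u y) = pull (qwire a) u.
    by apply/ffunP => x; rewrite !ffunE /= !ffunE andbb.
  rewrite big_pairb /relabel /copy_op.
  under eq_bigr => y2 _ do under eq_bigr => v _ do
    rewrite !key !sndb_pairb !fstb_pairb !d2 !sndb_pairb !d1 !pairb_eq2.
  (* Off the diagonal every term vanishes: the traced-out copy [y2] would have to equal the measured
     value on both sides. *)
  have [yy|ne] := eqVneq (fstb w) (fstb w'); last first.
    rewrite mul0r big1 // => y2 _; rewrite big1 // => v _.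
    case: (fstb w =P _) => [e1|]; last by rewrite mul0r mulr0.
    case: (y2 =P _) => [e2|]; last by rewrite mul0r mulr0.
    case: (fstb w' =P _) => [e3|]; last by rewrite mul0r mulr0.
    case: (y2 =P _) => [e4|]; last by rewrite mul0r mulr0.
    by case/eqP: ne; rewrite e1 e3 -e2 -e4.
  rewrite mul1r -yy (bigD1 (fstb w)) //= [X in _ + X]big1 ?addr0 => [|y2 ne]; last first.
    rewrite big1 // => v _; case: (fstb w =P _) => [<-|]; last by rewrite mul0r mulr0.
    by rewrite (negbTE ne) mul0r mulr0.
  under [RHS]eq_bigr => u _ do rewrite big_mkcondl.
  rewrite big_mkcondl.
  transitivity (\sum_(u | pull (qwire a) u == sndb w)
    \sum_(u' | (pull (qwire a) u' == sndb w') &&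
                [forall v, (v \notin codom (qwire a)) ==> (u v == u' v)])
      ((pull (cwire a) u == fstb w) && (pull (cwire a) u' == fstb w))%:R * S u u'); last first.
    apply: eq_bigr => u _; case: ifP => _; last by rewrite big1 // => u' _; rewrite mul0r.
    by apply: eq_bigr => u' _; case: ifP => _; rewrite ?mul1r ?mul0r.
  rewrite -(big_wires (qwire a) _ _ (fun u u' => ((pull (cwire a) u == fstb w) &&
    (pull (cwire a) u' == fstb w))%:R * S u u')) [RHS]big_mkcond.
  apply: eq_bigr => v _; rewrite -/(ins _) -/(ins _) ![sndb _ == _]eq_sym ![fstb _ == _]eq_sym !andbb.
  by case: ifP => _; rewrite ?mul1r ?mul0r.
(* The factor 4 is forced by J: two copies, each paying an ancilla and a gate. *)
rewrite /qsize !card_sum -/A.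
move: #|A| #|I| #|Q| #|J| #|Q'| (size _) => nA nI nQ nJ nQ' ng; lia.
Qed.

End Circuits.
Arguments bspec (A B)%_type.

(** * From implementable channels back to algorithms *)

Section NormalForm.
Variable R : realType.
Implicit Types (I J K P Q W A B E : finType).

Definition sumop Q (X : finType) (r : X -> op R Q) : op R Q :=
  fun u u' => \sum_x r x u u'.

Lemma lin_sum Q Q' (T : op R Q -> op R Q') (X : finType) (r : X -> op R Q) :
  linear_op T -> T (sumop r) = sumop (fun x => T (r x)).
Proof.
move=> hT; have := hT X (fun _ => 1) r.
have E Q0 (s : X -> op R Q0) : lincomb (fun _ => 1) s = sumop s.
  by apply/opP => u u'; apply: eq_bigr => x _; rewrite mul1r.
by rewrite !E.
Qed.

Lemma lin_scale Q Q' (T : op R Q -> op R Q') a (r : op R Q) :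
  linear_op T -> T (scale_op a r) = scale_op a (T r).
Proof.
move=> hT; have := hT unit (fun _ => a) (fun _ => r).
have E Q0 (s : op R Q0) : lincomb (fun _ : unit => a) (fun _ => s) = scale_op a s.
  by apply/opP => u u'; rewrite /lincomb (bigD1 tt) //= big1 ?addr0 // => -[].
by rewrite !E.
Qed.

Lemma lin_zero Q Q' (T : op R Q -> op R Q') :
  linear_op T -> T (fun _ _ => 0) = fun _ _ => 0.
Proof.
move=> hT; have := lin_scale 0 (fun _ _ => 0) hT.
have E Q0 (s : op R Q0) : scale_op 0 s = fun _ _ => 0.
  by apply/opP => u u'; rewrite /scale_op mul0r.
by rewrite !E.
Qed.

Lemma foldl_rel I J (h : I -> J) (gs : seq (gate I)) (rho : op R I) : bijective h ->
  foldl (@apply_gate R J) (relabel h rho) (map (gmap h) gs) = relabel h (foldl (@apply_gate R I) rho gs).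
Proof. by move=> bh; elim: gs rho => //= g gs IH rho; rewrite apply_gate_rel. Qed.

Lemma apply_gate_anc Q A (g : gate Q) (rho : op R Q) :
  apply_gate (anc_op A rho) (gmap inl g) = anc_op A (apply_gate rho g).
Proof.
apply/opP => w w'; rewrite apply_gate_inl /anc_op.
set b := _%:R; rewrite -[RHS]/(scale_op b (apply_gate rho g) (fstb w) (fstb w')).
rewrite -(lin_scale _ _ (@lin_gate R Q g)).
by congr (apply_gate _ _ _ _); apply/opP => v v'; rewrite !sndb_pairb !fstb_pairb.
Qed.

Lemma foldl_anc Q A (gs : seq (gate Q)) (rho : op R Q) :
  foldl (@apply_gate R _) (anc_op A rho) (map (gmap inl) gs) =
  anc_op A (foldl (@apply_gate R Q) rho gs).
Proof. by elim: gs rho => //= g gs IH rho; rewrite apply_gate_anc. Qed.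

Lemma ptr_gate Q E (g : gate Q) (rho : op R (Q + E)) :
  ptr (apply_gate rho (gmap inl g)) = apply_gate (ptr rho) g.
Proof.
have -> : ptr rho = sumop (fun e => (fun v v' => rho (pairb v e) (pairb v' e)) : op R Q) by [].
rewrite (lin_sum _ (@lin_gate R Q g)); apply/opP => z z'; apply: eq_bigr => e _.
by rewrite apply_gate_inl !sndb_pairb !fstb_pairb.
Qed.

(** Ancillas move to the front because they commute with gates on other wires, gates move in front
    of a partial trace because it leaves the kept wires alone, and consecutive relabellings and
    traces merge. *)
Lemma impl_normal_form Q Q' n (C : op R Q -> op R Q') : impl n C ->
  exists A E (h : Q + A -> Q' + E) (gs : seq (gate (Q + A))),
    [/\ bijective h, (#|A| + size gs <= n)%N &
      forall rho, C rho = ptr (relabel h (foldl (@apply_gate R _) (anc_op A rho) gs))].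
Proof.
elim: Q' n C / => [|Q1 n1 C1 g _ IH|Q1 n1 C1 B _ IH|Q1 Q2 n1 C1 k bk _ IH|Q1 E0 n1 C1 _ IH|Q1 n1 n2 C1 le _ IH].
- exists void, void, id, [::]; split; [by exists id | by rewrite card_void |].
  move=> rho; apply/opP => u u'; rewrite /ptr big_void /relabel /anc_op /=.
  by rewrite !(bits_void (sndb _)) eqxx mul1r; congr (rho _ _); bitsE.
- have [A [E [h [gs [[h' hK h'K] le HC]]]]] := IH.
  (* The new gate acts on the kept wires; it is carried back to the initial ones through [h']. *)
  exists A, E, h, (rcons gs (gmap (h' \o inl) g)); split; first by exists h'.
    by rewrite size_rcons addnS.
  move=> rho; rewrite foldl_rcons HC -ptr_gate -gmap_comp.
  have bh : bijective h by exists h'.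
  rewrite -(apply_gate_rel _ _ bh) [gmap h (gmap h' _)]gmap_comp.
  have -> : h \o h' = id by apply/funext.
  by rewrite gmap_id.
- have [A [E [h [gs [bh le HC]]]]] := IH.
  pose s1 (x : Q1 + E + B) : Q1 + B + E := match x with
    | inl (inl q) => inl (inl q) | inl (inr e) => inr e | inr b => inl (inr b) end.
  pose s1' (x : Q1 + B + E) : Q1 + E + B := match x with
    | inl (inl q) => inl (inl q) | inr e => inl (inr e) | inl (inr b) => inr b end.
  have bs1 : bijective s1 by exists s1'; do 2?case.
  have bi : bijective (@id B) by exists id.
  exists (A + B)%type, E, (s1 \o (sum_map h id \o @sum_assocV Q A B)),
    (map (gmap (@sum_assoc Q A B)) (map (gmap inl) gs)); split.
  + by apply: bij_comp => //; apply: bij_comp; [exact: sum_map_bij | exact: sum_assocV_bij].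
  + by rewrite !size_map card_sum addnAC leq_add2r.
  move=> rho.
  have -> : anc_op (A + B) rho = relabel (@sum_assoc Q A B) (anc_op B (anc_op A rho)).
    apply/opP => u u'; rewrite /relabel /anc_op !pull_assoc !(fstb_pairb, sndb_pairb).
    rewrite mulrA -natrM mulnb; congr (_%:R * _).
    have E0 (v : bits (A + B)) : (v == zerob _) = (fstb v == zerob A) && (sndb v == zerob B).
      rewrite pairb_eqE; have -> : fstb (zerob (A + B)%type) = zerob A by bitsE.
      by have -> : sndb (zerob (A + B)%type) = zerob B by bitsE.
    by rewrite !E0; do ![case: (_ == _)].
  rewrite foldl_rel; last exact: sum_assoc_bij.
  rewrite foldl_anc HC; set S := foldl _ _ _.
  apply/opP => w w'; rewrite /anc_op /ptr mulr_sumr; apply: eq_bigr => e _.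
  rewrite /relabel !pull_comp.
  have key (u : bits (Q1 + B)) : pull ((s1 \o (sum_map h id \o @sum_assocV Q A B)) \o @sum_assoc Q A B) (pairb u e)
     = pairb (pull h (pairb (fstb u) e)) (sndb u).
    apply/ffunP => -[[x|x]|b]; rewrite !ffunE //= ?ffunE;
    by [case: (h (inl x)) => y; rewrite ?ffunE | case: (h (inr x)) => y; rewrite ?ffunE].
  by rewrite !key !sndb_pairb !fstb_pairb.
- have [A [E [h [gs [bh le HC]]]]] := IH.
  have bi : bijective (@id E) by exists id.
  exists A, E, (sum_map k id \o h), gs; split=> //.
    by apply: bij_comp => //; exact: sum_map_bij.
  move=> rho; rewrite HC; apply/opP => z z'; apply: eq_bigr => e _.
  have ide : pull id e = e by bitsE.
  have key u : pull (sum_map k id \o h) (pairb u e) = pull h (pairb (pull k u) e).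
    by rewrite -(pull_comp (sum_map k id)) pull_sum_map sndb_pairb fstb_pairb ide.
  by rewrite /relabel !key.
- have [A [E [h [gs [bh le HC]]]]] := IH.
  exists A, (E0 + E)%type, (@sum_assoc _ _ _ \o h), gs; split=> //.
    by apply: bij_comp => //; exact: sum_assoc_bij.
  move=> rho; rewrite HC; apply/opP => z z'; rewrite /ptr big_pairb.
  apply: eq_bigr => e0 _; apply: eq_bigr => e _.
  have key u : pull (@sum_assoc _ _ _ \o h) (pairb u (pairb e0 e)) =
               pull h (pairb (pairb u e0) e).
    by rewrite -(pull_comp (@sum_assoc Q1 E0 E)) pull_assoc !sndb_pairb !fstb_pairb.
  by rewrite /relabel !key.
- have [A [E [h [gs [bh le' HC]]]]] := IH.
  by exists A, E, h, gs; split=> //; exact: leq_trans le.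
Qed.

(** J and Q' are located at their preimages under the relabelling of the normal form, and what
    remains is E. Since [run] measures J, only the diagonal blocks of [C] in J are reproduced. The
    sizes of the registers are added where the lemma is applied. *)
Lemma impl_qalg I Q J Q' n (C : op R (I + Q) -> op R (J + Q')) : impl n C ->
  exists a : qalg I Q J Q', (#|anc a| + size (gates a) <= n)%N /\
    forall x rho y z z',
      run a x rho y z z' = C (tens (ket R x) rho) (pairb y z) (pairb y z').
Proof.
case/impl_normal_form => A [E [h [gs [[h' hK h'K] le HC]]]].
exists (@QAlg I Q J Q' A gs (h' \o inl \o inl) (h' \o inl \o inr)); split=> //= x rho y z z'.
rewrite /run /= init_opE HC; set S := foldl _ _ _.
have bh : bijective h by exists h'.
have cE (v : bits (J + Q' + E)) : pull (h' \o inl \o inl) (pull h v) = fstb (fstb v).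
  by apply/ffunP => j; rewrite !ffunE /= h'K.
have qE (v : bits (J + Q' + E)) : pull (h' \o inl \o inr) (pull h v) = sndb (fstb v).
  by apply/ffunP => j; rewrite !ffunE /= h'K.
rewrite (reindex (pull h)) /=; last exact/onW_bij/pull_bij.
rewrite big_pairb /ptr (bigD1 (pairb y z)) //= [X in _ + X = _]big1 ?addr0 => [|v ne]; last first.
  rewrite big_pred0 // => e; rewrite cE qE fstb_pairb; apply: contraNF ne => /andP[/eqP <- /eqP <-].
  by rewrite pairb_surj.
under eq_bigl => e do rewrite cE qE !fstb_pairb !sndb_pairb !eqxx.
apply: eq_bigr => e _; rewrite (reindex (pull h)) /=; last exact/onW_bij/pull_bij.
rewrite (big_pred1 (pairb (pairb y z') e)) // => v.
rewrite cE qE /= pairb_eqE fstb_pairb pairb_eqE fstb_pairb !sndb_pairb -andbA.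
case: eqP => //= ey; case: eqP => //= ez.
(* The wires outside [qwire] are those of J, already fixed to [y] on both sides, and those of E,
   which the partial trace identifies. *)
apply/forallP/eqP => [H|ee w].
  apply/ffunP => b; have := H (h' (inr b)); rewrite !pullE !h'K !ffunE => /implyP h1.
  apply/esym/eqP/h1/codomP => -[q] /(can_inj h'K) //.
apply/implyP => nw; rewrite !pullE; case hw: (h w) => [[j|q]|b].
- by rewrite -ey !ffunE.
- by case/codomP: nw; exists q; rewrite /= -hw hK.
- by rewrite -ee !ffunE.
Qed.

End NormalForm.

(** * Classical-quantum states *)

Section Families.
Variable R : realType.
Implicit Types (I J K P Q W A B E : finType).

(* Classical-quantum states: [r k] is the unnormalized state of Q when the
   classical register holds k, and [cq r] the block-diagonal operator on both. *)
Definition fam K Q := bits K -> op R Q.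

Arguments fam (K Q)%_type.

Definition cq K Q (r : fam K Q) : op R (K + Q) :=
  fun w w' => (fstb w == fstb w')%:R * r (fstb w) (sndb w) (sndb w').

(** [C] is constrained only on block-diagonal operators and must keep them block diagonal; its
    effect on coherences of the classical register is left open. *)
Definition fimpl K Q K' Q' (n : nat) (T : fam K Q -> fam K' Q') : Prop :=
  exists2 C : op R (K + Q) -> op R (K' + Q'), impl n C & forall r, C (cq r) = cq (T r).

Lemma fimpl_eq K Q K' Q' n (T T' : fam K Q -> fam K' Q') :
  (forall r k, T r k = T' r k) -> fimpl n T -> fimpl n T'.
Proof.
by move=> e [C hC E]; exists C => // r; rewrite E; congr cq; apply/funext => k; rewrite e.
Qed.

Lemma fimpl_le K Q K' Q' n m (T : fam K Q -> fam K' Q') :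
  (n <= m)%N -> fimpl n T -> fimpl m T.
Proof. by move=> le [C hC E]; exists C => //; exact: ImplLe hC. Qed.

Lemma fimpl_id K Q : fimpl 0 (fun r : fam K Q => r).
Proof. by exists (fun rho => rho) => //; exact: ImplId. Qed.

Lemma fimpl_comp K Q K' Q' K'' Q'' n n' (T : fam K Q -> fam K' Q')
    (T' : fam K' Q' -> fam K'' Q'') :
  fimpl n T -> fimpl n' T' -> fimpl (n + n') (fun r => T' (T r)).
Proof.
move=> [C hC E] [C' hC' E']; exists (fun rho => C' (C rho)); first exact: impl_comp.
by move=> r; rewrite E E'.
Qed.

(** [b] splits the classical register into a kept and a forgotten part, and forgetting classical
    data is a sum over its values. Dropping and permuting registers are instances. *)
Lemma fimpl_rewire K K' E Q (b : K -> K' + E) : bijective b ->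
  fimpl 0 (fun (r : fam K Q) k' => sumop (fun e => r (pull b (pairb k' e)))).
Proof.
move=> bb; have inj := bij_inj (pull_bij bb); have [b' bK b'K] := bb.
pose g (x : K + Q) : K' + Q + E := match x with
  | inl k => match b k with inl k' => inl (inl k') | inr e => inr e end
  | inr q => inl (inr q) end.
pose g' (x : K' + Q + E) : K + Q := match x with
  | inl (inl k') => inl (b' (inl k')) | inl (inr q) => inr q | inr e => inl (b' (inr e)) end.
have bg : bijective g.
  exists g'; last by case=> [[k'|q]|e] /=; rewrite ?b'K.
  by case=> [k|//] /=; case e: (b k) => [k'|x] /=; rewrite -e bK.
exists (fun rho => ptr (relabel g rho)); first exact: (ImplPtr (ImplRel bg (ImplId R _))).
move=> r; apply/opP => w w'; rewrite /ptr /relabel /cq /sumop mulr_sumr; apply: eq_bigr => e _.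
have key (u : bits (K' + Q)) : pull g (pairb u e) = pairb (pull b (pairb (fstb u) e)) (sndb u).
  apply/ffunP => -[k|q]; rewrite !ffunE /= ?ffunE //.
  by case: (b k) => x; rewrite ?ffunE.
rewrite !key !fstb_pairb !sndb_pairb (inj_eq inj).
by congr (_ %:R * _); rewrite pairb_eq2 eqxx andbT.
Qed.

Lemma fimpl_drop K J Q :
  fimpl 0 (fun (r : fam (K + J) Q) k => sumop (fun y => r (pairb k y))).
Proof.
have bi : bijective (@id (K + J)) by exists id.
apply: fimpl_eq (fimpl_rewire Q bi) => r k; apply/opP => z z'.
by apply: eq_bigr => y _; congr (r _ _ _); bitsE.
Qed.

Lemma bij_inl_void A : bijective (@inl A void).
Proof. by exists (fun x : A + void => match x with inl a => a | inr v => match v with end end) => // -[]. Qed.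

Lemma fimpl_perm K K' Q (b : K -> K') : bijective b ->
  fimpl 0 (fun (r : fam K Q) k' => r (pull b k')).
Proof.
move=> bb; have bb' := bij_comp (bij_inl_void K') bb.
apply: fimpl_eq (fimpl_rewire Q bb') => r k; apply/opP => z z'.
by rewrite /sumop big_void; congr (r _ _ _); apply/ffunP => x; rewrite !ffunE.
Qed.

Lemma fimpl_qrel K Q Q' (h : Q -> Q') : bijective h ->
  fimpl 0 (fun (r : fam K Q) k => relabel h (r k)).
Proof.
move=> bh; exists (fun rho => relabel (sum_map id h) rho).
  by apply: ImplRel (ImplId _ _); apply: sum_map_bij => //; exists id.
move=> r; apply/opP => w w'; rewrite /relabel /cq !pull_sum_map !fstb_pairb !sndb_pairb.
have e (x : bits K) : pull id x = x by bitsE.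
by rewrite !e.
Qed.

(** A coherent copy keeps the operator block diagonal, because on each side the new value is a
    function of the old one. *)
Lemma fimpl_det K J Q (s : bspec K J) :
  fimpl (#|J| + #|J|) (fun (r : fam K Q) ky =>
     scale_op (sndb ky == bspec_eval s (fstb ky))%:R (r (fstb ky))).
Proof.
pose s' : bspec (K + Q) J := fun j => match s j with
  | inl c => inl c | inr cd => inr (inl cd.1, inl cd.2) end.
pose h (x : K + Q + J) : K + J + Q := match x with
  | inl (inl k) => inl (inl k) | inl (inr q) => inr q | inr j => inl (inr j) end.
pose h' (x : K + J + Q) : K + Q + J := match x with
  | inl (inl k) => inl (inl k) | inr q => inl (inr q) | inl (inr j) => inr j end.
have bh : bijective h by exists h'; do 2?case.
exists (fun rho => relabel h (copy_op s' rho)).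
  by apply: ImplRel => //; exact: impl_copy.
move=> r; apply/opP => w w'; rewrite /relabel /copy_op /cq /scale_op.
have key (u : bits (K + J + Q)) : pull h u = pairb (pairb (fstb (fstb u)) (sndb u)) (sndb (fstb u)).
  bitsE.
have dE (k : bits K) (q : bits Q) : bspec_eval s' (pairb k q) = bspec_eval s k.
  by apply/ffunP => j; rewrite !ffunE /s'; case: (s j) => //= cd; rewrite !ffunE.
rewrite !key !fstb_pairb !sndb_pairb !dE [in RHS]pairb_eqE.
have [-> /=|_] := eqVneq (fstb (fstb w)) (fstb (fstb w')); last by rewrite /= !mul0r mulr0.
rewrite mul1r mulrA; congr (_ * _); rewrite -natrM mulnb; congr (_%:R).
have E (a b d : bits J) : (a == d) && (b == d) = (a == b) && (a == d).
  by case: (a =P d) => [->|_]; rewrite ?andbT ?andbF // eq_sym.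
by rewrite E.
Qed.

Lemma lin_run I Q J Q' (a : qalg I Q J Q') x y :
  linear_op (fun rho : op R Q => run a x rho y).
Proof.
move=> X c r; apply/opP => z z'; rewrite runE.
have -> : tens (ket R x) (lincomb c r) = lincomb c (fun i => tens (ket R x) (r i)).
  apply/opP => u u'; rewrite /tens /lincomb mulr_sumr.
  by apply: eq_bigr => i _; rewrite mulrCA.
by rewrite (lin_impl (impl_channel_of R a)) /lincomb; apply: eq_bigr => i _; rewrite runE.
Qed.

(** The input is first copied from the wires [i] of K, so that K survives the call. The factor 6 is
    the 4 of [impl_channel_of] plus 2 for this copy. *)
Lemma fimpl_call I Q J Q' (a : qalg I Q J Q') K P (i : I -> K) :
  fimpl (6 * qsize a) (fun (r : fam K (P + Q)) ky =>
    idle (fun rho => run a (pull i (fstb ky)) rho (sndb ky)) (r (fstb ky)) : op R (P + Q')).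
Proof.
pose s : bspec (K + (P + Q)) I := fun j => inr (inl (i j), inl (i j)).
pose h (x : K + (P + Q) + I) : (K + P) + (I + Q) := match x with
  | inl (inl k) => inl (inl k) | inl (inr (inl p)) => inl (inr p)
  | inl (inr (inr q)) => inr (inr q) | inr j => inr (inl j) end.
pose h' (x : (K + P) + (I + Q)) : K + (P + Q) + I := match x with
  | inl (inl k) => inl (inl k) | inl (inr p) => inl (inr (inl p))
  | inr (inr q) => inl (inr (inr q)) | inr (inl j) => inr j end.
have bh : bijective h by exists h'; do 3?case.
pose g (x : (K + P) + (J + Q')) : (K + J) + (P + Q') := match x with
  | inl (inl k) => inl (inl k) | inl (inr p) => inr (inl p)
  | inr (inr q) => inr (inr q) | inr (inl j) => inl (inr j) end.
pose g' (x : (K + J) + (P + Q')) : (K + P) + (J + Q') := match x with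
  | inl (inl k) => inl (inl k) | inr (inl p) => inl (inr p)
  | inr (inr q) => inr (inr q) | inl (inr j) => inr (inl j) end.
have bg : bijective g by exists g'; do 3?case.
exists (fun rho => relabel g (idle (channel_of (R := R) a) (relabel h (copy_op s rho)))).
  apply: ImplRel => //; apply: (ImplLe (n := (#|I| + #|I|) + 4 * qsize a)).
    rewrite -[X in (_ <= X * _)%N]/(2 + 4)%N mulnDl leq_add2r mul2n -addnn.
    by apply: leq_add; rewrite /qsize -!addnA leq_addr.
  apply: (impl_comp (C := fun rho => relabel h (copy_op s rho))).
    by apply: ImplRel => //; exact: impl_copy.
  exact: impl_idle (impl_channel_of R a).
move=> r; apply/opP => w w'; rewrite /relabel /cq /idle.
have kg (u : bits ((K + J) + (P + Q'))) : pull g u =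
  pairb (pairb (fstb (fstb u)) (fstb (sndb u))) (pairb (sndb (fstb u)) (sndb (sndb u))).
  bitsE.
have kh (u : bits (K + P)) (v : bits (I + Q)) : pull h (pairb u v) =
  pairb (pairb (fstb u) (pairb (sndb u) (sndb v))) (fstb v).
  bitsE.
have dE (k : bits K) (q : bits (P + Q)) : bspec_eval s (pairb k q) = pull i k.
  by apply/ffunP => j; rewrite !ffunE /= !ffunE andbb.
rewrite !kg !sndb_pairb !fstb_pairb.
have -> : (fun v v' : bits (I + Q) => copy_op s (fun w0 w'0 => (fstb w0 == fstb w'0)%:R *
     r (fstb w0) (sndb w0) (sndb w'0))
     (pull h (pairb (pairb (fstb (fstb w)) (fstb (sndb w))) v))
     (pull h (pairb (pairb (fstb (fstb w')) (fstb (sndb w'))) v'))) =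
   scale_op ((fstb (fstb w) == fstb (fstb w'))%:R) (tens (ket R (pull i (fstb (fstb w))))
     (fun v v' => r (fstb (fstb w)) (pairb (fstb (sndb w)) v) (pairb (fstb (sndb w')) v'))).
  apply/opP => v v'; rewrite !kh /copy_op /scale_op /tens /ket.
  rewrite !fstb_pairb !sndb_pairb !dE.
  case: (fstb (fstb w) =P _) => [->|_]; last by rewrite !mul0r mulr0.
  by rewrite !mul1r.
rewrite (lin_scale _ _ (lin_impl (impl_channel_of R a))) /scale_op channel_of_ket.
rewrite !sndb_pairb !fstb_pairb [in RHS]pairb_eqE.
by rewrite mulrA -natrM mulnb.
Qed.

Lemma fimpl_run I Q J Q' (a : qalg I Q J Q') K (i : I -> K) :
  fimpl (6 * qsize a) (fun (r : fam K Q) ky =>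
    run a (pull i (fstb ky)) (r (fstb ky)) (sndb ky)).
Proof.
pose e A (x : A) : void + A := inr x.
pose e' A (x : void + A) : A := match x with inl v => match v with end | inr a => a end.
have be A : bijective (e A) by exists (e' A) => // -[].
have be' A : bijective (e' A) by exists (e A) => // -[].
have := fimpl_comp (fimpl_qrel K (be Q)) (fimpl_comp (fimpl_call a void i)
   (fimpl_qrel (K + J)%type (be' Q'))).
rewrite add0n addn0; apply: fimpl_eq => r ky; rewrite /relabel /idle.
apply/opP => z z'.
have -> u : sndb (pull (e' Q') u) = u by bitsE.
have -> u : sndb (pull (e' Q') u) = u by bitsE.
congr (run _ _ _ _ _ _); apply/opP => v v'; congr (r _ _ _); bitsE.
Qed.

Definition sampler I J (a : qalg I void J void) (x : bits I) (y : bits J) : R[i] :=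
  tr (run a x (unit_op R) y).

Lemma op_void (rho : op R void) : rho = scale_op (tr rho) (unit_op R).
Proof.
apply/opP => u u'; rewrite /scale_op /unit_op mulr1 /tr big_void.
by rewrite !(bits_void u) (bits_void u').
Qed.

Lemma run_void I J (a : qalg I void J void) x (rho : op R void) y :
  run a x rho y = scale_op (tr rho * sampler a x y) (unit_op R).
Proof.
rewrite {1}(op_void rho) (lin_scale _ _ (lin_run a x y)) {1}[run _ _ _ _]op_void.
by apply/opP => u u'; rewrite /scale_op mulrA.
Qed.

(** The state of Q takes the idle role of P in [fimpl_call], so that sampling leaves it
    undisturbed. *)
Lemma fimpl_sample I J (a : qalg I void J void) K Q (i : I -> K) :
  fimpl (6 * qsize a) (fun (r : fam K Q) ky =>
    scale_op (sampler a (pull i (fstb ky)) (sndb ky)) (r (fstb ky))).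
Proof.
pose e' A (x : A + void) : A := match x with inr v => match v with end | inl a => a end.
have be' A : bijective (e' A) by exists inl => // -[].
have := fimpl_comp (fimpl_qrel K (bij_inl_void Q)) (fimpl_comp (fimpl_call a Q i)
   (fimpl_qrel (K + J)%type (be' Q))).
rewrite add0n addn0; apply: fimpl_eq => r ky; rewrite /relabel /idle.
apply/opP => z z'; rewrite run_void /scale_op /unit_op mulr1 mulrC; congr (_ * _).
rewrite /tr big_void; congr (r _ _ _); bitsE.
Qed.

Lemma fimpl_prep I J (a : qalg I void void J) K Q (i : I -> K) :
  fimpl (6 * qsize a) (fun (r : fam K Q) k =>
    tens (r k) (run a (pull i k) (unit_op R) (zerob void))).
Proof.
pose e' A (x : A + void) : A := match x with inr v => match v with end | inl a => a end.
have be' A : bijective (e' A) by exists inl => // -[].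
have := fimpl_comp (fimpl_qrel K (bij_inl_void Q)) (fimpl_comp (fimpl_call a Q i)
   (fimpl_perm _ (be' K))).
rewrite add0n addn0; apply: fimpl_eq => r k; rewrite /relabel /idle.
apply/opP => w w'; rewrite [X in run _ _ X]op_void (lin_scale _ _ (lin_run a _ _)) /scale_op.
rewrite /tens /tr big_void (bits_void (sndb _)).
have e : fstb (pull (e' K) k) = k by bitsE.
by rewrite e; congr (r _ _ _ * _); bitsE.
Qed.

End Families.
Arguments fam R (K Q)%_type.

(** * Interactive machines *)

Section Interaction.
Variable R : realType.
Implicit Types (I J K P Q W A B E : finType).

(** The quantification over Q says that the sample can be drawn beside any quantum state of the
    adversary. *)
Definition fsampler K J (n : nat) (O : bits K -> bits J -> R[i]) : Prop :=
  forall Q, fimpl n (fun (r : fam R K Q) (ky : bits (K + J)) =>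
    scale_op (O (fstb ky) (sndb ky)) (r (fstb ky))).

Lemma fsampler_alg I J (a : qalg I void J void) K (i : I -> K) :
  fsampler (6 * qsize a) (fun k y => sampler R a (pull i k) y).
Proof. by move=> Q; exact: fimpl_sample. Qed.

Lemma fsampler_det K J (s : bspec K J) :
  fsampler (2 * #|J|) (fun k y => (y == bspec_eval s k)%:R).
Proof. by move=> Q; rewrite mul2n -addnn; exact: fimpl_det. Qed.

Lemma fsampler_eq K J n (O O' : bits K -> bits J -> R[i]) :
  (forall k y, O k y = O' k y) -> fsampler n O -> fsampler n O'.
Proof. by move=> e h Q; apply: fimpl_eq (h Q) => r k; rewrite e. Qed.

Lemma fsampler_le K J n m (O : bits K -> bits J -> R[i]) :
  (n <= m)%N -> fsampler n O -> fsampler m O.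
Proof. by move=> le h Q; exact: fimpl_le (h Q). Qed.

(** The intermediate sample is recorded, used and then forgotten, which turns it into a sum. *)
Lemma fsampler_bind K J J' n n' (O : bits K -> bits J -> R[i])
    (O' : bits (K + J) -> bits J' -> R[i]) :
  fsampler n O -> fsampler n' O' ->
  fsampler (n + n') (fun k y' => \sum_y O k y * O' (pairb k y) y').
Proof.
move=> h h' Q.
pose b (x : K + J + J') : K + J' + J := match x with
  | inl (inl k) => inl (inl k) | inl (inr j) => inr j | inr j => inl (inr j) end.
pose b' (x : K + J' + J) : K + J + J' := match x with
  | inl (inl k) => inl (inl k) | inr j => inl (inr j) | inl (inr j) => inr j end.
have bb : bijective b by exists b'; do 2?case.
have := fimpl_comp (h Q) (fimpl_comp (h' Q) (fimpl_rewire R Q bb)).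
rewrite addn0; apply: fimpl_eq => r ky; apply/opP => z z'.
rewrite /sumop /scale_op mulr_suml; apply: eq_bigr => y _.
have -> : pull b (pairb ky y) = pairb (pairb (fstb ky) y) (sndb ky) by bitsE.
by rewrite !fstb_pairb !sndb_pairb mulrA [O' _ _ * _]mulrC.
Qed.

Lemma lin_sumop Q Q' (X : finType) (T : X -> op R Q -> op R Q') :
  (forall x, linear_op (T x)) -> linear_op (fun rho => sumop (fun x => T x rho)).
Proof.
move=> h Y c r; apply/opP => u u'; rewrite /sumop /lincomb.
under [LHS]eq_bigr => x _ do rewrite h /lincomb.
rewrite exchange_big /=; apply: eq_bigr => y _; by rewrite mulr_sumr.
Qed.

Lemma lin_scaleop Q (c : R[i]) : linear_op (@scale_op R Q c).
Proof.
move=> Y d r; apply/opP => u u'; rewrite /scale_op /lincomb mulr_sumr.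
by apply: eq_bigr => y _; rewrite mulrCA.
Qed.

Lemma lin_tens Q P (kappa : op R P) : linear_op (fun rho : op R Q => tens rho kappa).
Proof.
move=> Y d r; apply/opP => u u'; rewrite /tens /lincomb mulr_suml.
by apply: eq_bigr => y _; rewrite mulrA.
Qed.

Section Machine.
Variables (I Q Qry Ans J Q' : finType) (M : machine I Q Qry Ans J Q').

Definition conv1 (O : bits Qry -> bits Ans -> R[i]) (j : nat) (rho : op R (work M)) :
  op R (work M) :=
  sumop (fun q => sumop (fun a => run (tell M j) a
    (scale_op (O q a) (run (ask M j) (zerob void) rho q)) (zerob void))).

(** The oracle may vary with the round, as the hybrids require, and the rounds form an arbitrary
    list, so that a conversation can be cut at any round. *)
Definition conv (O : nat -> bits Qry -> bits Ans -> R[i]) (s : seq nat)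
    (rho : op R (work M)) : op R (work M) :=
  foldl (fun r j => conv1 (O j) j r) rho s.

Definition iact (O : nat -> bits Qry -> bits Ans -> R[i]) (x : bits I)
    (rho : op R Q) (y : bits J) : op R Q' :=
  run (finish M) (zerob void)
    (conv O (iota 0 (rounds M)) (run (start M) x rho (zerob void))) y.

Lemma lin_conv1 O j : linear_op (conv1 O j).
Proof.
apply: lin_sumop => q; apply: lin_sumop => a.
apply: (lin_comp (T := fun rho => scale_op _ (run (ask M j) (zerob void) rho q))
                 (T' := fun rho => run (tell M j) a rho (zerob void))) => [|X c r].
  apply: (lin_comp (T := fun rho => run (ask M j) (zerob void) rho q)
                 (T' := @scale_op R _ _)); [exact: lin_run | exact: lin_scaleop].
exact: lin_run.
Qed.

Lemma lin_conv O s : linear_op (conv O s).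
Proof.
elim: s => [//|j s IH] X c r; rewrite /conv /=.
have /= := @lin_conv1 (O j) j X c r => ->; exact: IH.
Qed.

Lemma lin_iact O x y : linear_op (fun rho => iact O x rho y).
Proof.
move=> X c r; rewrite /iact (lin_run (start M) x (zerob void)).
by rewrite lin_conv (lin_run (finish M)).
Qed.

Lemma eq_conv O O' s rho : (forall j, j \in s -> O j = O' j) -> conv O s rho = conv O' s rho.
Proof.
elim: s rho => //= j s IH rho h; rewrite /conv /= h ?mem_head //.
by apply: IH => i hi; apply: h; rewrite inE hi orbT.
Qed.

Lemma fimpl_conv1 K n (O : bits K -> bits Qry -> bits Ans -> R[i]) j :
  fsampler n (fun kq : bits (K + Qry) => O (fstb kq) (sndb kq)) ->
  fimpl (6 * qsize (ask M j) + (n + 6 * qsize (tell M j)))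
    (fun (r : fam R K (work M)) k => conv1 (O k) j (r k)).
Proof.
move=> hO.
pose i0 (x : void) : K := match x with end.
have := fimpl_comp (fimpl_run R (ask M j) i0) (fimpl_comp (hO _) (fimpl_comp
  (fimpl_run R (tell M j) (@inr (K + Qry) Ans)) (fimpl_comp (fimpl_drop R _ _ _)
  (fimpl_comp (fimpl_drop R _ _ _) (fimpl_drop R _ _ _))))).
rewrite !addn0; apply: fimpl_eq => r k; apply/opP => z z'.
rewrite /conv1 /sumop; apply: eq_bigr => q _; apply: eq_bigr => a _; rewrite big_void.
rewrite !fstb_pairb !sndb_pairb (bits_void (pull i0 k)).
by have -> : pull inr (pairb (pairb k q) a) = a by exact: sndb_pairb.
Qed.

Lemma fimpl_conv K n (O : bits K -> nat -> bits Qry -> bits Ans -> R[i]) s m :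
  (forall j, j \in s -> fsampler n (fun kq : bits (K + Qry) => O (fstb kq) j (sndb kq))) ->
  (forall j, j \in s -> qsize (ask M j) + qsize (tell M j) <= m)%N ->
  fimpl (size s * (6 * m + n)) (fun (r : fam R K (work M)) k => conv (O k) s (r k)).
Proof.
elim: s => [|j s IH] hO hm; first exact: fimpl_id.
have h1 := fimpl_conv1 j (O := fun k => O k j) (hO j (mem_head _ _)).
have h2 := IH (fun i hi => hO i (@mem_behead _ (j :: s) i hi)) (fun i hi => hm i (@mem_behead _ (j :: s) i hi)).
have := fimpl_comp h1 h2; rewrite /conv /=; apply: fimpl_le.
have := hm j (mem_head _ _); rewrite mulSn leq_add2r; lia.
Qed.

(** The oracle may depend on the classical register, where the keys that it uses are stored. At most
    [m] rounds cost at most [6 * m + n] each; start and finish fit into [12 * m]. *)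
Lemma fimpl_iact K n (O : bits K -> nat -> bits Qry -> bits Ans -> R[i]) (i : I -> K) m :
  (forall j, (j < rounds M)%N -> fsampler n (fun kq : bits (K + Qry) => O (fstb kq) j (sndb kq))) ->
  (msize M <= m)%N ->
  fimpl (12 * m + m * (6 * m + n)) (fun (r : fam R K Q) (ky : bits (K + J)) =>
    iact (O (fstb ky)) (pull i (fstb ky)) (r (fstb ky)) (sndb ky)).
Proof.
move=> hO hm.
pose i0 (x : void) : K := match x with end.
have hs j : j \in iota 0 (rounds M) -> (j < rounds M)%N by rewrite mem_iota.
have h2 : forall j, j \in iota 0 (rounds M) -> (qsize (ask M j) + qsize (tell M j) <= m)%N.
  move=> j /hs lt; apply: leq_trans hm; apply: leq_trans (leq_addl _ _).
  by rewrite (bigD1 (Ordinal lt)) //= leq_addr.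
have := fimpl_comp (fimpl_run R (start M) i) (fimpl_comp (fimpl_drop R _ _ _)
  (fimpl_comp (fimpl_conv (fun j hj => hO j (hs j hj)) h2) (fimpl_run R (finish M) i0))).
move=> h; apply: fimpl_eq (fimpl_le _ h) => [r ky|]; last first.
  have : (qsize (start M) + qsize (finish M) + rounds M <= m)%N.
    by apply: leq_trans hm; exact: leq_addr.
  rewrite add0n size_iota; move: (qsize _) (qsize _) (rounds _) => a b c hle.
  rewrite addnCA addnC leq_add //; [lia | apply: leq_mul => //; lia].
rewrite /iact (bits_void (pull i0 _)); congr (run _ _ (conv _ _ _) _).
by apply/opP => z z'; rewrite /sumop big_void fstb_pairb sndb_pairb.
Qed.

End Machine.

Lemma rel_ket_cq I K Q (x : bits I) (r : fam R K Q) :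
  relabel (@sum_assocV I K Q) (tens (ket R x) (cq r)) =
  cq (fun xk => scale_op (fstb xk == x)%:R (r (sndb xk))).
Proof.
apply/opP => u u'; rewrite /relabel /tens /ket /cq /scale_op !pull_assocV.
rewrite !(fstb_pairb, sndb_pairb) [in RHS]pairb_eqE.
case: (fstb (fstb u) =P x) => [->|_]; last by rewrite !mul0r mulr0.
rewrite /= mul1r mulrA -natrM mulnb [x == _]eq_sym.
by case: (fstb (fstb u') == x).
Qed.

Lemma id_bij (T : Type) : bijective (@id T). Proof. by exists id. Qed.

(** I and J become the classical interface of the algorithm, while K and K' travel inside its
    quantum registers as block-diagonal states. This is how one stage passes classical data on to
    the next. *)
Lemma export_cq n I K Q J K' Q' (T : fam R (I + K) Q -> fam R (J + K') Q') :
  fimpl n T ->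
  exists a : qalg I (K + Q) J (K' + Q'), (#|anc a| + size (gates a) <= n)%N /\
    forall x r y, run a x (cq r) y =
      cq (fun k' => T (fun xk => scale_op (fstb xk == x)%:R (r (sndb xk))) (pairb y k')).
Proof.
case=> C hC E.
have := ImplRel (sum_assoc_bij J K' Q')
  (impl_comp (ImplRel (sum_assocV_bij I K Q) (ImplId R _)) hC).
rewrite add0n => /impl_qalg [a [le H]]; exists a; split=> // x r y.
apply/opP => z z'; rewrite H rel_ket_cq E /relabel /cq !pull_assoc !fstb_pairb !sndb_pairb.
by rewrite pairb_eq2 eqxx.
Qed.

Lemma export_prep n I J K' Q' (T : fam R I void -> fam R (J + K') Q') :
  fimpl n T ->
  exists a : qalg I void J (K' + Q'), (#|anc a| + size (gates a) <= n)%N /\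
    forall x rho y, run a x rho y =
      cq (fun k' => T (fun i => scale_op (i == x)%:R rho) (pairb y k')).
Proof.
case=> C hC E.
have := ImplRel (sum_assoc_bij J K' Q') hC.
move=> /impl_qalg [a [le H]]; exists a; split=> // x rho y.
have e : tens (ket R x) rho = cq (fun i => scale_op (i == x)%:R rho).
  apply/opP => u u'; rewrite /tens /ket /cq /scale_op mulrA -natrM mulnb.
  by congr (_%:R * _); case: (fstb u =P x) => [->|]; rewrite ?andbT ?andbF // eq_sym.
apply/opP => z z'; rewrite H e E /relabel /cq !pull_assoc !fstb_pairb !sndb_pairb.
by rewrite pairb_eq2 eqxx.
Qed.

(** [h] exhibits the quantum input as a classical part K beside a quantum part Q; the formula is
    claimed for inputs that are block diagonal in this splitting. *)
Lemma export_meas n I P K Q J (h : P -> K + Q) (T : fam R (I + K) Q -> fam R J void) :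
  bijective h -> fimpl n T ->
  exists a : qalg I P J void, (#|anc a| + size (gates a) <= n)%N /\
    forall x rho r y, relabel h rho = cq r -> run a x rho y =
      T (fun xk => scale_op (fstb xk == x)%:R (r (sndb xk))) y.
Proof.
move=> bh [C hC E].
have := (impl_comp (ImplRel (sum_assocV_bij I K Q) (ImplRel (sum_map_bij (id_bij I) bh)
  (ImplId R _))) hC).
rewrite add0n => /impl_qalg [a [le H]]; exists a; split=> // x rho r y e.
apply/opP => z z'; rewrite H.
have -> : relabel (sum_map id h) (tens (ket R x) rho) = tens (ket R x) (cq r).
  rewrite -e; apply/opP => u u'; rewrite /relabel /tens /ket !pull_sum_map.
  have ide (w : bits I) : pull id w = w by apply/ffunP => ?; rewrite ffunE.
  by rewrite !fstb_pairb !sndb_pairb !ide.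
by rewrite rel_ket_cq E /cq !fstb_pairb !sndb_pairb eqxx mul1r.
Qed.

End Interaction.

(** * Experiments as sums *)

Section Mass.
Variable R : realType.
Implicit Types (I J K P Q W A B E : finType).

Lemma tr_ket_tens I Q (x : bits I) (rho : op R Q) : tr (tens (ket R x) rho) = tr rho.
Proof.
rewrite /tr big_pairb (bigD1 x) //= [X in _ + X]big1 ?addr0 => [|x' ne]; last first.
  by apply: big1 => u _; rewrite /tens /ket !fstb_pairb (negbTE ne) mul0r.
by apply: eq_bigr => u _; rewrite /tens /ket !fstb_pairb !sndb_pairb eqxx mul1r.
Qed.

Lemma tr_run I Q J Q' (a : qalg I Q J Q') x (rho : op R Q) :
  \sum_y tr (run a x rho y) = tr rho.
Proof.
rewrite -(tr_ket_tens x) -(tr_impl _ (impl_channel_of R a)) {2}/tr big_pairb.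
by apply: eq_bigr => y _; apply: eq_bigr => z _; rewrite runE.
Qed.

Lemma sum_sampler I J (a : qalg I void J void) x : \sum_y sampler R a x y = 1.
Proof. by rewrite tr_run /tr big_void. Qed.

Lemma psd_ket_tens I Q (x : bits I) (rho : op R Q) : psd rho -> psd (tens (ket R x) rho).
Proof.
move=> h v; have := h (fun u => v (pairb x u)); congr (0 <= _).
rewrite [RHS]big_pairb (bigD1 x) //= [X in _ + X]big1 ?addr0 => [|x' ne]; last first.
  apply: big1 => u _; apply: big1 => w _.
  by rewrite /tens /ket fstb_pairb (negbTE ne) mul0r mulr0 mul0r.
apply: eq_bigr => u _.
rewrite big_pairb (bigD1 x) //= [X in _ + X]big1 ?addr0 => [|x' ne]; last first.
  apply: big1 => u' _.
  by rewrite /tens /ket !fstb_pairb (negbTE ne) andbF mul0r mulr0 mul0r.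
by apply: eq_bigr => u' _; rewrite /tens /ket !fstb_pairb !sndb_pairb eqxx mul1r.
Qed.

Lemma psd_block J Q (y : bits J) (rho : op R (J + Q)) : psd rho ->
  psd (fun z z' => rho (pairb y z) (pairb y z')).
Proof.
move=> h v; have := h (fun u => (fstb u == y)%:R * v (sndb u)); congr (0 <= _).
rewrite big_pairb (bigD1 y) //= [X in _ + X = _]big1 ?addr0 => [|x' ne]; last first.
  apply: big1 => u _; apply: big1 => w _.
  by rewrite fstb_pairb (negbTE ne) mul0r conjc0 !mul0r.
apply: eq_bigr => u _.
rewrite big_pairb (bigD1 y) //= [X in _ + X = _]big1 ?addr0 => [|x' ne]; last first.
  by apply: big1 => u' _; rewrite !fstb_pairb (negbTE ne) mul0r mulr0.
by apply: eq_bigr => u' _; rewrite !fstb_pairb !sndb_pairb eqxx !mul1r.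
Qed.

Lemma psd_run I Q J Q' (a : qalg I Q J Q') x (rho : op R Q) y :
  psd rho -> psd (run a x rho y).
Proof.
move=> h; have := psd_block y (psd_impl (impl_channel_of R a) (psd_ket_tens x h)).
by congr psd; apply/opP => z z'; rewrite -runE.
Qed.

Lemma sampler_ge0 I J (a : qalg I void J void) x y : 0 <= sampler R a x y.
Proof. exact/psd_tr/psd_run/psd_unit. Qed.

Lemma psd_cq K Q (r : fam R K Q) : (forall k, psd (r k)) -> psd (cq r).
Proof.
move=> h v; rewrite big_pairb; apply: sumr_ge0 => k _.
have := h k (fun u => v (pairb k u)); congr (0 <= _); apply: eq_bigr => u _.
rewrite big_pairb (bigD1 k) //= [X in _ = _ + X]big1 ?addr0 => [|x' ne]; last first.
  by apply: big1 => u' _; rewrite /cq !fstb_pairb eq_sym (negbTE ne) mul0r mulr0 mul0r.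
by apply: eq_bigr => u' _; rewrite /cq !fstb_pairb !sndb_pairb eqxx !mul1r.
Qed.

(** Appending a prepared state is itself implementable, so positivity is inherited from that of
    circuits instead of a statement about tensor products. *)
Lemma psd_tens_run I Q J (a : qalg I void void J) x (rho : op R Q) :
  psd rho -> psd (tens rho (run a x (unit_op R) (zerob void))).
Proof.
move=> h; have [C hC E] := fimpl_prep R a Q (fun i : I => i).
have := psd_impl hC (psd_cq (r := fun _ : bits I => rho) (fun _ => h)).
rewrite E => /(psd_block x); congr psd; apply/opP => z z'.
rewrite /cq !fstb_pairb !sndb_pairb eqxx mul1r.
by have -> : pull (fun i => i) x = x by apply/ffunP => i; rewrite ffunE.
Qed.

Definition mass Q (X : Type) (e : ens R Q X) (F : X -> op R Q -> R[i]) : R[i] :=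
  \sum_(b <- e) F b.1 b.2.

Lemma PrE Q (X : Type) (e : ens R Q X) (P : pred X) :
  Pr e P = complex.Re (mass e (fun x rho => (P x)%:R * tr rho)).
Proof.
rewrite /Pr /mass big_mkcond; congr complex.Re; apply: eq_bigr => b _.
by case: (P b.1); rewrite ?mul1r ?mul0r.
Qed.

Lemma mass_bind Q Q' (X Y : Type) (e : ens R Q X) (k : X -> op R Q -> ens R Q' Y) F :
  mass (bind e k) F = mass e (fun x rho => mass (k x rho) F).
Proof. by rewrite /mass /bind big_flatten big_map. Qed.

Lemma mass_ret Q (X : Type) (x : X) (rho : op R Q) F : mass (ret x rho) F = F x rho.
Proof. by rewrite /mass /ret big_seq1. Qed.

Lemma mass_draw Q J (p : bits J -> R[i]) (rho : op R Q) F :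
  mass (draw p rho) F = \sum_y F y (scale_op (p y) rho).
Proof. by rewrite /mass /draw big_map big_enum. Qed.

Lemma mass_exec I Q J Q' (a : qalg I Q J Q') x (rho : op R Q) F :
  mass (exec a x rho) F = \sum_y F y (run a x rho y).
Proof. by rewrite /mass /exec big_map big_enum. Qed.

Lemma eq_mass Q (X : Type) (e : ens R Q X) F G :
  (forall x rho, F x rho = G x rho) -> mass e F = mass e G.
Proof. by move=> h; apply: eq_bigr => b _; exact: h. Qed.

Lemma mass_sum Q (X : Type) (e : ens R Q X) (Y : finType) (F : Y -> X -> op R Q -> R[i]) :
  mass e (fun x rho => \sum_y F y x rho) = \sum_y mass e (F y).
Proof. by rewrite /mass exchange_big. Qed.

Definition linear_form Q (G : op R Q -> R[i]) : Prop :=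
  forall (X : finType) c (r : X -> op R Q),
    G (lincomb c r) = \sum_x c x * G (r x).

Lemma linf_comp Q Q' (T : op R Q -> op R Q') G : linear_op T -> linear_form G -> linear_form (fun rho => G (T rho)).
Proof. by move=> hT hG X c r; rewrite hT hG. Qed.

Lemma linf_tr Q : linear_form (@tr R Q).
Proof.
move=> X c r; rewrite /tr /lincomb exchange_big /=.
by apply: eq_bigr => x _; rewrite mulr_sumr.
Qed.

Lemma linf_sum Q (X : finType) (G : X -> op R Q -> R[i]) :
  (forall x, linear_form (G x)) -> linear_form (fun rho => \sum_x G x rho).
Proof.
move=> h Y c r; under eq_bigr do rewrite h.
by rewrite exchange_big /=; apply: eq_bigr => y _; rewrite mulr_sumr.
Qed.

Lemma linf_mull Q a (G : op R Q -> R[i]) : linear_form G -> linear_form (fun rho => a * G rho).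
Proof.
move=> h Y c r; rewrite h mulr_sumr; apply: eq_bigr => y _; exact: mulrCA.
Qed.

Lemma linf_sumop Q (G : op R Q -> R[i]) (X : finType) (r : X -> op R Q) :
  linear_form G -> G (sumop r) = \sum_x G (r x).
Proof.
move=> h; have := h X (fun _ => 1) r.
have -> : lincomb (fun _ => 1) r = sumop r.
  by apply/opP => u u'; apply: eq_bigr => x _; rewrite mul1r.
by move=> ->; apply: eq_bigr => x _; rewrite mul1r.
Qed.

Lemma linf_scale Q (G : op R Q -> R[i]) a (r : op R Q) :
  linear_form G -> G (scale_op a r) = a * G r.
Proof.
move=> h; have := h unit (fun _ => a) (fun _ => r).
have -> : lincomb (fun _ : unit => a) (fun _ => r) = scale_op a r.
  by apply/opP => u u'; rewrite /lincomb (bigD1 tt) //= big1 ?addr0 // => -[].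
by rewrite (bigD1 tt) //= big1 ?addr0 // => -[].
Qed.

Definition filt I J (p : pred (bits I)) (O : bits I -> bits J -> R[i]) q a :=
  (p q)%:R * O q a.

Section Interact.
Variables (I Q Qry Ans J Q' : finType) (M : machine I Q Qry Ans J Q').
Variables (O : bits Qry -> bits Ans -> R[i]).

(** The indicator of a log factors over its queries; the last round is absorbed into [G], which
    stays a linear form. *)
Lemma mass_converse (p : pred (bits Qry)) k rho (G : op R (work M) -> R[i]) : linear_form G ->
  mass (converse O k rho) (fun log s => (all p log)%:R * G s) =
  G (conv (fun _ => filt p O) (iota 0 k) rho).
Proof.
elim: k G => [|k IH] G hG; first by rewrite /= mass_ret mul1r.
rewrite -addn1 iotaD /conv foldl_cat /= add0n.
apply: etrans (IH (fun s => G (conv1 (filt p O) k s)) _); last first.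
  exact: linf_comp (lin_conv1 _ _) hG.
rewrite addn1 /= mass_bind; apply: eq_mass => log s.
rewrite mass_bind mass_exec (linf_sumop _ hG) mulr_sumr; apply: eq_bigr => q _.
rewrite mass_bind mass_draw (linf_sumop _ hG) mulr_sumr; apply: eq_bigr => a _.
rewrite mass_bind mass_exec big_void mass_ret all_rcons /filt.
rewrite !(lin_scale _ _ (lin_run (tell M k) _ _)) !(linf_scale _ _ hG) -mulnb natrM.
ring.
Qed.

(** The predicate may depend on the output [y] although [y] is produced after the queries: the
    legality of early key queries refers to messages chosen later. Hence one filtered run for each
    [y]. *)
Lemma mass_interact (p : bits J -> pred (bits Qry)) x rho (G : bits J -> op R Q' -> R[i]) :
  (forall y, linear_form (G y)) ->
  mass (interact M O x rho) (fun t s => (all (p t.2) t.1)%:R * G t.2 s) =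
  \sum_y G y (iact M (fun _ => filt (p y) O) x rho y).
Proof.
move=> hG; rewrite /interact mass_bind mass_exec big_void mass_bind.
have E y : G y (iact M (fun _ => filt (p y) O) x rho y) =
  mass (converse O (rounds M) (run (start M) x rho (zerob void)))
    (fun log s => (all (p y) log)%:R * G y (run (finish M) (zerob void) s y)).
  rewrite (mass_converse _ _ _ (G := fun s => G y (run (finish M) (zerob void) s y))) //.
  exact: linf_comp (lin_run _ _ _) (hG y).
rewrite [RHS](eq_bigr _ (fun y _ => E y)) -mass_sum.
apply: eq_mass => log s; rewrite mass_bind mass_exec.
by apply: eq_bigr => y _; rewrite mass_ret.
Qed.

Definition psd_ens (X : Type) (P : finType) (e : ens R P X) : Prop :=
  foldr (fun b Z => psd b.2 /\ Z) True e.

End Interact.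

Lemma psd_ens_bind Q P (X Y : Type) (e : ens R Q X) (k : X -> op R Q -> ens R P Y) :
  psd_ens e -> (forall x rho, psd rho -> psd_ens (k x rho)) -> psd_ens (bind e k).
Proof.
move=> he hk; rewrite /bind; elim: e he => //= b e IH [hb he].
have := hk b.1 b.2 hb; elim: (k b.1 b.2) => [|c l IHl] /=; first by move=> _; exact: IH.
by case=> hc /IHl.
Qed.

Lemma psd_ens_exec I Q J P (a : qalg I Q J P) x (rho : op R Q) :
  psd rho -> psd_ens (exec a x rho).
Proof. by move=> h; rewrite /exec; elim: (enum _) => //= y l IH; split=> //; exact: psd_run. Qed.

Lemma psd_ens_draw Q J (p : bits J -> R[i]) (rho : op R Q) :
  (forall y, 0 <= p y) -> psd rho -> psd_ens (draw p rho).
Proof. by move=> hp h; rewrite /draw; elim: (enum _) => //= y l IH; split=> //; exact: psd_scale. Qed.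

Lemma psd_ens_interact I Q Qry Ans J Q' (M : machine I Q Qry Ans J Q') O x (rho : op R Q) :
  (forall q a, 0 <= O q a) -> psd rho -> psd_ens (interact M O x rho).
Proof.
move=> hO h; apply: psd_ens_bind => [|_ r1 h1]; first exact: psd_ens_exec.
apply: psd_ens_bind => [|log r2 h2]; last first.
  by apply: psd_ens_bind => [|y r3 h3]; [exact: psd_ens_exec | split].
elim: (rounds M) => [|k IH] /=; first by split.
apply: psd_ens_bind => // log r2 h2.
apply: psd_ens_bind => [|q r3 h3]; first exact: psd_ens_exec.
apply: psd_ens_bind => [|a r4 h4]; first exact: psd_ens_draw.
by apply: psd_ens_bind => [|v r5 h5]; [exact: psd_ens_exec | split].
Qed.

Lemma le_mass Q (X : Type) (e : ens R Q X) F G : psd_ens e ->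
  (forall x rho, psd rho -> F x rho <= G x rho) -> mass e F <= mass e G.
Proof.
rewrite /mass => + h; elim: e => [|b e IH] /=; first by rewrite !big_nil.
by case=> hb he; rewrite !big_cons; apply: lerD; [exact: h | exact: IH].
Qed.

(** Every round preserves the trace when the oracle is normalized, so the total weight is the same
    for all such oracles. This is what later makes the answers to B irrelevant for admissibility. *)
Lemma tr_iact I Q Qry Ans J Q' (M : machine I Q Qry Ans J Q') O x (rho : op R Q) :
  (forall j q, \sum_a O j q a = 1) -> \sum_y tr (iact M O x rho y) = tr rho.
Proof.
move=> hO; rewrite tr_run.
have -> : tr rho = tr (run (start M) x rho (zerob void)).
  by rewrite -(tr_run (start M) x rho) big_void.
elim: (iota _ _) (run _ _ _ _) => //= j s IH r; rewrite /conv /= in IH *; rewrite IH.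
rewrite (linf_sumop _ (@linf_tr _)) -[RHS](tr_run (ask M j) (zerob void)).
apply: eq_bigr => q _; rewrite (linf_sumop _ (@linf_tr _)).
transitivity (\sum_a O j q a * tr (run (ask M j) (zerob void) r q)); last first.
  by rewrite -mulr_suml hO mul1r.
apply: eq_bigr => a _; rewrite -(linf_scale _ _ (@linf_tr _)).
by rewrite -[RHS](tr_run (tell M j) a) big_void.
Qed.

End Mass.

(** * The two reductions *)

Section Scheme.
Variable R : realType.
Implicit Types (I J K P Q W A B E : finType).
Variables (PK MF MS FL ML KL CT CTF FK DS : finType).
Variables (setF : bits (PK + MF) -> R[i]) (setS : bits MS -> R[i])
  (kg : bits MS -> bits FL -> bits KL -> R[i])
  (encS : bits MS -> bits ML -> bits CT -> R[i])
  (encF : bits PK -> bits KL -> bits CTF -> R[i])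
  (key : bits MF -> bits DS -> op R FK).
Variables (a_setF : qalg void void (PK + MF) void) (a_setS : qalg void void MS void)
  (a_kg : qalg (MS + FL) void KL void) (a_encS : qalg (MS + ML) void CT void)
  (a_encF : qalg (PK + KL) void CTF void) (a_key : qalg (MF + DS) void void FK).
Hypothesis setFE : forall x y, setF y = sampler R a_setF x y.
Hypothesis setSE : forall x y, setS y = sampler R a_setS x y.
Hypothesis kgE : forall x y, kg (fstb x) (sndb x) y = sampler R a_kg x y.
Hypothesis encSE : forall x y, encS (fstb x) (sndb x) y = sampler R a_encS x y.
Hypothesis encFE : forall x y, encF (fstb x) (sndb x) y = sampler R a_encF x y.
Hypothesis keyE : forall x,
  key (fstb x) (sndb x) = run a_key x (unit_op R) (zerob void).
Variable gS : bspec CT DS.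
Variable sz : nat.
Hypothesis sz_algs : (qsize a_setF + qsize a_setS + qsize a_kg + qsize a_encS
  + qsize a_encF + qsize a_key <= sz)%N.
Hypothesis sz_regs : (#|PK| + #|MF| + #|MS| + #|FL| + #|ML| + #|KL| + #|CT|
  + #|CTF| + #|FK| + #|DS| <= sz)%N.

Notation QRY := (unit + FL)%type.

(** * The oracles of the experiments as samplers *)

Definition mask J (b : bool) (y : bits J) : bits J := if b then y else zerob J.

Definition real_oracle pk mS : bits QRY -> bits CTF -> R[i] :=
  opt_oracle (fun f a => \sum_k kg mS f k * encF pk k a).
Definition zero_oracle pk : bits QRY -> bits CTF -> R[i] :=
  opt_oracle (fun _ a => encF pk (zerob KL) a).

Lemma kgE2 mS f y : kg mS f y = sampler R a_kg (pairb mS f) y.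
Proof. by rewrite -kgE fstb_pairb sndb_pairb. Qed.

Lemma encSE2 mS m y : encS mS m y = sampler R a_encS (pairb mS m) y.
Proof. by rewrite -encSE fstb_pairb sndb_pairb. Qed.

Lemma encFE2 pk k y : encF pk k y = sampler R a_encF (pairb pk k) y.
Proof. by rewrite -encFE fstb_pairb sndb_pairb. Qed.

Lemma keyE2 mF d : key mF d = run a_key (pairb mF d) (unit_op R) (zerob void).
Proof. by rewrite -keyE fstb_pairb sndb_pairb. Qed.

Lemma sum_kg mS f : \sum_k kg mS f k = 1.
Proof. by under eq_bigr => k _ do rewrite kgE2; exact: sum_sampler. Qed.

Lemma sum_encF pk k : \sum_a encF pk k a = 1.
Proof. by under eq_bigr => a _ do rewrite encFE2; exact: sum_sampler. Qed.

Lemma sum_opt_oracle I J (O : bits I -> bits J -> R[i]) q :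
  (forall x, \sum_y O x y = 1) -> \sum_y opt_oracle O q y = 1.
Proof.
rewrite /opt_oracle; case: (optb q) => [x|] // _.
by rewrite (bigD1 (zerob J)) //= eqxx big1 ?addr0 // => y /negbTE ->.
Qed.

Lemma sum_real_oracle pk mS q : \sum_a real_oracle pk mS q a = 1.
Proof.
apply: sum_opt_oracle => f; rewrite exchange_big /=.
by under eq_bigr => k _ do rewrite -mulr_sumr sum_encF mulr1; exact: sum_kg.
Qed.

Lemma sum_zero_oracle pk q : \sum_a zero_oracle pk q a = 1.
Proof. by apply: sum_opt_oracle => f; exact: sum_encF. Qed.

(** A circuit of fixed shape cannot skip the encryption when no query is made: an answer is always
    drawn and then blanked. Normalization of [p] makes the discarded draw invisible. *)
Lemma sum_mask J (p : bits J -> R[i]) b a : \sum_y p y = 1 ->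
  \sum_y p y * (a == mask b y)%:R = if b then p a else (a == zerob J)%:R.
Proof.
move=> h; case: b => /=; last by rewrite -mulr_suml h mul1r.
rewrite (bigD1 a) //= eqxx mulr1 big1 ?addr0 // => y ne.
by rewrite eq_sym (negbTE ne) mulr0.
Qed.

Definition mask_spec K J (w : K) : bspec (K + J) J := fun j => inr (inr j, inl w).

Lemma bspec_eval_mask K J (w : K) (k : bits K) (y : bits J) :
  bspec_eval (@mask_spec K J w) (pairb k y) = mask (k w) y.
Proof.
by apply/ffunP => j; rewrite /mask !ffunE /= !ffunE; case: (k w); rewrite ?andbT ?andbF ?ffunE.
Qed.

Lemma fsampler_enc K (ip : PK -> K) (ik : KL -> K) (w : K) :
  fsampler (8 * sz) (fun k (a : bits CTF) =>
    \sum_a0 encF (pull ip k) (pull ik k) a0 * (a == mask (k w) a0)%:R).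
Proof.
pose i (x : PK + KL) : K := match x with inl p => ip p | inr j => ik j end.
have h := fsampler_bind (fsampler_alg R a_encF i)
  (fsampler_det R (@mask_spec K CTF w)).
apply: fsampler_le (fsampler_eq _ h) => [|k a].
  move: (qsize a_encF) sz_algs sz_regs => x; lia.
apply: eq_bigr => a0 _; rewrite bspec_eval_mask -encFE; congr (encF _ _ _ * _); bitsE.
Qed.

(** An SKFE key is drawn in every round, for 6 units, and its masked encryption takes the other 8.
    For a declined query the key is summed away. *)
Lemma fsampler_real K (ip : PK -> K) (im : MS -> K) :
  fsampler (14 * sz) (fun (kq : bits (K + QRY)) =>
    real_oracle (pull ip (fstb kq)) (pull im (fstb kq)) (sndb kq)).
Proof.
pose i1 (x : MS + FL) : K + QRY := match x with inl m => inl (im m) | inr f => inr (inr f) end.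
have h := fsampler_bind (fsampler_alg R a_kg i1)
  (@fsampler_enc (K + QRY + KL)%type (fun p => inl (inl (ip p))) inr (inl (inr (inl tt)))).
apply: fsampler_le (fsampler_eq _ h) => [|kq a].
  move: (qsize a_kg) sz_algs sz_regs => x; lia.
have e y : sampler R a_kg (pull i1 kq) y = kg (pull im (fstb kq)) (sndb (sndb kq)) y.
  by rewrite -kgE; congr (kg _ _ _); bitsE.
under eq_bigr => k _.
  rewrite e.
  have -> : pull (fun p => inl (inl (ip p))) (pairb kq k) = pull ip (fstb kq) by bitsE.
  have -> : pull inr (pairb kq k) = k by exact: sndb_pairb.
  rewrite sum_mask; last exact: sum_encF.
  have -> : pairb kq k (inl (inr (inl tt))) = sndb kq (inl tt) by rewrite !ffunE.
  over.
rewrite /real_oracle /opt_oracle /optb /=; case: (sndb kq (inl tt)) => //.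
by rewrite -mulr_suml sum_kg mul1r.
Qed.

(** No SKFE data enters, so whoever holds [pk] can run this oracle. *)
Lemma fsampler_zero K (ip : PK -> K) :
  fsampler (10 * sz) (fun (kq : bits (K + QRY)) =>
    zero_oracle (pull ip (fstb kq)) (sndb kq)).
Proof.
pose s0 : bspec (K + QRY) KL := fun _ => inl false.
have dE u : bspec_eval s0 u = zerob KL by bitsE.
have h := fsampler_bind (fsampler_det R s0)
  (@fsampler_enc (K + QRY + KL)%type (fun p => inl (inl (ip p))) inr (inl (inr (inl tt)))).
apply: fsampler_le (fsampler_eq _ h) => [|kq a].
  move: sz_algs sz_regs; lia.
rewrite (bigD1 (zerob KL)) //= [X in _ + X]big1 ?addr0 => [|k ne]; last first.
  by rewrite dE (negbTE ne) mul0r.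
rewrite dE eqxx mul1r.
have -> : pull (fun p => inl (inl (ip p))) (pairb kq (zerob KL)) = pull ip (fstb kq) by bitsE.
have -> : pull inr (pairb kq (zerob KL)) = zerob KL by exact: sndb_pairb.
rewrite sum_mask; last exact: sum_encF.
have -> : pairb kq (zerob KL) (inl (inr (inl tt))) = sndb kq (inl tt) by rewrite !ffunE.
by rewrite /zero_oracle /opt_oracle /optb /=; case: (sndb kq (inl tt)).
Qed.

Definition spec_map K K' J (h : K -> K') (s : bspec K J) : bspec K' J :=
  fun j => match s j with inl c => inl c | inr cd => inr (h cd.1, h cd.2) end.

Lemma bspec_eval_map K K' J (h : K -> K') (s : bspec K J) (k : bits K') :
  bspec_eval (spec_map h s) k = bspec_eval s (pull h k).
Proof.
by apply/ffunP => j; rewrite !ffunE /spec_map; case: (s j) => //= cd; rewrite !ffunE.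
Qed.

(** * The adversary against UTK security *)

Definition chosen (b : bool) (m : bits (ML + ML)) : bits ML := if b then sndb m else fstb m.

Variables (QA QS : finType).
Variables (A1 : machine void void QRY CTF (ML + ML) QA)
  (A2 : machine void (QA + FK) QRY CTF QS void)
  (B : machine QS void QRY CTF unit void).
Hypothesis sz_mach : (msize A1 + msize A2 + msize B <= sz)%N.

Notation K0 := (PK + MS)%type.

Let no_wire K (x : void) : K := match x with end.

Lemma pull_no_wire K (k : bits K) : pull (no_wire K) k = zerob void.
Proof. exact: bits_void. Qed.

Lemma sum_pick (T : finType) (x : T) (F : T -> R[i]) : \sum_y (y == x)%:R * F y = F x.
Proof.
by rewrite (bigD1 x) //= eqxx mul1r big1 ?addr0 // => y /negbTE ->; rewrite mul0r.
Qed.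

Lemma scale_scale Q a c (rho : op R Q) : scale_op a (scale_op c rho) = scale_op (a * c) rho.
Proof. by apply/opP => u u'; rewrite /scale_op mulrA. Qed.

Lemma eq_sumop Q (X : finType) (F G : X -> op R Q) :
  (forall x, F x = G x) -> sumop F = sumop G.
Proof. by move=> e; congr sumop; apply/funext. Qed.

Lemma sumop_pick Q (X : finType) (x : X) (F : X -> op R Q) :
  sumop (fun y => scale_op (y == x)%:R (F y)) = F x.
Proof.
by apply/opP => u u'; rewrite /sumop /scale_op (sum_pick x (fun y => F y u u')).
Qed.

Lemma sum_mask_fun J (p : bits J -> R[i]) b (G : bits J -> R[i]) : \sum_y p y = 1 ->
  \sum_y p y * G (mask b y) = \sum_a (if b then p a else (a == zerob J)%:R) * G a.
Proof.
by move=> h; case: b => //=; rewrite sum_pick -mulr_suml h mul1r.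
Qed.

Lemma scale1 Q (rho : op R Q) : scale_op 1 rho = rho.
Proof. by apply/opP => u u'; rewrite /scale_op mul1r. Qed.

Lemma msize_start I Q Qry Ans J Q' (M : machine I Q Qry Ans J Q') :
  (qsize (start M) + qsize (finish M) + rounds M <= msize M)%N.
Proof. exact: leq_addr. Qed.

Lemma msize_round I Q Qry Ans J Q' (M : machine I Q Qry Ans J Q') j :
  (j < rounds M)%N -> (qsize (ask M j) + qsize (tell M j) <= msize M)%N.
Proof.
by move=> lt; apply: leq_trans (leq_addl _ _); rewrite (bigD1 (Ordinal lt)) //= leq_addr.
Qed.

(* The stages of the UTK adversary attacking round i of B.  It samples msk_SKFE
   itself; its classical string consists of pk, msk_SKFE and the string st of A. *)
Lemma utk_A1 b : exists a : qalg PK void DS (K0 + QA),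
  (#|anc a| + size (gates a) <= 40 * sz + 20 * sz * sz)%N /\
  forall pk rho f, run a pk rho f = cq (fun k0 : bits K0 => sumop (fun m =>
    scale_op ((\sum_ct encS (sndb k0) (chosen b m) ct * (f == bspec_eval gS ct)%:R) *
              (setS (sndb k0) * (fstb k0 == pk)%:R))
      (iact A1 (fun _ => real_oracle (fstb k0) (sndb k0)) (zerob void) rho m))).
Proof.
have p1 := fimpl_sample R a_setS void (no_wire PK).
have p2 : fimpl _ _ := fimpl_iact (M := A1)
  (O := fun (k0 : bits K0) _ => real_oracle (fstb k0) (sndb k0)) (no_wire K0)
  (fun j _ => fsampler_real inl inr) (m := sz) _.
(* The bit [b] of the experiment is a matter of wiring; it is unrelated to the challenge bit of the
   UTK game. *)
pose ie (x : MS + ML) : K0 + (ML + ML) := match x with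
  | inl m => inl (inr m) | inr x => inr (if b then inr x else inl x) end.
have p3 := fsampler_bind (fsampler_alg R a_encS ie)
  (fsampler_det R (spec_map (@inr (K0 + (ML + ML)) CT) gS)).
pose w (x : K0 + (ML + ML) + DS) : (DS + K0) + (ML + ML) := match x with
  | inl (inl k) => inl (inr k) | inl (inr m) => inr m | inr d => inl (inl d) end.
pose w' (x : (DS + K0) + (ML + ML)) : K0 + (ML + ML) + DS := match x with
  | inl (inr k) => inl (inl k) | inr m => inl (inr m) | inl (inl d) => inr d end.
have bw : bijective w by exists w'; do 2?case.
have := fimpl_comp p1 (fimpl_comp (p2 _) (fimpl_comp (p3 _) (fimpl_rewire R _ bw))).
move=> /(_ _)/export_prep [|a [le H]]; first by move: sz_mach; lia.
exists a; split.
  apply: leq_trans le _.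
  move: (qsize a_setS) (qsize a_encS) sz_algs sz_regs sz_mach => x y; nia.
move=> pk rho f; rewrite H; congr cq; apply/funext => k0.
apply/opP => z z'; apply: eq_bigr => m _.
have -> : pull w (pairb (pairb f k0) m) = pairb (pairb k0 m) f by bitsE.
rewrite !fstb_pairb !sndb_pairb !pull_no_wire -setSE scale_scale.
rewrite (lin_scale _ _ (lin_iact _ _ _ _)) scale_scale.
congr (scale_op _ _ _ _); congr (_ * _).
apply: eq_bigr => ct _; rewrite bspec_eval_map.
have -> : pull inr (pairb (pairb k0 m) ct) = ct by exact: sndb_pairb.
congr (_ * _); rewrite -encSE; congr (encS _ _ _); first by bitsE.
by rewrite /chosen; apply/ffunP => x; rewrite !ffunE /=; case: ifP; rewrite !ffunE.
Qed.

Lemma rel_assoc_tens K Q P (r : fam R K Q) (kappa : op R P) :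
  relabel (@sum_assoc K Q P) (tens (cq r) kappa) = cq (fun k => tens (r k) kappa).
Proof.
apply/opP => u u'; rewrite /relabel /tens /cq !pull_assoc !(fstb_pairb, sndb_pairb).
by rewrite mulrA.
Qed.

(** [kappa] is arbitrary because the function key comes from the challenger. The measured string
    repeats [k0], so that the next stage can keep answering key queries. *)
Lemma utk_A2 : exists a : qalg void (K0 + QA + FK) (K0 + QS) void,
  (#|anc a| + size (gates a) <= 40 * sz + 20 * sz * sz)%N /\
  forall (r : fam R K0 QA) kappa k0 s,
    run a (zerob void) (tens (cq r) kappa) (pairb k0 s) =
    iact A2 (fun _ => real_oracle (fstb k0) (sndb k0)) (zerob void) (tens (r k0) kappa) s.
Proof.
have p2 : fimpl _ _ := fimpl_iact (M := A2)
  (O := fun (k0 : bits (void + K0)) _ => real_oracle (pull (fun p => inr (inl p)) k0)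
     (pull (fun p => inr (inr p)) k0)) (no_wire (void + K0)%type)
  (fun j _ => fsampler_real _ _) (m := sz) _.
pose w (x : void + K0 + QS) : K0 + QS := match x with
  | inl (inl v) => match v with end | inl (inr k) => inl k | inr s => inr s end.
pose w' (x : K0 + QS) : void + K0 + QS := match x with
  | inl k => inl (inr k) | inr s => inr s end.
have bw : bijective w by exists w'; do 2?case.
have := fimpl_comp (p2 _) (fimpl_perm R _ bw).
move=> /(_ _)/(export_meas (sum_assoc_bij _ _ _)) [|a [le H]]; first by move: sz_mach; lia.
exists a; split; first by apply: leq_trans le _; nia.
move=> r kappa k0 s; rewrite (H _ _ _ _ (rel_assoc_tens r kappa)) pull_no_wire.
have -> : pull w (pairb k0 s) = pairb (pairb (zerob void) k0) s by bitsE.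
rewrite !(fstb_pairb, sndb_pairb) eqxx scale1.
by congr (iact _ _ _ _ _); apply/funext => _; congr real_oracle; bitsE.
Qed.

(** B is played with genuine answers up to its query of round [i]; the challenge messages are a
    fresh SKFE key for that query and the zero string. The query stays in the state because its
    leading bit decides later whether the answer is blanked. *)
Lemma utk_B0 i : (i < rounds B)%N ->
  exists a : qalg (K0 + QS) void (KL + KL) (K0 + QRY + work B),
  (#|anc a| + size (gates a) <= 40 * sz + 20 * sz * sz)%N /\
  forall k0 s rho m, run a (pairb k0 s) rho m = cq (fun kq : bits (K0 + QRY) =>
    scale_op ((sndb m == zerob KL)%:R * kg (sndb k0) (sndb (sndb kq)) (fstb m) *
              (fstb kq == k0)%:R)
      (run (ask B i) (zerob void) (conv (fun _ => real_oracle (fstb k0) (sndb k0))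
         (iota 0 i) (run (start B) s rho (zerob void))) (sndb kq))).
Proof.
move=> lti.
have p1 := fimpl_run R (start B) (@inr K0 QS).
have p4 : fimpl _ _ := fimpl_conv (M := B)
  (O := fun (k0 : bits K0) _ => real_oracle (fstb k0) (sndb k0)) (s := iota 0 i)
  (fun j _ => fsampler_real inl inr) (m := sz) _.
have p5 := fimpl_run R (ask B i) (no_wire K0).
pose ik (x : MS + FL) : K0 + QRY := match x with
  | inl m => inl (inr m) | inr f => inr (inr f) end.
have p6 := fsampler_alg R a_kg ik.
pose s0 : bspec (K0 + QRY + KL) KL := fun _ => inl false.
have dE u : bspec_eval s0 u = zerob KL by bitsE.
have p7 := fsampler_det R s0.
pose w (x : K0 + QRY + KL + KL) : (KL + KL) + (K0 + QRY) := match x with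
  | inl (inl k) => inr k | inl (inr j) => inl (inl j) | inr j => inl (inr j) end.
pose w' (x : (KL + KL) + (K0 + QRY)) : K0 + QRY + KL + KL := match x with
  | inr k => inl (inl k) | inl (inl j) => inl (inr j) | inl (inr j) => inr j end.
have bw : bijective w by exists w'; do 2?case.
have := fimpl_comp p1 (fimpl_comp (fimpl_drop R _ _ _) (fimpl_comp (fimpl_drop R _ _ _)
  (fimpl_comp (p4 _) (fimpl_comp p5 (fimpl_comp (p6 _) (fimpl_comp (p7 _) (fimpl_perm R _ bw))))))).
have ms := msize_start B; have mr j := msize_round (M := B) (j := j).
move=> /(_ _)/export_prep [|a [le H]].
  move=> j; rewrite mem_iota => /andP[_ lj]; have := mr j (ltn_trans lj lti); lia.
exists a; split.
  apply: leq_trans le _; have := mr i lti; rewrite size_iota.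
  move: (qsize (start B)) (qsize (ask B i)) (qsize (tell B i)) (qsize (finish B)) (qsize a_kg)
    (msize B) (rounds B) sz_algs sz_regs sz_mach ms lti => x1 x2 x3 x5 x4 mb rb; nia.
move=> k0 s rho m; rewrite H; congr cq; apply/funext => kq.
have -> : pull w (pairb m kq) = pairb (pairb kq (fstb m)) (sndb m) by bitsE.
rewrite !(fstb_pairb, sndb_pairb) dE scale_scale !pull_no_wire.
have -> : (sampler R a_kg (pull ik kq) (fstb m)) = kg (sndb (fstb kq)) (sndb (sndb kq)) (fstb m).
  by rewrite -kgE; congr (kg _ _ _); bitsE.
have -> : sumop (fun y : bits QS => sumop (fun y0 : bits void =>
      run (start B) (pull inr (fstb (pairb (pairb (fstb kq) y) y0)))
        (scale_op (fstb (pairb (pairb (fstb kq) y) y0) == pairb k0 s)%:R rho)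
        (sndb (pairb (pairb (fstb kq) y) y0)))) =
   scale_op (fstb kq == k0)%:R (run (start B) s rho (zerob void)).
  apply/opP => z z'; rewrite /sumop (bigD1 s) //= [X in _ + X]big1 ?addr0 => [|y ne]; last first.
    rewrite big_void !(fstb_pairb, sndb_pairb) pairb_eq2 (negbTE ne) andbF.
    by rewrite (lin_scale _ _ (lin_run _ _ _)) /scale_op mul0r.
  rewrite big_void !(fstb_pairb, sndb_pairb) pairb_eq2 eqxx andbT.
  rewrite (lin_scale _ _ (lin_run _ _ _)); congr (scale_op _ (run _ _ _ _) _ _).
  exact: sndb_pairb.
rewrite (lin_scale _ _ (lin_conv _ _)) (lin_scale _ _ (lin_run _ _ _)) scale_scale.
(* The oracle reads its keys from the register, the claim takes them from [k0]; the weight vanishes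
   unless both agree. *)
have [->//|ne] := eqVneq (fstb kq) k0.
by rewrite mulr0; apply/opP => z z'; rewrite /scale_op mulr0 !mul0r.
Qed.

(** The challenge ciphertext serves as the answer of round [i], blanked if B declined to query, and
    all later rounds get encryptions of 0. *)
Lemma utk_B1 i : (i < rounds B)%N ->
  exists a : qalg CTF (K0 + QRY + work B) unit void,
  (#|anc a| + size (gates a) <= 40 * sz + 20 * sz * sz)%N /\
  forall (r : fam R (K0 + QRY) (work B)) ct y, run a ct (cq r) y =
    sumop (fun k0 : bits K0 => run (finish B) (zerob void)
      (conv (fun _ => zero_oracle (fstb k0)) (iota i.+1 (rounds B - i.+1))
        (sumop (fun q : bits QRY => run (tell B i) (mask (q (inl tt)) ct) (r (pairb k0 q)) (zerob void)))) y).
Proof.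
move=> lti.
pose s1 : bspec (CTF + (K0 + QRY)) CTF := fun j => inr (inl j, inr (inr (inl tt))).
have dE u : bspec_eval s1 u = mask (sndb (sndb u) (inl tt)) (fstb u).
  by apply/ffunP => j; rewrite /mask !ffunE /=; case: ifP => e; rewrite ?andbT ?andbF ?ffunE ?e.
have p1 := fsampler_det R s1.
have p2 := fimpl_run R (tell B i) (@inr (CTF + (K0 + QRY)) CTF).
pose v (x : CTF + (K0 + QRY) + CTF + void) : K0 + (QRY + (CTF + CTF)) := match x with
  | inl (inl (inl c)) => inr (inr (inl c)) | inl (inl (inr (inl k))) => inl k
  | inl (inl (inr (inr q))) => inr (inl q) | inl (inr c) => inr (inr (inr c))
  | inr e => match e with end end.
pose v' (x : K0 + (QRY + (CTF + CTF))) : CTF + (K0 + QRY) + CTF + void := match x with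
  | inr (inr (inl c)) => inl (inl (inl c)) | inl k => inl (inl (inr (inl k)))
  | inr (inl q) => inl (inl (inr (inr q))) | inr (inr (inr c)) => inl (inr c) end.
have bv : bijective v by exists v'; [case=> [[[c|[k|q]]|c]|[]] | case=> [k|[q|[c|c]]]].
have p4 : fimpl _ _ := fimpl_conv (M := B)
  (O := fun (k0 : bits K0) _ => zero_oracle (fstb k0)) (s := iota i.+1 (rounds B - i.+1))
  (fun j _ => fsampler_zero inl) (m := sz) _.
have p5 := fimpl_run R (finish B) (no_wire K0).
have p6 := fimpl_rewire R void (sum_swap_bij K0 unit).
have := fimpl_comp (p1 _) (fimpl_comp p2 (fimpl_comp (fimpl_rewire R _ bv)
  (fimpl_comp (p4 _) (fimpl_comp p5 p6)))).
have ms := msize_start B; have mr j := msize_round (M := B) (j := j).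
move=> /(_ _)/(export_meas (id_bij _)) [|a [le H]].
  move=> j; rewrite mem_iota subnKC // => /andP[_ lj]; have := mr j lj; lia.
exists a; split.
  apply: leq_trans le _; have := mr i lti; rewrite size_iota.
  move: (qsize (start B)) (qsize (ask B i)) (qsize (tell B i)) (qsize (finish B))
    (msize B) (rounds B) sz_algs sz_regs sz_mach ms lti => x1 x2 x3 x4 mb rb; nia.
move=> r ct y; rewrite (H ct (cq r) r); last first.
  by apply/opP => u u'; congr (cq r _ _); apply/ffunP => x; rewrite ffunE.
apply/opP => z z'; apply: eq_bigr => k0 _; rewrite pull_no_wire.
have -> : pull (@sum_swap K0 unit) (pairb y k0) = pairb k0 y by bitsE.
rewrite !(fstb_pairb, sndb_pairb); congr (run _ _ (conv _ _ _) _ _ _).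
apply/opP => x x'; rewrite /sumop big_pairb; apply: eq_bigr => q _.
rewrite big_pairb (bigD1 ct) //= [X in _ + X]big1 ?addr0 => [|c ne]; last first.
  apply: big1 => a' _.
  have -> : pull v (pairb k0 (pairb q (pairb c a'))) =
    pairb (pairb (pairb c (pairb k0 q)) a') (zerob void) by bitsE.
  rewrite !(fstb_pairb, sndb_pairb) (negbTE ne) scale_scale mulr0.
  by rewrite (lin_scale _ _ (lin_run _ _ _)) /scale_op mul0r.
rewrite (bigD1 (mask (q (inl tt)) ct)) //= [X in _ + X]big1 ?addr0 => [|a' ne]; last first.
  have -> : pull v (pairb k0 (pairb q (pairb ct a'))) =
    pairb (pairb (pairb ct (pairb k0 q)) a') (zerob void) by bitsE.
  rewrite !(fstb_pairb, sndb_pairb) dE !(fstb_pairb, sndb_pairb) (negbTE ne) scale_scale mul0r.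
  by rewrite (lin_scale _ _ (lin_run _ _ _)) /scale_op mul0r.
have -> a' : pull v (pairb k0 (pairb q (pairb ct a'))) =
    pairb (pairb (pairb ct (pairb k0 q)) a') (zerob void) by bitsE.
rewrite !(fstb_pairb, sndb_pairb) dE !(fstb_pairb, sndb_pairb) !eqxx !scale1.
by congr (run _ _ _ _ _ _); exact: sndb_pairb.
Qed.

(** The two ends are [hyb 0], which depends on [pk] alone, and [hyb (rounds B)], which is the real
    oracle in every round that B plays. *)
Definition hyb i (pk : bits PK) (mS : bits MS) (j : nat) :=
  if (j < i)%N then real_oracle pk mS else zero_oracle pk.

(* The experiments of the proof: the oracles O12 and O3 answer the key queries of
   the two adversaries, and only the branches accepted by P and fin are counted. *)
Definition game b (P : pred (bits (ML + ML)))
    (O12 : bits (ML + ML) -> bits PK -> bits MS -> bits QRY -> bits CTF -> R[i])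
    (O3 : bits PK -> bits MS -> nat -> bits QRY -> bits CTF -> R[i])
    (fin : pred (bits unit)) : R[i] :=
  \sum_kF \sum_mS setF kF * setS mS *
  \sum_m (P m)%:R * \sum_ct encS mS (chosen b m) ct *
  \sum_st \sum_y (fin y)%:R * tr (iact B (O3 (fstb kF) mS) st
     (iact A2 (fun _ => O12 m (fstb kF) mS) (zerob void)
       (tens (iact A1 (fun _ => O12 m (fstb kF) mS) (zerob void) (unit_op R) m)
             (key (sndb kF) (bspec_eval gS ct))) st) y).

(** Challenge bit false encrypts the SKFE key in round [i], hence the index [i.+1]; challenge bit
    true encrypts 0, and the key drawn in vain sums to 1. *)
Lemma utk_B_step i (be : bool) (B0 : qalg (K0 + QS) void (KL + KL) (K0 + QRY + work B))
   (B1 : qalg CTF (K0 + QRY + work B) unit void) : (i < rounds B)%N ->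
  (forall k0 s rho m, run B0 (pairb k0 s) rho m = cq (fun kq : bits (K0 + QRY) =>
    scale_op ((sndb m == zerob KL)%:R * kg (sndb k0) (sndb (sndb kq)) (fstb m) *
              (fstb kq == k0)%:R)
      (run (ask B i) (zerob void) (conv (fun _ => real_oracle (fstb k0) (sndb k0))
         (iota 0 i) (run (start B) s rho (zerob void))) (sndb kq)))) ->
  (forall (r : fam R (K0 + QRY) (work B)) ct y, run B1 ct (cq r) y =
    sumop (fun k0 : bits K0 => run (finish B) (zerob void)
      (conv (fun _ => zero_oracle (fstb k0)) (iota i.+1 (rounds B - i.+1))
        (sumop (fun q : bits QRY => run (tell B i) (mask (q (inl tt)) ct) (r (pairb k0 q)) (zerob void)))) y)) ->
  forall pk mS s rho y,
  sumop (fun m => sumop (fun ct => run B1 ct (scale_op (encF pk (if be then sndb m else fstb m) ct)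
      (run B0 (pairb (pairb pk mS) s) rho m)) y)) =
  iact B (hyb (if be then i else i.+1) pk mS) s rho y.
Proof.
move=> lti H0 H1 pk mS s rho y.
rewrite /iact.
have -> : iota 0 (rounds B) = iota 0 i ++ i :: iota i.+1 (rounds B - i.+1).
  have e1 : iota 0 i.+1 = iota 0 i ++ [:: i] by rewrite -addn1 iotaD.
  by rewrite -{1}(subnKC lti) iotaD e1 -catA.
rewrite /conv foldl_cat /= -!/(conv _ _ _).
set rho0 := run (start B) s rho (zerob void).
have -> : conv (hyb (if be then i else i.+1) pk mS) (iota 0 i) rho0 =
          conv (fun _ => real_oracle pk mS) (iota 0 i) rho0.
  apply: eq_conv => j; rewrite mem_iota => /andP[_ lj]; rewrite /hyb.
  by have -> : (j < (if be then i else i.+1))%N by case: (be) => //; exact: ltnW.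
set rho1 := conv _ _ rho0.
(* Everything after round [i] is one linear map, common to both hybrids; only round [i] itself has
   to be compared. *)
set T := fun r => run (finish B) (zerob void)
  (conv (fun _ => zero_oracle pk) (iota i.+1 (rounds B - i.+1)) r) y.
have -> : run (finish B) (zerob void) (conv (hyb (if be then i else i.+1) pk mS)
   (iota i.+1 (rounds B - i.+1))
   (conv1 (hyb (if be then i else i.+1) pk mS i) i rho1)) y =
   T (conv1 (if be then zero_oracle pk else real_oracle pk mS) i rho1).
  rewrite /T; congr (run _ _ _ _); rewrite {2}/hyb.
  have -> : (if (i < (if be then i else i.+1))%N then real_oracle pk mS else zero_oracle pk) =
            if be then zero_oracle pk else real_oracle pk mS.
    by case: (be); rewrite ?ltnn ?ltnSn.
  apply: eq_conv => j; rewrite mem_iota => /andP[lj _]; rewrite /hyb.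
  have -> // : (j < (if be then i else i.+1))%N = false.
  by case: (be); rewrite ltnNge ?lj ?(ltnW lj).
have linT : linear_op T.
  move=> X c r; rewrite /T (lin_conv (M := B)); exact: lin_run.
have step m ct : run B1 ct (scale_op (encF pk (if be then sndb m else fstb m) ct)
      (run B0 (pairb (pairb pk mS) s) rho m)) y =
  T (sumop (fun q => scale_op (encF pk (if be then sndb m else fstb m) ct *
     ((sndb m == zerob KL)%:R * kg mS (sndb q) (fstb m)))
     (run (tell B i) (mask (q (inl tt)) ct) (run (ask B i) (zerob void) rho1 q) (zerob void)))).
  rewrite (lin_scale _ _ (lin_run _ _ _)) H0 H1.
  have E k0 : run (finish B) (zerob void) (conv (fun _ => zero_oracle (fstb k0))
      (iota i.+1 (rounds B - i.+1)) (sumop (fun q : bits QRY => run (tell B i) (mask (q (inl tt)) ct)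
         (scale_op ((sndb m == zerob KL)%:R * kg (sndb (pairb pk mS)) (sndb (sndb (pairb k0 q))) (fstb m)
            * (fstb (pairb k0 q) == pairb pk mS)%:R)
         (run (ask B i) (zerob void) (conv (fun _ => real_oracle (fstb (pairb pk mS)) (sndb (pairb pk mS)))
            (iota 0 i) rho0) (sndb (pairb k0 q)))) (zerob void)))) y =
     scale_op (k0 == pairb pk mS)%:R (run (finish B) (zerob void) (conv (fun _ => zero_oracle (fstb k0))
      (iota i.+1 (rounds B - i.+1)) (sumop (fun q : bits QRY =>
        scale_op ((sndb m == zerob KL)%:R * kg mS (sndb q) (fstb m))
          (run (tell B i) (mask (q (inl tt)) ct) (run (ask B i) (zerob void) rho1 q) (zerob void))))) y).
    rewrite -(lin_scale _ _ (lin_run _ _ _)) -(lin_scale _ _ (lin_conv _ _)).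
    congr (run _ _ (conv _ _ _) _); apply/opP => u u'; rewrite /sumop [RHS]mulr_sumr.
    apply: eq_bigr => q _; rewrite !(fstb_pairb, sndb_pairb) (lin_scale _ _ (lin_run _ _ _)).
    by rewrite /scale_op mulrA [_ * (k0 == _)%:R]mulrC.
  rewrite (eq_sumop E) sumop_pick fstb_pairb -/(T _) -(lin_scale _ _ linT); congr T.
  apply/opP => u u'; rewrite /scale_op /sumop mulr_sumr.
  by apply: eq_bigr => q _; rewrite mulrA.
under eq_sumop => m do under eq_sumop => ct do rewrite step.
under eq_sumop => m do rewrite -(lin_sum _ linT).
rewrite -(lin_sum _ linT); congr T.
apply/opP => u u'; rewrite /conv1 /sumop.
under eq_bigr => m _ do rewrite exchange_big /=.
rewrite exchange_big /=; apply: eq_bigr => q _.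
set X := run (ask B i) _ _ _; pose G a := run (tell B i) a X (zerob void) u u'.
transitivity (\sum_m1 \sum_ct encF pk (if be then zerob KL else m1) ct * kg mS (sndb q) m1
                * G (mask (q (inl tt)) ct)).
  rewrite big_pairb; apply: eq_bigr => m1 _.
  rewrite (bigD1 (zerob KL)) //= [X in _ + X]big1 ?addr0 => [|m2 ne]; last first.
    apply: big1 => ct _; rewrite sndb_pairb (negbTE ne) !mul0r mulr0.
    by rewrite /scale_op mul0r.
  by apply: eq_bigr => ct _; rewrite !(fstb_pairb, sndb_pairb) eqxx mul1r.
transitivity (\sum_ct (if be then encF pk (zerob KL) ct else \sum_m1 kg mS (sndb q) m1 * encF pk m1 ct)
                * G (mask (q (inl tt)) ct)).
  rewrite exchange_big /=; apply: eq_bigr => ct _; rewrite -mulr_suml; congr (_ * _).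
  case: (be); first by rewrite -mulr_sumr sum_kg mulr1.
  by apply: eq_bigr => m1 _; rewrite mulrC.
rewrite sum_mask_fun; last first.
  case: (be); first exact: sum_encF.
  rewrite exchange_big /=.
  by under eq_bigr => k _ do rewrite -mulr_sumr sum_encF mulr1; exact: sum_kg.
apply: eq_bigr => a _; rewrite (lin_scale _ _ (lin_run _ _ _)) /scale_op; congr (_ * _).
rewrite /real_oracle /zero_oracle /opt_oracle /optb.
by case: (be); case: (q (inl tt)).
Qed.

Lemma linf_finish O O' x (kappa : op R FK) st y :
  linear_form (fun rho => tr (iact B O st (iact A2 O' x (tens rho kappa) st) y)).
Proof.
apply: (linf_comp (T := fun rho => tens rho kappa)
  (G := fun rho => tr (iact B O st (iact A2 O' x rho st) y))) (lin_tens _) _.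
apply: (linf_comp (T := fun rho => iact A2 O' x rho st)
  (G := fun rho => tr (iact B O st rho y))) (lin_iact _ _ _ _) _.
exact: (linf_comp (T := fun rho => iact B O st rho y)) (lin_iact _ _ _ _) (@linf_tr R _).
Qed.

(** The function requested from the challenger is always [G[ct]] for an SKFE ciphertext that the
    adversary produced itself, so the sum over all [f] collapses to a sum over [ct]. *)
Lemma utk_reduction b i : (i < rounds B)%N ->
  exists (A1' : qalg PK void DS (K0 + QA)) (A2' : qalg void (K0 + QA + FK) (K0 + QS) void)
    (B0' : qalg (K0 + QS) void (KL + KL) (K0 + QRY + work B))
    (B1' : qalg CTF (K0 + QRY + work B) unit void),
  (qsize A1' + qsize A2' + qsize B0' + qsize B1' <= 200 * sz + 80 * sz * sz + 2)%N /\
  forall be : bool,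
  \sum_kF \sum_f \sum_s \sum_m \sum_ct \sum_(y : bits unit) (y tt)%:R * tr (run B1' ct
    (scale_op (encF (fstb kF) (if be then sndb m else fstb m) ct)
      (run B0' s (run A2' (zerob void)
        (tens (run A1' (fstb kF) (scale_op (setF kF) (unit_op R)) f) (key (sndb kF) f)) s) m)) y)
  = game b predT (fun _ => real_oracle) (hyb (if be then i else i.+1)) (fun y => y tt).
Proof.
move=> lti.
have [A1' [c1 H1]] := utk_A1 b; have [A2' [c2 H2]] := utk_A2.
have [B0' [c3 H3]] := utk_B0 lti; have [B1' [c4 H4]] := utk_B1 lti.
exists A1', A2', B0', B1'; split.
  have := msize_start A1; have := msize_start A2; have := msize_start B.
  move: sz_mach sz_regs c1 c2 c3 c4; rewrite /qsize !card_sum !card_unit !card_void.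
  lia.
move=> be; apply: eq_bigr => kF _.
set pk := fstb kF; set mF := sndb kF.
(* The part of the experiment after the first machine of A, as a linear form in the state; it sees
   the SKFE ciphertext only through [f]. *)
pose Phi f mS rho := \sum_st \sum_(y : bits unit) (y tt)%:R * tr (iact B (hyb (if be then i else i.+1) pk mS) st
     (iact A2 (fun _ => real_oracle pk mS) (zerob void) (tens rho (key mF f)) st) y).
have linPhi f mS : linear_form (Phi f mS).
  by apply: linf_sum => st; apply: linf_sum => y; apply: linf_mull; exact: linf_finish.
pose a1 mS m := iact A1 (fun _ => real_oracle pk mS) (zerob void) (unit_op R) m.
transitivity (\sum_f \sum_mS setF kF * setS mS * \sum_m
   (\sum_ct encS mS (chosen b m) ct * (f == bspec_eval gS ct)%:R) * Phi f mS (a1 mS m)); last first.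
  rewrite exchange_big /=; apply: eq_bigr => mS _.
  rewrite -mulr_sumr; congr (_ * _); rewrite exchange_big /=; apply: eq_bigr => m _.
  rewrite mul1r; under eq_bigr do rewrite mulr_suml.
  rewrite exchange_big /=; apply: eq_bigr => ct _.
  under eq_bigr do rewrite -mulrA.
  by rewrite -mulr_sumr sum_pick.
apply: eq_bigr => f _.
set r := fun k0 : bits K0 => sumop (fun m =>
    scale_op ((\sum_ct encS (sndb k0) (chosen b m) ct * (f == bspec_eval gS ct)%:R) *
              (setS (sndb k0) * (fstb k0 == pk)%:R))
      (iact A1 (fun _ => real_oracle (fstb k0) (sndb k0)) (zerob void)
         (scale_op (setF kF) (unit_op R)) m)).
(* The measured string carries a public key, and the first stage put no weight on values other than
   [pk]. *)
rewrite H1 -/r big_pairb big_pairb (bigD1 pk) //= [X in _ + X]big1 ?addr0 => [|pk' ne]; last first.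
  apply: big1 => mS _; apply: big1 => s _; apply: big1 => m _; apply: big1 => ct _; apply: big1 => y _.
  rewrite H2.
  have -> : r (pairb pk' mS) = fun _ _ => 0.
    apply/opP => u u'; apply: big1 => m' _.
    by rewrite fstb_pairb (negbTE ne) mulr0 mulr0 /scale_op mul0r.
  rewrite (lin_zero (@lin_tens R _ _ _)) (lin_zero (lin_iact _ _ _ _)) (lin_zero (lin_run _ _ _)).
  rewrite (lin_zero (lin_scaleop _)) (lin_zero (lin_run _ _ _)) /tr big1 ?mulr0 //.
apply: eq_bigr => mS _.
have E s rho : \sum_m \sum_ct \sum_(y : bits unit) (y tt)%:R * tr (run B1' ct
    (scale_op (encF pk (if be then sndb m else fstb m) ct) (run B0' (pairb (pairb pk mS) s) rho m)) y) =
  \sum_(y : bits unit) (y tt)%:R * tr (iact B (hyb (if be then i else i.+1) pk mS) s rho y).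
  under [RHS]eq_bigr => y _.
    rewrite -(utk_B_step be lti H3 H4) (linf_sumop _ (@linf_tr R _)) mulr_sumr.
    under eq_bigr => m _ do rewrite (linf_sumop _ (@linf_tr R _)) mulr_sumr.
    over.
  rewrite [RHS]exchange_big /=; apply: eq_bigr => m _.
  by rewrite [RHS]exchange_big /=.
under eq_bigr => s _ do rewrite E H2 fstb_pairb sndb_pairb.
rewrite -/(Phi f mS (r (pairb pk mS))) (linf_sumop _ (linPhi _ _)) mulr_sumr.
apply: eq_bigr => m _; rewrite (linf_scale _ _ (linPhi _ _)) fstb_pairb sndb_pairb eqxx mulr1.
rewrite (lin_scale _ _ (lin_iact _ _ _ _)) (linf_scale _ _ (linPhi _ _)) -/(a1 mS m).
ring.
Qed.

(** * The adversary against SKFE security *)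

Notation KF := (PK + MF)%type.
Notation QRY2 := ((unit + FL) + (unit + ML))%type.
Notation ANS2 := (KL + CT)%type.

(** The zero half is a declined encryption query: the simulation asks for keys only, so the
    condition on queried messages holds vacuously. *)
Definition padq (q : bits QRY) : bits QRY2 := pairb q (zerob (unit + ML)%type).
Definition qbit (q : bits QRY) : bits unit := [ffun=> q (inl tt)].

(* A state of the simulated machine is stored with a cleared flag; the flag
   remembers, between a query and its answer, whether a query is being made. *)
Definition flag0 Q (r : fam R KF Q) : fam R (KF + unit) Q :=
  fun kb => scale_op (sndb kb == zerob unit)%:R (r (fstb kb)).

Lemma flag0E Q (r : fam R KF Q) kb :
  flag0 r kb = scale_op (sndb kb == zerob unit)%:R (r (fstb kb)).
Proof. by []. Qed.

Lemma sumop_flag0 Q (r : fam R KF Q) k : sumop (fun b => flag0 r (pairb k b)) = r k.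
Proof.
under eq_sumop => b do rewrite /flag0 fstb_pairb sndb_pairb.
exact: sumop_pick.
Qed.

Lemma scale_cq K Q c (r : fam R K Q) : scale_op c (cq r) = cq (fun k => scale_op c (r k)).
Proof. by apply/opP => u u'; rewrite /scale_op /cq mulrCA. Qed.

Lemma sumop_cq K Q (X : finType) (r : X -> fam R K Q) :
  sumop (fun x => cq (r x)) = cq (fun k => sumop (fun x => r x k)).
Proof. by apply/opP => u u'; rewrite /sumop /cq mulr_sumr. Qed.

Section Wrap.
Variables (I Q J Q' : finType) (M : machine I Q QRY CTF J Q').

(** The flag is kept because the answer of the SKFE oracle does not reveal whether a key was
    requested, while the simulation has to decide between encrypting and answering zeros. *)
Lemma sk_ask j : exists a : qalg void (KF + unit + work M) QRY2 (KF + unit + work M),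
  (#|anc a| + size (gates a) <= 6 * qsize (ask M j) + 2 * (#|FL| + #|ML| + 3))%N /\
  forall (r : fam R (KF + unit) (work M)) q', run a (zerob void) (cq r) q' = cq (fun kb : bits (KF + unit) => sumop (fun q : bits QRY =>
    scale_op ((q' == padq q) && (sndb kb == qbit q))%:R
     (run (ask M j) (zerob void) (sumop (fun b => r (pairb (fstb kb) b))) q))).
Proof.
pose w0 (x : void + (KF + unit)) : KF + unit := match x with inr k => k | inl v => match v with end end.
have bw0 : bijective w0 by exists inr => // -[].
have p1 := fimpl_run R (ask M j) (no_wire KF).
pose s (x : QRY2 + unit) : bool + (KF + QRY) * (KF + QRY) := match x with
  | inl (inl q) => inr (inr q, inr q) | inl (inr _) => inl false
  | inr _ => inr (inr (inl tt), inr (inl tt)) end.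
have dE k q : bspec_eval s (pairb k q) = pairb (padq q) (qbit q).
  apply/ffunP => -[[x|x]|x]; rewrite !ffunE /= ?ffunE /= ?ffunE ?andbb //.
pose w (x : KF + QRY + (QRY2 + unit)) : (QRY2 + (KF + unit)) + QRY := match x with
  | inl (inl k) => inl (inr (inl k)) | inl (inr q) => inr q
  | inr (inl q) => inl (inl q) | inr (inr u) => inl (inr (inr u)) end.
pose w' (x : (QRY2 + (KF + unit)) + QRY) : KF + QRY + (QRY2 + unit) := match x with
  | inl (inr (inl k)) => inl (inl k) | inr q => inl (inr q)
  | inl (inl q) => inr (inl q) | inl (inr (inr u)) => inr (inr u) end.
have bw : bijective w by exists w'; [case=> [[k|q]|[q|u]] | case=> [[q|[k|u]]|q]].
have := fimpl_comp (fimpl_rewire R _ bw0) (fimpl_comp p1 (fimpl_comp (fsampler_det R s _)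
  (fimpl_rewire R _ bw))).
case/export_cq => a [le H]; exists a; split.
  by apply: leq_trans le _; rewrite !card_sum !card_unit; lia.
move=> r q'; rewrite H; congr cq; apply/funext => kb; apply: eq_sumop => q.
have -> : pull w (pairb (pairb q' kb) q) =
  pairb (pairb (fstb kb) q) (pairb q' (sndb kb)) by bitsE.
rewrite !(fstb_pairb, sndb_pairb) dE pairb_eq2 pull_no_wire; congr (scale_op _ (run _ _ _ _)).
apply: eq_sumop => b.
have -> : pull w0 (pairb (fstb kb) b) = pairb (zerob void) (pairb (fstb kb) b) by bitsE.
by rewrite !(fstb_pairb, sndb_pairb) eqxx scale1.
Qed.

(** The returned SKFE key is encrypted under the FE public key that the simulation holds; the
    encryption half of the answer is thrown away and the flag is cleared for the next round. *)
Lemma sk_tell j : exists a : qalg ANS2 (KF + unit + work M) void (KF + unit + work M),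
  (#|anc a| + size (gates a) <= 8 * sz + 6 * qsize (tell M j) + 2)%N /\
  forall (r : fam R (KF + unit) (work M)) a', run a a' (cq r) (zerob void) = cq (flag0 (fun k => sumop (fun b : bits unit => sumop (fun a0 =>
    run (tell M j) a0 (scale_op (\sum_c encF (fstb k) (fstb a') c * (a0 == mask (b tt) c)%:R)
      (r (pairb k b))) (zerob void))))).
Proof.
have p1 := @fsampler_enc (ANS2 + (KF + unit))%type (fun p => inr (inl (inl p)))
  (fun k => inl (inl k)) (inr (inr tt)).
have p2 := fimpl_run R (tell M j) (@inr (ANS2 + (KF + unit)) CTF).
pose w (x : ANS2 + (KF + unit) + CTF + void) : KF + (unit + (CTF + ANS2)) := match x with
  | inl (inl (inl a)) => inr (inr (inr a)) | inl (inl (inr (inl k))) => inl k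
  | inl (inl (inr (inr u))) => inr (inl u) | inl (inr c) => inr (inr (inl c))
  | inr e => match e with end end.
pose w' (x : KF + (unit + (CTF + ANS2))) : ANS2 + (KF + unit) + CTF + void := match x with
  | inr (inr (inr a)) => inl (inl (inl a)) | inl k => inl (inl (inr (inl k)))
  | inr (inl u) => inl (inl (inr (inr u))) | inr (inr (inl c)) => inl (inr c) end.
have bw : bijective w by exists w'; [case=> [[[c|[k|q]]|c]|[]] | case=> [k|[q|[c|c]]]].
pose s0 : bspec KF unit := fun _ => inl false.
have d0 k : bspec_eval s0 k = zerob unit by bitsE.
pose v (x : KF + unit) : void + (KF + unit) := inr x.
pose v' (x : void + (KF + unit)) : KF + unit := match x with inr k => k | inl v => match v with end end.
have bv : bijective v by exists v' => // -[].
have := fimpl_comp (p1 _) (fimpl_comp p2 (fimpl_comp (fimpl_rewire R _ bw)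
  (fimpl_comp (fsampler_det R s0 _) (fimpl_perm R _ bv)))).
case/export_cq => a [le H]; exists a; split.
  by apply: leq_trans le _; rewrite card_unit; lia.
move=> r a'; rewrite H; congr cq; apply/funext => kb.
have -> : pull v (pairb (zerob void) kb) = kb by bitsE.
rewrite d0 /flag0; congr scale_op.
apply/opP => u u'; rewrite /sumop big_pairb; apply: eq_bigr => b _.
rewrite big_pairb; apply: eq_bigr => c _.
have key2 a'' : pull w (pairb (fstb kb) (pairb b (pairb c a''))) =
  pairb (pairb (pairb a'' (pairb (fstb kb) b)) c) (zerob void) by bitsE.
rewrite (bigD1 a') //= [X in _ + X]big1 ?addr0 => [|a'' ne]; last first.
  rewrite key2 !(fstb_pairb, sndb_pairb) (negbTE ne) scale_scale mulr0.
  by rewrite (lin_scale _ _ (lin_run _ _ _)) /scale_op mul0r.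
rewrite key2 !(fstb_pairb, sndb_pairb) eqxx scale1.
have -> : pull inr (pairb (pairb a' (pairb (fstb kb) b)) c) = c by exact: sndb_pairb.
congr (run _ _ (scale_op _ _) _ _ _); apply: eq_bigr => d _.
have -> : pairb a' (pairb (fstb kb) b) (inr (inr tt)) = b tt by rewrite !ffunE.
by congr (encF _ _ _ * _); bitsE.
Qed.

Definition wrapped (O : bits QRY2 -> bits ANS2 -> R[i]) (kF : bits KF)
    (q : bits QRY) (a : bits CTF) : R[i] :=
  \sum_a' O (padq q) a' * \sum_c encF (fstb kF) (fstb a') c * (a == mask (q (inl tt)) c)%:R.

Lemma sk_round j (ask' : qalg void (KF + unit + work M) QRY2 (KF + unit + work M))
    (tell' : qalg ANS2 (KF + unit + work M) void (KF + unit + work M)) :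
  (forall (r : fam R (KF + unit) (work M)) q',
     run ask' (zerob void) (cq r) q' = cq (fun kb : bits (KF + unit) => sumop (fun q : bits QRY =>
       scale_op ((q' == padq q) && (sndb kb == qbit q))%:R
        (run (ask M j) (zerob void) (sumop (fun b => r (pairb (fstb kb) b))) q)))) ->
  (forall (r : fam R (KF + unit) (work M)) a',
     run tell' a' (cq r) (zerob void) = cq (flag0 (fun k => sumop (fun b : bits unit => sumop (fun a0 =>
       run (tell M j) a0 (scale_op (\sum_c encF (fstb k) (fstb a') c * (a0 == mask (b tt) c)%:R)
         (r (pairb k b))) (zerob void)))))) ->
  forall O r,
  sumop (fun q => sumop (fun a => run tell' a
    (scale_op (O q a) (run ask' (zerob void) (cq (flag0 r)) q)) (zerob void))) =
  cq (flag0 (fun kF => conv1 (M := M) (wrapped O kF) j (r kF))).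
Proof.
move=> Hask Htell O r.
under eq_sumop => q' do under eq_sumop => a' do rewrite Hask scale_cq Htell.
under eq_sumop => q' do rewrite sumop_cq.
rewrite sumop_cq; congr cq; apply/funext => kb; rewrite [RHS]flag0E.
under eq_sumop => q' do under eq_sumop => a' do rewrite flag0E.
set k := fstb kb; set c0 := _%:R.
under eq_sumop => q' do under eq_sumop => a' do under eq_sumop => b do under eq_sumop => a0 do
  rewrite fstb_pairb sndb_pairb sumop_flag0.
apply/opP => u u'; rewrite /sumop /scale_op.
under eq_bigr => q' _ do rewrite -mulr_sumr.
rewrite -mulr_sumr; congr (_ * _).
pose X q := run (ask M j) (zerob void) (r k) q.
pose G q a0 := run (tell M j) a0 (X q) (zerob void) u u'.
transitivity (\sum_q' \sum_a' \sum_(b : bits unit) \sum_a0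
   (\sum_c encF (fstb k) (fstb a') c * (a0 == mask (b tt) c)%:R) * (O q' a' *
   \sum_q ((q' == padq q) && (b == qbit q))%:R * G q a0)).
  apply: eq_bigr => q' _; apply: eq_bigr => a' _; apply: eq_bigr => b _; apply: eq_bigr => a0 _.
  rewrite (lin_scale _ _ (lin_run _ _ _)) {1}/scale_op; congr (_ * _).
  rewrite (lin_scale _ _ (lin_run _ _ _)) {1}/scale_op; congr (_ * _).
  rewrite (lin_sum _ (lin_run _ _ _)); apply: eq_bigr => q _.
  by rewrite (lin_scale _ _ (lin_run _ _ _)).
transitivity (\sum_q \sum_a0 \sum_a' \sum_q' \sum_(b : bits unit)
   ((q' == padq q) && (b == qbit q))%:R *
   ((\sum_c encF (fstb k) (fstb a') c * (a0 == mask (b tt) c)%:R) * (O q' a' * G q a0))).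
  rewrite [RHS]exchange_big /=.
  under [RHS]eq_bigr => a0 _ do rewrite exchange_big /=.
  under [RHS]eq_bigr => a0 _ do under eq_bigr => a' _ do rewrite exchange_big /=.
  under [RHS]eq_bigr => a0 _ do under eq_bigr => a' _ do under eq_bigr => q' _ do
    rewrite exchange_big /=.
  under [RHS]eq_bigr => a0 _ do rewrite exchange_big /=.
  rewrite [RHS]exchange_big /=; apply: eq_bigr => q' _.
  rewrite [RHS]exchange_big /=; apply: eq_bigr => a' _.
  rewrite [RHS]exchange_big /=; apply: eq_bigr => b _.
  apply: eq_bigr => a0 _; rewrite !mulr_sumr; apply: eq_bigr => q _; ring.
apply: eq_bigr => q _; apply: eq_bigr => a0 _.
rewrite (lin_scale _ _ (lin_run _ _ _)) /scale_op -/(X q) -/(G q a0) /wrapped mulr_suml.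
apply: eq_bigr => a' _.
rewrite (bigD1 (padq q)) //= [X in _ + X]big1 ?addr0 => [|q' ne]; last first.
  by apply: big1 => b _; rewrite (negbTE ne) mul0r.
rewrite (bigD1 (qbit q)) //= [X in _ + X]big1 ?addr0 => [|b ne]; last first.
  by rewrite (negbTE ne) andbF mul0r.
by rewrite !eqxx mul1r ffunE mulrCA mulrA.
Qed.

(** Both machines of A are wrapped in this way but receive different first and last algorithms,
    hence the quantification over [start'] and [finish']. *)
Lemma sk_machine : (msize M <= sz)%N ->
  exists (ask' : nat -> qalg void (KF + unit + work M) QRY2 (KF + unit + work M))
    (tell' : nat -> qalg ANS2 (KF + unit + work M) void (KF + unit + work M)),
  (forall j, (j < rounds M)%N -> qsize (ask' j) + qsize (tell' j) <= 50 * sz + 50)%N /\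
  forall I2 Q2 J2 Q2' (start' : qalg I2 Q2 void (KF + unit + work M))
    (finish' : qalg void (KF + unit + work M) J2 Q2') O s r,
  conv (M := Machine (rounds M) start' ask' tell' finish') (fun _ => O) s (cq (flag0 r)) =
  cq (flag0 (fun kF => conv (M := M) (fun _ => wrapped O kF) s (r kF))).
Proof.
move=> szM.
have [ask' Hask] := choice sk_ask; have [tell' Htell] := choice sk_tell.
exists ask', tell'; split.
  move=> j lj; have [h1 _] := Hask j; have [h2 _] := Htell j.
  have := msize_round lj; have := msize_start M; move: h1 h2 szM sz_regs.
  rewrite /qsize !card_sum !card_unit !card_void; lia.
move=> I2 Q2 J2 Q2' start' finish' O s; elim: s => [//|j s IH] r.
have [_ h1] := Hask j; have [_ h2] := Htell j.
have E : conv1 (M := Machine (rounds M) start' ask' tell' finish') O j (cq (flag0 r)) =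
  cq (flag0 (fun kF => conv1 (M := M) (wrapped O kF) j (r kF))) by exact: sk_round.
by have := IH (fun kF => conv1 (M := M) (wrapped O kF) j (r kF)); rewrite -E.
Qed.

End Wrap.

(** The declined encryption half is answered by zeros with certainty, and an SKFE key followed by
    its FE encryption is how the scheme answers a key query. *)
Lemma wrapped_filt (p : pred (bits QRY2)) mS kF :
  wrapped (filt p (pair_oracle (opt_oracle (kg mS)) (opt_oracle (encS mS)))) kF =
  filt (fun q => p (padq q)) (real_oracle (fstb kF) mS).
Proof.
apply/funext => q; apply/funext => a; rewrite /wrapped /filt /pair_oracle.
have -> : fstb (padq q) = q by exact: fstb_pairb.
have -> : sndb (padq q) = zerob (unit + ML)%type by exact: sndb_pairb.
have optE c : opt_oracle (encS mS) (zerob (unit + ML)%type) c = (c == zerob CT)%:R.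
  by rewrite /opt_oracle /optb ffunE.
transitivity ((p (padq q))%:R * \sum_k opt_oracle (kg mS) q k *
   (if q (inl tt) then encF (fstb kF) k a else (a == zerob CTF)%:R)).
  rewrite big_pairb mulr_sumr; apply: eq_bigr => k _.
  rewrite (bigD1 (zerob CT)) //= [X in _ + X]big1 ?addr0 => [|c ne]; last first.
    by rewrite optE sndb_pairb (negbTE ne) mulr0 mulr0 mul0r.
  rewrite optE !(fstb_pairb, sndb_pairb) eqxx mulr1 -mulrA; congr (_ * (_ * _)).
  by rewrite sum_mask //; exact: sum_encF.
congr (_ * _); rewrite /real_oracle /opt_oracle /optb.
case: (q (inl tt)) => //.
by rewrite -mulr_suml (eq_bigr (fun k => (k == zerob KL)%:R * 1)) ?sum_pick ?mul1r // => k _; rewrite mulr1.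
Qed.

Let drop_void (x : void + (KF + unit)) : KF + unit := match x with inr k => k | inl v => match v with end end.

Lemma drop_void_bij : bijective drop_void. Proof. by exists inr => // -[]. Qed.

Let add_void (x : KF + unit) : void + (KF + unit) := inr x.

Lemma add_void_bij : bijective add_void. Proof. by exists drop_void => // -[]. Qed.

Lemma pull_drop_void kb : pull drop_void kb = pairb (zerob void) kb.
Proof. bitsE. Qed.

Lemma pull_add_void z kb : pull add_void (pairb z kb) = kb.
Proof. bitsE. Qed.

Let clear_flag : bspec KF unit := fun _ => inl false.

Lemma bspec_eval_clear_flag k : bspec_eval clear_flag k = zerob unit. Proof. bitsE. Qed.

Lemma sk_start1 : exists a : qalg void void void (KF + unit + work A1),
  (#|anc a| + size (gates a) <= 12 * sz + 2)%N /\
  forall rho, run a (zerob void) rho (zerob void) =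
    cq (flag0 (fun kF => scale_op (setF kF) (run (start A1) (zerob void) rho (zerob void)))).
Proof.
pose w (x : void + KF + void) : KF := match x with
  | inl (inr k) => k | inl (inl v) => match v with end | inr v => match v with end end.
have bw : bijective w by exists (fun k => inl (inr k)) => // -[[[]|]|[]].
have := fimpl_comp (fimpl_sample R a_setF void (no_wire void)) (fimpl_comp
  (fimpl_run R (start A1) (no_wire (void + KF)%type)) (fimpl_comp (fimpl_perm R _ bw)
  (fimpl_comp (fsampler_det R clear_flag _) (fimpl_perm R _ add_void_bij)))).
case/export_prep => a [le H]; exists a; split.
  apply: leq_trans le _; have := msize_start A1; rewrite card_unit.
  move: (qsize a_setF) (qsize (start A1)) (qsize (finish A1)) (msize A1) sz_algs sz_mach => x y z t; lia.
move=> rho; rewrite H; congr cq; apply/funext => kb; rewrite pull_add_void bspec_eval_clear_flag flag0E.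
congr scale_op.
have -> : pull w (fstb kb) = pairb (pairb (zerob void) (fstb kb)) (zerob void) by bitsE.
rewrite !(fstb_pairb, sndb_pairb) eqxx scale1 !pull_no_wire -setFE.
exact: (lin_scale _ _ (lin_run _ _ _)).
Qed.

Lemma sk_finish1 : exists a : qalg void (KF + unit + work A1) (ML + ML) (KF + QA),
  (#|anc a| + size (gates a) <= 6 * sz)%N /\
  forall (r : fam R KF (work A1)) m, run a (zerob void) (cq (flag0 r)) m =
    cq (fun kF => run (finish A1) (zerob void) (r kF) m).
Proof.
have := fimpl_comp (fimpl_rewire R _ drop_void_bij) (fimpl_comp
  (fimpl_run R (finish A1) (no_wire KF)) (fimpl_perm R _ (sum_swap_bij KF (ML + ML)))).
case/export_cq => a [le H]; exists a; split.
  apply: leq_trans le _; have := msize_start A1; move: sz_mach.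
  move: (qsize (start A1)) (qsize (finish A1)) (msize A1) => x y z; lia.
move=> r m; rewrite H; congr cq; apply/funext => k.
have -> : pull (@sum_swap KF (ML + ML)) (pairb m k) = pairb k m by bitsE.
rewrite !(fstb_pairb, sndb_pairb) pull_no_wire; congr (run _ _ _ _).
rewrite -[RHS](sumop_flag0 r); apply: eq_sumop => b.
by rewrite pull_drop_void !(fstb_pairb, sndb_pairb) eqxx scale1.
Qed.

(** The untelegraphable ciphertext is rebuilt from the SKFE challenge: the description of [G[ct]] is
    computed, and its FE key is generated with the master key that the simulation sampled. *)
Lemma sk_start2 : exists a : qalg CT (KF + QA) void (KF + unit + work A2),
  (#|anc a| + size (gates a) <= 14 * sz + 2)%N /\
  forall (r : fam R KF QA) ct, run a ct (cq r) (zerob void) =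
    cq (flag0 (fun kF => run (start A2) (zerob void)
      (tens (r kF) (key (sndb kF) (bspec_eval gS ct))) (zerob void))).
Proof.
pose ik (x : MF + DS) : CT + KF + DS := match x with
  | inl m => inl (inr (inr m)) | inr d => inr d end.
pose w (x : CT + KF + DS + void) : KF + (CT + DS) := match x with
  | inl (inl (inl c)) => inr (inl c) | inl (inl (inr k)) => inl k
  | inl (inr d) => inr (inr d) | inr v => match v with end end.
pose w' (x : KF + (CT + DS)) : CT + KF + DS + void := match x with
  | inr (inl c) => inl (inl (inl c)) | inl k => inl (inl (inr k))
  | inr (inr d) => inl (inr d) end.
have bw : bijective w by exists w'; [case=> [[[c|k]|d]|[]] | case=> [k|[c|d]]].
have := fimpl_comp (fsampler_det R (spec_map (@inl CT KF) gS) _) (fimpl_comp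
  (fimpl_prep R a_key _ ik) (fimpl_comp (fimpl_run R (start A2) (no_wire (CT + KF + DS)%type))
  (fimpl_comp (fimpl_rewire R _ bw) (fimpl_comp (fsampler_det R clear_flag _) (fimpl_perm R _ add_void_bij))))).
case/export_cq => a [le H]; exists a; split.
  apply: leq_trans le _; have := msize_start A2; rewrite card_unit.
  move: (qsize a_key) (qsize (start A2)) (qsize (finish A2)) (msize A2) sz_algs sz_mach sz_regs => x y z t; lia.
move=> r ct; rewrite H; congr cq; apply/funext => kb; rewrite pull_add_void bspec_eval_clear_flag flag0E.
congr scale_op.
have kw c d : pull w (pairb (fstb kb) (pairb c d)) =
   pairb (pairb (pairb c (fstb kb)) d) (zerob void) by bitsE.
apply/opP => u u'; rewrite /sumop big_pairb.
rewrite (bigD1 ct) //= [X in _ + X]big1 ?addr0 => [|c ne]; last first.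
  apply: big1 => d _; rewrite kw !(fstb_pairb, sndb_pairb) (negbTE ne) scale_scale mulr0.
  have -> Q1 (rho : op R Q1) : scale_op 0 rho = fun _ _ => 0.
    by apply/opP => z z'; rewrite /scale_op mul0r.
  by rewrite (lin_zero (@lin_tens R _ _ _)) (lin_zero (lin_run _ _ _)).
rewrite (bigD1 (bspec_eval gS ct)) //= [X in _ + X]big1 ?addr0 => [|d ne]; last first.
  rewrite kw !(fstb_pairb, sndb_pairb) bspec_eval_map.
  have -> : pull inl (pairb ct (fstb kb)) = ct by exact: fstb_pairb.
  have -> Q1 (rho : op R Q1) : scale_op (d == bspec_eval gS ct)%:R rho = fun _ _ => 0.
    by apply/opP => z z'; rewrite /scale_op (negbTE ne) mul0r.
  by rewrite (lin_zero (@lin_tens R _ _ _)) (lin_zero (lin_run _ _ _)).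
rewrite kw !(fstb_pairb, sndb_pairb) bspec_eval_map.
have -> : pull inl (pairb ct (fstb kb)) = ct by exact: fstb_pairb.
rewrite !eqxx !scale1 pull_no_wire -keyE.
by congr (run _ _ (tens _ (key _ _)) _ _ _); bitsE.
Qed.

(** The whole of B fits into the final algorithm, since [zero_oracle] needs only [pk] and no SKFE
    query is left. The quadratic term is the cost of this run of B. *)
Lemma sk_finish2 : exists a : qalg void (KF + unit + work A2) unit void,
  (#|anc a| + size (gates a) <= 20 * sz + 20 * sz * sz)%N /\
  forall (r : fam R KF (work A2)) y, run a (zerob void) (cq (flag0 r)) y =
    sumop (fun kF => sumop (fun st => iact B (fun _ => zero_oracle (fstb kF)) st
      (run (finish A2) (zerob void) (r kF) st) y)).
Proof.
have p2 : fimpl _ _ := fimpl_iact (M := B)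
  (O := fun (k : bits (KF + QS)) _ => zero_oracle (pull (fun p => inl (inl p)) k)) (@inr KF QS)
  (fun j _ => fsampler_zero _) (m := sz) _.
have := fimpl_comp (fimpl_rewire R _ drop_void_bij) (fimpl_comp
  (fimpl_run R (finish A2) (no_wire KF)) (fimpl_comp (p2 _)
  (fimpl_rewire R _ (sum_swap_bij (KF + QS) unit)))).
move=> /(_ _)/(export_meas (id_bij _)) [|a [le H]]; first by move: sz_mach; lia.
exists a; split.
  apply: leq_trans le _; have := msize_start A2; move: sz_mach.
  move: (qsize (start A2)) (qsize (finish A2)) (msize A2) => x y z; nia.
move=> r y; rewrite (H _ (cq (flag0 r)) (flag0 r)); last first.
  by apply/opP => u u'; congr (cq _ _ _); apply/ffunP => x; rewrite ffunE.
apply/opP => z z'; rewrite /sumop big_pairb; apply: eq_bigr => kF _; apply: eq_bigr => st _.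
have -> : pull (@sum_swap (KF + QS) unit) (pairb y (pairb kF st)) = pairb (pairb kF st) y by bitsE.
rewrite !(fstb_pairb, sndb_pairb) pull_no_wire.
have -> : pull inr (pairb kF st) = st by exact: sndb_pairb.
have -> : pull (fun p => inl (inl p)) (pairb kF st) = fstb kF by bitsE.
congr (iact _ _ _ (run _ _ _ _) _ _ _).
rewrite -[RHS](sumop_flag0 r); apply: eq_sumop => b.
by rewrite pull_drop_void !(fstb_pairb, sndb_pairb) eqxx scale1.
Qed.

Lemma msize_le I Q Qry Ans J Q' (M : machine I Q Qry Ans J Q') c :
  (forall j, (j < rounds M)%N -> qsize (ask M j) + qsize (tell M j) <= c)%N ->
  (msize M <= qsize (start M) + qsize (finish M) + rounds M + rounds M * c)%N.
Proof.
move=> h; rewrite leq_add2l -[X in (_ <= X * _)%N]card_ord -sum_nat_const.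
by apply: leq_sum => j _; exact: h.
Qed.

(** The filter and the two predicates are left open, so that one identity yields both the success
    probability and the weight of the legal branches. *)
Lemma sk_reduction :
  exists (A1' : machine void void QRY2 ANS2 (ML + ML) (KF + QA))
    (A2' : machine CT (KF + QA) QRY2 ANS2 unit void),
  (msize A1' + msize A2' <= 400 * sz * sz + 400 * sz + 100)%N /\
  forall b (vm : pred (bits (ML + ML))) (p : bits (ML + ML) -> pred (bits QRY2))
    (fin : pred (bits unit)),
  let O m mS := filt (p m) (pair_oracle (opt_oracle (kg mS)) (opt_oracle (encS mS))) in
  \sum_mS \sum_m (vm m)%:R * \sum_ct \sum_y (fin y)%:R * tr (iact A2' (fun _ => O m mS) ct
    (scale_op (encS mS (chosen b m) ct)
      (iact A1' (fun _ => O m mS) (zerob void) (scale_op (setS mS) (unit_op R)) m)) y)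
  = game b vm (fun m pk mS => filt (fun q => p m (padq q)) (real_oracle pk mS))
      (fun pk _ _ => zero_oracle pk) fin.
Proof.
have [st1 [c1 H1]] := sk_start1; have [fi1 [d1 G1]] := sk_finish1.
have [st2 [c2 H2]] := sk_start2; have [fi2 [d2 G2]] := sk_finish2.
have szA1 : (msize A1 <= sz)%N by move: sz_mach; lia.
have szA2 : (msize A2 <= sz)%N by move: sz_mach; lia.
have [ask1 [tell1 [e1 C1]]] := sk_machine szA1; have [ask2 [tell2 [e2 C2]]] := sk_machine szA2.
exists (Machine (rounds A1) st1 ask1 tell1 fi1), (Machine (rounds A2) st2 ask2 tell2 fi2); split.
  have f1 := @msize_le _ _ _ _ _ _ (Machine (rounds A1) st1 ask1 tell1 fi1) _ e1.
  have f2 := @msize_le _ _ _ _ _ _ (Machine (rounds A2) st2 ask2 tell2 fi2) _ e2.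
  have m1 := msize_start A1; have m2 := msize_start A2.
  have w1 : (#|work A1| <= sz)%N by apply: leq_trans szA1; move: m1; rewrite /qsize; lia.
  have w2 : (#|work A2| <= sz)%N by apply: leq_trans szA2; move: m2; rewrite /qsize; lia.
  have wA : (#|QA| <= sz)%N by apply: leq_trans szA1; move: m1; rewrite /qsize; lia.
  have r1 : (rounds A1 * (50 * sz + 50) <= sz * (50 * sz + 50))%N.
    by rewrite leq_mul2r (leq_trans _ szA1) ?orbT // (leq_trans _ m1) // leq_addl.
  have r2 : (rounds A2 * (50 * sz + 50) <= sz * (50 * sz + 50))%N.
    by rewrite leq_mul2r (leq_trans _ szA2) ?orbT // (leq_trans _ m2) // leq_addl.
  have r1' : (rounds A1 <= sz)%N by rewrite (leq_trans _ szA1) // (leq_trans _ m1) // leq_addl.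
  have r2' : (rounds A2 <= sz)%N by rewrite (leq_trans _ szA2) // (leq_trans _ m2) // leq_addl.
  have q1 : (qsize st1 <= 20 * sz + 20)%N.
    by move: c1 sz_regs w1; rewrite /qsize !card_sum !card_unit !card_void; lia.
  have q2 : (qsize st2 <= 20 * sz + 20)%N.
    by move: c2 sz_regs w2 wA; rewrite /qsize !card_sum !card_unit !card_void; lia.
  have q3 : (qsize fi1 <= 20 * sz + 20)%N.
    by move: d1 sz_regs w1 wA; rewrite /qsize !card_sum !card_unit !card_void; lia.
  have q4 : (qsize fi2 <= 30 * sz + 20 * sz * sz + 20)%N.
    by move: d2 sz_regs w2; rewrite /qsize !card_sum !card_unit !card_void; lia.
  apply: leq_trans (leq_add f1 f2) _ => /=.
  apply: leq_trans (leq_add (leq_add (leq_add (leq_add q1 q3) r1') r1)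
                            (leq_add (leq_add (leq_add q2 q4) r2') r2)) _.
  clear; nia.
move=> b vm p fin O.
have W m mS kF : wrapped (O m mS) kF = filt (fun q => p m (padq q)) (real_oracle (fstb kF) mS).
  exact: wrapped_filt.
rewrite /game [RHS]exchange_big /=; apply: eq_bigr => mS _.
transitivity (\sum_m \sum_kF setF kF * setS mS * ((vm m)%:R *
  \sum_ct encS mS (chosen b m) ct * \sum_st \sum_y (fin y)%:R *
   tr (iact B (fun _ => zero_oracle (fstb kF)) st
     (iact A2 (fun _ => filt (fun q => p m (padq q)) (real_oracle (fstb kF) mS)) (zerob void)
       (tens (iact A1 (fun _ => filt (fun q => p m (padq q)) (real_oracle (fstb kF) mS))
           (zerob void) (unit_op R) m) (key (sndb kF) (bspec_eval gS ct))) st) y))); last first.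
  by rewrite exchange_big /=; apply: eq_bigr => kF _; rewrite mulr_sumr.
apply: eq_bigr => m _.
under [RHS]eq_bigr do rewrite mulrCA.
rewrite -mulr_sumr; congr (_ * _).
under [RHS]eq_bigr do rewrite mulr_sumr.
rewrite [RHS]exchange_big /=; apply: eq_bigr => ct _.
under [RHS]eq_bigr => kF _ do rewrite exchange_big /= 2!mulr_sumr.
rewrite [RHS]exchange_big /=; apply: eq_bigr => y _.
pose a1 (kF : bits KF) := iact A1 (fun _ => filt (fun q => p m (padq q)) (real_oracle (fstb kF) mS))
           (zerob void) (unit_op R) m.
have -> : iact (Machine (rounds A1) st1 ask1 tell1 fi1) (fun=> O m mS) (zerob void)
    (scale_op (setS mS) (unit_op R)) m = cq (fun kF => scale_op (setF kF * setS mS) (a1 kF)).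
  rewrite {1}/iact /= H1 C1 G1; congr cq; apply/funext => kF; rewrite W.
  rewrite (lin_scale _ _ (lin_run (start A1) _ _)) scale_scale.
  by rewrite (lin_scale _ _ (lin_conv _ _)) (lin_scale _ _ (lin_run _ _ _)).
rewrite scale_cq {1}/iact /= H2 C2 G2.
rewrite (linf_sumop _ (@linf_tr R _)) mulr_sumr; apply: eq_bigr => kF _.
rewrite (linf_sumop _ (@linf_tr R _)) !mulr_sumr; apply: eq_bigr => st _.
rewrite W scale_scale.
have L := linf_finish (fun _ => zero_oracle (fstb kF))
  (fun _ => filt (fun q => p m (padq q)) (real_oracle (fstb kF) mS)) (zerob void)
  (key (sndb kF) (bspec_eval gS ct)) st y.
have := linf_scale (encS mS (chosen b m) ct * (setF kF * setS mS)) (a1 kF) L.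
rewrite /a1 {1}/iact => E; rewrite [X in _ * X = _]E.
ring.
Qed.

(** When every output is accepted, B only contributes its trace, which normalized oracles
    preserve. *)
Lemma game_tr b vm O12 O3 O3' :
  (forall pk mS j q, \sum_a O3 pk mS j q a = 1) ->
  (forall pk mS j q, \sum_a O3' pk mS j q a = 1) ->
  game b vm O12 O3 predT = game b vm O12 O3' predT.
Proof.
move=> h h'; apply: eq_bigr => kF _; apply: eq_bigr => mS _; congr (_ * _).
apply: eq_bigr => m _; congr (_ * _); apply: eq_bigr => ct _; congr (_ * _).
apply: eq_bigr => st _; under eq_bigr do rewrite mul1r.
by under [RHS]eq_bigr do rewrite mul1r; rewrite !tr_iact.
Qed.

Lemma eq_game b vm O12 O12' O3 O3' fin :
  (forall m pk mS, O12 m pk mS = O12' m pk mS) ->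
  (forall pk mS j, (j < rounds B)%N -> O3 pk mS j = O3' pk mS j) ->
  game b vm O12 O3 fin = game b vm O12' O3' fin.
Proof.
move=> h12 h; apply: eq_bigr => kF _; apply: eq_bigr => mS _; congr (_ * _).
apply: eq_bigr => m _; congr (_ * _); apply: eq_bigr => ct _; congr (_ * _).
apply: eq_bigr => st _; apply: eq_bigr => y _; rewrite h12; congr (_ * tr _).
rewrite /iact; congr (run _ _ _ _); apply: eq_conv => j; rewrite mem_iota => /andP[_ lj].
exact: h.
Qed.

(** * The experiments as nested sums *)

Lemma mass_mull Q (X : Type) (e : ens R Q X) c F :
  mass e (fun x rho => c * F x rho) = c * mass e F.
Proof. by rewrite /mass mulr_sumr. Qed.

Lemma mass_sub Q (X : Type) (e : ens R Q X) F G :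
  mass e (fun x rho => F x rho - G x rho) = mass e F - mass e G.
Proof. by rewrite /mass sumrB. Qed.

Definition enc_state b mS mF m : op R FK :=
  sumop (fun ct => scale_op (encS mS (chosen b m) ct) (key mF (bspec_eval gS ct))).

(** [L] is a free functional of the three transcripts, so that success and illegality are weights of
    the same shape, comparable by positivity and linearity. *)
Definition ut_nest b
    (L : seq (bits QRY) * bits (ML + ML) -> seq (bits QRY) * bits QS ->
         seq (bits QRY) * bits unit -> op R void -> R[i]) : R[i] :=
  \sum_kF \sum_mS
    mass (interact A1 (real_oracle (fstb kF) mS) (zerob void)
           (scale_op (setF kF * setS mS) (unit_op R))) (fun t1 r1 =>
    mass (interact A2 (real_oracle (fstb kF) mS) (zerob void)
           (tens r1 (enc_state b mS (sndb kF) t1.2))) (fun t2 r2 =>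
    mass (interact B (real_oracle (fstb kF) mS) t2.2 r2) (fun t3 r3 => L t1 t2 t3 r3))).

Lemma eq_ut_nest b L L' : (forall t1 t2 t3 r, L t1 t2 t3 r = L' t1 t2 t3 r) ->
  ut_nest b L = ut_nest b L'.
Proof.
move=> e; apply: eq_bigr => kF _; apply: eq_bigr => mS _.
by apply: eq_mass => t1 r1; apply: eq_mass => t2 r2; apply: eq_mass => t3 r3.
Qed.

Lemma ut_nest_sub b L L' :
  ut_nest b (fun t1 t2 t3 r => L t1 t2 t3 r - L' t1 t2 t3 r) = ut_nest b L - ut_nest b L'.
Proof.
rewrite /ut_nest -sumrB; apply: eq_bigr => kF _; rewrite -sumrB; apply: eq_bigr => mS _.
rewrite -mass_sub; apply: eq_mass => t1 r1; rewrite -mass_sub; apply: eq_mass => t2 r2.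
by rewrite -mass_sub.
Qed.

Lemma setF_ge0 y : 0 <= setF y. Proof. by rewrite (setFE (zerob void)); exact: sampler_ge0. Qed.
Lemma setS_ge0 y : 0 <= setS y. Proof. by rewrite (setSE (zerob void)); exact: sampler_ge0. Qed.

Lemma real_oracle_ge0 pk mS q a : 0 <= real_oracle pk mS q a.
Proof.
rewrite /real_oracle /opt_oracle; case: (optb q) => [f|]; last exact: ler0n.
by apply: sumr_ge0 => k _; apply: mulr_ge0; rewrite ?kgE2 ?encFE2; exact: sampler_ge0.
Qed.

Lemma tens_enc_state Q b mS mF m (r : op R Q) : tens r (enc_state b mS mF m) =
  sumop (fun ct => scale_op (encS mS (chosen b m) ct) (tens r (key mF (bspec_eval gS ct)))).
Proof.
apply/opP => u u'; rewrite /tens /enc_state /sumop mulr_sumr.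
by apply: eq_bigr => ct _; rewrite /scale_op mulrCA.
Qed.

Lemma psd_sumop Q (X : finType) (r : X -> op R Q) : (forall x, psd (r x)) -> psd (sumop r).
Proof.
move=> h v.
have -> : \sum_u \sum_u' conjc (v u) * sumop r u u' * v u' =
   \sum_x \sum_u \sum_u' conjc (v u) * r x u u' * v u'.
  rewrite [RHS]exchange_big /=; apply: eq_bigr => u _; rewrite [RHS]exchange_big /=.
  by apply: eq_bigr => u' _; rewrite /sumop mulr_sumr mulr_suml.
by apply: sumr_ge0 => x _; exact: h.
Qed.

Lemma ut_nest_le b L L' : (forall t1 t2 t3 r, psd r -> L t1 t2 t3 r <= L' t1 t2 t3 r) ->
  ut_nest b L <= ut_nest b L'.
Proof.
move=> h; apply: ler_sum => kF _; apply: ler_sum => mS _.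
apply: le_mass => [|t1 r1 p1].
  apply: psd_ens_interact; first by move=> q a; exact: real_oracle_ge0.
  by apply: psd_scale; [rewrite mulr_ge0 ?setF_ge0 ?setS_ge0 | exact: psd_unit].
apply: le_mass => [|t2 r2 p2].
  apply: psd_ens_interact; first by move=> q a; exact: real_oracle_ge0.
  rewrite tens_enc_state; apply: psd_sumop => ct; apply: psd_scale.
    by rewrite encSE2; exact: sampler_ge0.
  by rewrite keyE2; exact: psd_tens_run.
apply: le_mass => [|t3 r3 p3]; last exact: h.
by apply: psd_ens_interact => // q a; exact: real_oracle_ge0.
Qed.

(** Conditions on logs turn into filters from the inside out, first for B and then for the two
    machines of A, each time because the remaining weight is a linear form in the state. *)
Lemma ut_nest_game b (vm : pred (bits (ML + ML))) (pA : bits (ML + ML) -> pred (bits QRY))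
    (pB : pred (bits QRY)) (fin : pred (bits unit)) :
  ut_nest b (fun t1 t2 t3 r =>
    [&& vm t1.2, all (pA t1.2) (t1.1 ++ t2.1), all pB t3.1 & fin t3.2]%:R * tr r) =
  game b vm (fun m pk mS => filt (pA m) (real_oracle pk mS))
    (fun pk mS _ => filt pB (real_oracle pk mS)) fin.
Proof.
apply: eq_bigr => kF _; apply: eq_bigr => mS _.
set O := real_oracle (fstb kF) mS.
pose G3 y (r : op R void) : R[i] := (fin y)%:R * tr r.
have lin3 y : linear_form (G3 y) by apply: linf_mull; exact: linf_tr.
pose G2 st (r : op R void) := \sum_y G3 y (iact B (fun _ => filt pB O) st r y).
have lin2 (st : bits QS) : linear_form (G2 st).
  apply: linf_sum => y.
  exact: (linf_comp (T := fun rho => iact B _ st rho y)) (lin_iact _ _ _ _) (lin3 y).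
have E2 st r c : mass (interact B O st r) (fun t3 r3 => c * ((all pB t3.1)%:R * G3 t3.2 r3)) = c * G2 st r.
  by rewrite mass_mull (mass_interact _ _ (fun _ => pB) _ _ lin3).
pose G1 m (r : op R QA) := (vm m)%:R * \sum_st G2 st (iact A2 (fun _ => filt (pA m) O) (zerob void)
   (tens r (enc_state b mS (sndb kF) m)) st).
have lin1 m : linear_form (G1 m).
  apply: linf_mull; apply: linf_sum => st.
  apply: (linf_comp (T := fun rho => tens rho _) (G := fun rho => G2 st (iact A2 _ _ rho st))).
    exact: lin_tens.
  exact: (linf_comp (T := fun rho => iact A2 _ _ rho st)) (lin_iact _ _ _ _) (lin2 st).
transitivity (mass (interact A1 O (zerob void) (scale_op (setF kF * setS mS) (unit_op R)))
  (fun t1 r1 => (all (pA t1.2) t1.1)%:R * G1 t1.2 r1)).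
  apply: eq_mass => t1 r1; rewrite /G1.
  transitivity (mass (interact A2 O (zerob void) (tens r1 (enc_state b mS (sndb kF) t1.2)))
    (fun t2 r2 => ((vm t1.2)%:R * (all (pA t1.2) t1.1)%:R) * ((all (pA t1.2) t2.1)%:R * G2 t2.2 r2))).
    apply: eq_mass => t2 r2; rewrite mulrA -E2; apply: eq_mass => t3 r3.
    by rewrite /G3 all_cat -!mulnb !natrM !mulrA.
  rewrite mass_mull (mass_interact _ _ (fun _ => pA t1.2) _ _ lin2); ring.
rewrite (mass_interact _ _ _ _ _ lin1) mulr_sumr; apply: eq_bigr => m _.
rewrite (lin_scale _ _ (lin_iact _ _ _ _)) (linf_scale _ _ (lin1 m)); congr (_ * _).
rewrite /G1; congr (_ * _); rewrite tens_enc_state.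
under eq_bigr => st _ do
  rewrite (lin_sum _ (lin_iact _ _ _ _)) (linf_sumop _ (lin2 _)).
rewrite exchange_big /=; apply: eq_bigr => ct _; rewrite mulr_sumr; apply: eq_bigr => st _.
by rewrite (lin_scale _ _ (lin_iact _ _ _ _)) (linf_scale _ _ (lin2 _)).
Qed.

Definition sk_nest QX (X1 : machine void void QRY2 ANS2 (ML + ML) QX)
    (X2 : machine CT QX QRY2 ANS2 unit void) b
    (L : seq (bits QRY2) * bits (ML + ML) -> seq (bits QRY2) * bits unit -> op R void -> R[i]) : R[i] :=
  \sum_mS
    let O := pair_oracle (opt_oracle (kg mS)) (opt_oracle (encS mS)) in
    mass (interact X1 O (zerob void) (scale_op (setS mS) (unit_op R))) (fun t1 r1 =>
    \sum_ct mass (interact X2 O ct (scale_op (encS mS (chosen b t1.2) ct) r1))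
      (fun t2 r2 => L t1 t2 r2)).

Lemma eq_sk_nest QX X1 X2 b L L' : (forall t1 t2 r, L t1 t2 r = L' t1 t2 r) ->
  @sk_nest QX X1 X2 b L = @sk_nest QX X1 X2 b L'.
Proof.
move=> e; apply: eq_bigr => mS _; apply: eq_mass => t1 r1; apply: eq_bigr => ct _.
by apply: eq_mass => t2 r2.
Qed.

Lemma sk_nest_sub QX X1 X2 b L L' :
  @sk_nest QX X1 X2 b (fun t1 t2 r => L t1 t2 r - L' t1 t2 r) =
  @sk_nest QX X1 X2 b L - @sk_nest QX X1 X2 b L'.
Proof.
rewrite /sk_nest -sumrB; apply: eq_bigr => mS _; rewrite -mass_sub; apply: eq_mass => t1 r1.
by rewrite -sumrB; apply: eq_bigr => ct _; rewrite -mass_sub.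
Qed.

Lemma sk_nest_iact QX X1 X2 b (vm : pred (bits (ML + ML)))
    (p : bits (ML + ML) -> pred (bits QRY2)) (fin : pred (bits unit)) :
  let O m mS := filt (p m) (pair_oracle (opt_oracle (kg mS)) (opt_oracle (encS mS))) in
  @sk_nest QX X1 X2 b (fun t1 t2 r =>
    [&& vm t1.2, all (p t1.2) (t1.1 ++ t2.1) & fin t2.2]%:R * tr r) =
  \sum_mS \sum_m (vm m)%:R * \sum_ct \sum_y (fin y)%:R * tr (iact X2 (fun _ => O m mS) ct
    (scale_op (encS mS (chosen b m) ct)
      (iact X1 (fun _ => O m mS) (zerob void) (scale_op (setS mS) (unit_op R)) m)) y).
Proof.
move=> O; apply: eq_bigr => mS _.
set O0 := pair_oracle _ _.
pose G2 y (r : op R void) : R[i] := (fin y)%:R * tr r.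
have lin2 y : linear_form (G2 y) by apply: linf_mull; exact: linf_tr.
pose G1 m (r : op R QX) := (vm m)%:R * \sum_ct \sum_y G2 y
  (iact X2 (fun _ => O m mS) ct (scale_op (encS mS (chosen b m) ct) r) y).
have lin1 m : linear_form (G1 m).
  apply: linf_mull; apply: linf_sum => ct; apply: linf_sum => y.
  apply: (linf_comp (T := @scale_op R _ _) (G := fun rho => G2 y (iact X2 _ ct rho y))).
    exact: lin_scaleop.
  exact: (linf_comp (T := fun rho => iact X2 _ ct rho y)) (lin_iact _ _ _ _) (lin2 y).
rewrite -(mass_interact _ _ _ _ _ lin1); apply: eq_mass => t1 r1.
rewrite /G1 mulrA [_ * (vm _)%:R]mulrC mulr_sumr; apply: eq_bigr => ct _.
rewrite -(mass_interact _ _ (fun _ => p t1.2) _ _ lin2) -mass_mull; apply: eq_mass => t2 r2.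
by rewrite /G2 all_cat -!mulnb !natrM !mulrA.
Qed.

Lemma filt_predT I J (O : bits I -> bits J -> R[i]) : filt predT O = O.
Proof. by apply/funext => q; apply/funext => a; rewrite /filt mul1r. Qed.

Lemma ut_nest_bit b :
  ut_nest b (fun _ _ t3 r => (t3.2 tt)%:R * tr r) =
  game b predT (fun _ => real_oracle) (hyb (rounds B)) (fun y => y tt).
Proof.
have := ut_nest_game b predT (fun _ => predT) predT (fun y : bits unit => y tt).
set L := (fun t1 t2 t3 r => _) => E.
transitivity (ut_nest b L).
  by apply: eq_ut_nest => t1 t2 t3 r; rewrite /L !all_predT.
rewrite E; apply: eq_game => [m pk mS|pk mS j lj]; first exact: filt_predT.
by rewrite filt_predT /hyb lj.
Qed.

(** * The hybrid argument and the simulation *)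

Lemma dummy_qalg I Q J Q' : exists a : qalg I Q J Q',
  qsize a = (#|I| + #|Q| + 2 * #|J| + 2 * #|Q'|)%N.
Proof.
exists (@QAlg I Q J Q' (J + Q')%type [::] (fun j => inr (inl j)) (fun q => inr (inr q))).
rewrite /qsize /= card_sum; move: #|I| #|Q| #|J| #|Q'| => i q j q'; lia.
Qed.

(** The real part of [V be] is the output probability of the constructed UTK adversary under
    challenge bit [be]; the factor [rounds B] is the loss of the hybrid argument. *)
Lemma utk_hybrid b :
  exists (A1' : qalg PK void DS (K0 + QA)) (A2' : qalg void (K0 + QA + FK) (K0 + QS) void)
    (B0' : qalg (K0 + QS) void (KL + KL) (K0 + QRY + work B))
    (B1' : qalg CTF (K0 + QRY + work B) unit void),
  (qsize A1' + qsize A2' + qsize B0' + qsize B1' <= 80 * sz * sz + 400 * sz + 20)%N /\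
  let V be := \sum_kF \sum_f \sum_s \sum_m \sum_ct \sum_(y : bits unit) (y tt)%:R * tr (run B1' ct
    (scale_op (encF (fstb kF) (if be then sndb m else fstb m) ct)
      (run B0' s (run A2' (zerob void)
        (tens (run A1' (fstb kF) (scale_op (setF kF) (unit_op R)) f) (key (sndb kF) f)) s) m)) y) in
  `|complex.Re (ut_nest b (fun _ _ t3 r => (t3.2 tt)%:R * tr r)) -
    complex.Re (game b predT (fun _ => real_oracle) (fun pk _ _ => zero_oracle pk) (fun y => y tt))|
  <= (rounds B)%:R * `|complex.Re (V false) - complex.Re (V true)|.
Proof.
(* Without any query of B there is nothing to attack, and the adversary is void. *)
have [n0|n0] := posnP (rounds B).
  have [A1' e1] := dummy_qalg PK void DS (K0 + QA)%type.
  have [A2' e2] := dummy_qalg void (K0 + QA + FK)%type (K0 + QS)%type void.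
  have [B0' e3] := dummy_qalg (K0 + QS)%type void (KL + KL)%type (K0 + QRY + work B)%type.
  have [B1' e4] := dummy_qalg CTF (K0 + QRY + work B)%type unit void.
  exists A1', A2', B0', B1'; split.
    have := msize_start A1; have := msize_start A2; have := msize_start B.
    rewrite e1 e2 e3 e4; move: sz_mach sz_regs; rewrite /qsize !card_sum !card_unit !card_void.
    lia.
  move=> V.
  have -> : ut_nest b (fun _ _ t3 r => (t3.2 tt)%:R * tr r) =
    game b predT (fun _ => real_oracle) (fun pk _ _ => zero_oracle pk) (fun y => y tt).
    by rewrite ut_nest_bit; apply: eq_game => // pk mS j; rewrite n0.
  by rewrite subrr normr0 mulr_ge0.
(* By nonuniformity, the round with the largest gap can be hardwired. *)
pose h i := complex.Re (game b predT (fun _ => real_oracle) (hyb i) (fun y => y tt)).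
pose d (i : 'I_(rounds B)) := `|h i.+1 - h i|.
have [i _ imax] := arg_maxP (P := predT) d (i0 := Ordinal n0) isT.
have [A1' [A2' [B0' [B1' [le E]]]]] := utk_reduction b (ltn_ord i).
exists A1', A2', B0', B1'; split; first by apply: leq_trans le _; lia.
move=> V.
have EF : complex.Re (V false) = h i.+1 by rewrite /h -(E false).
have ET : complex.Re (V true) = h i by rewrite /h -(E true).
have EU : complex.Re (ut_nest b (fun _ _ t3 r => (t3.2 tt)%:R * tr r)) = h (rounds B).
  by rewrite /h -ut_nest_bit.
have EZ : complex.Re (game b predT (fun _ => real_oracle) (fun pk _ _ => zero_oracle pk)
    (fun y => y tt)) = h 0 by rewrite /h; congr complex.Re; apply: eq_game.
rewrite EF ET EU EZ.
change (`|h (rounds B) - h 0| <= (rounds B)%:R * d i).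
have -> : h (rounds B) - h 0 = \sum_(j < rounds B) (h j.+1 - h j).
  by rewrite -(big_mkord predT (fun j => h j.+1 - h j)) telescope_sumr.
apply: le_trans (ler_norm_sum _ _ _) _.
apply: (@le_trans _ _ (\sum_(j < rounds B) d i)); first by apply: ler_sum => j _; exact: imax.
by rewrite sumr_const card_ord mulr_natl.
Qed.

(** On padded queries [p] coincides with [pA], so the two notions of legality agree on all queries
    that the simulation sends to the SKFE oracle; the queries of B never reach it. *)
Lemma sk_simulation :
  exists (A1' : machine void void QRY2 ANS2 (ML + ML) (KF + QA))
    (A2' : machine CT (KF + QA) QRY2 ANS2 unit void),
  [/\ (msize A1' + msize A2' <= 400 * sz * sz + 400 * sz + 100)%N,
    forall b, sk_nest A1' A2' b (fun _ t2 r => (t2.2 tt)%:R * tr r) =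
      game b predT (fun _ => real_oracle) (fun pk _ _ => zero_oracle pk) (fun y => y tt) &
    forall b (vm : pred (bits (ML + ML))) (pA : bits (ML + ML) -> pred (bits QRY))
      (pB : pred (bits QRY)) (p : bits (ML + ML) -> pred (bits QRY2)),
      (forall m q, p m (padq q) = pA m q) ->
      complex.Re (ut_nest b (fun t1 t2 t3 r =>
        (~~ [&& vm t1.2, all (pA t1.2) (t1.1 ++ t2.1) & all pB t3.1])%:R * tr r)) = 0 ->
      complex.Re (sk_nest A1' A2' b (fun t1 t2 r =>
        (~~ (vm t1.2 && all (p t1.2) (t1.1 ++ t2.1)))%:R * tr r)) = 0].
Proof.
have [A1' [A2' [le E]]] := sk_reduction; exists A1', A2'.
have skE b vm p fin : sk_nest A1' A2' b (fun t1 t2 r =>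
    [&& vm t1.2, all (p t1.2) (t1.1 ++ t2.1) & fin t2.2]%:R * tr r) =
  game b vm (fun m pk mS => filt (fun q => p m (padq q)) (real_oracle pk mS))
      (fun pk _ _ => zero_oracle pk) fin.
  by rewrite sk_nest_iact; exact: E.
split=> //.
  move=> b; transitivity (game b predT (fun m pk mS => filt (fun q => predT (padq q)) (real_oracle pk mS))
      (fun pk _ _ => zero_oracle pk) (fun y => y tt)).
    by rewrite -(skE _ _ (fun _ => predT)); apply: eq_sk_nest => t1 t2 r; rewrite all_predT.
  by apply: eq_game => // m pk mS; exact: filt_predT.
move=> b vm pA pB p pE H.
(* Positivity drops the condition on the queries of B; as B's machine preserves the
   trace, the remaining weight does not depend on how B is answered. *)
set L := fun t1 t2 t3 r => _ in H.
have ge0 : 0 <= ut_nest b (fun t1 t2 _ r => (~~ (vm t1.2 && all (pA t1.2) (t1.1 ++ t2.1)))%:R * tr r).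
  have -> : 0 = ut_nest b (fun _ _ _ _ => 0).
    rewrite /ut_nest big1 // => kF _; rewrite big1 // => mS _.
    rewrite /mass big1 // => b1 _; rewrite big1 // => b2 _; rewrite big1 //.
  by apply: ut_nest_le => t1 t2 t3 r pr; apply: mulr_ge0; [exact: ler0n | exact: psd_tr].
have leL : ut_nest b (fun t1 t2 _ r => (~~ (vm t1.2 && all (pA t1.2) (t1.1 ++ t2.1)))%:R * tr r) <=
           ut_nest b L.
  apply: ut_nest_le => t1 t2 t3 r pr; apply: ler_wpM2r; first exact: psd_tr.
  by rewrite ler_nat; case: (vm _) => //; case: (all _ _).
have Re0 : complex.Re (ut_nest b
   (fun t1 t2 _ r => (~~ (vm t1.2 && all (pA t1.2) (t1.1 ++ t2.1)))%:R * tr r)) = 0.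
  apply/eqP; rewrite eq_le -{1}H.
  by move: leL ge0; rewrite !lecE => /andP[_ ->] /andP[_].
rewrite -Re0; congr complex.Re.
(* A violation is no conjunction over the log, so filters do not express it; its complement is one,
   whence the difference of total and legal weight. *)
have negE (c : bool) (x : R[i]) : (~~ c)%:R * x = true%:R * x - c%:R * x.
  by case: c; rewrite /= ?mul1r ?mul0r ?subrr ?subr0.
under [LHS]eq_sk_nest => t1 t2 r do rewrite negE.
under [RHS]eq_ut_nest => t1 t2 t3 r do rewrite negE.
rewrite sk_nest_sub ut_nest_sub; congr (_ - _).
- transitivity (game b predT (fun m pk mS => filt predT (real_oracle pk mS))
      (fun pk mS _ => filt predT (real_oracle pk mS)) predT).
    transitivity (game b predT (fun m pk mS => filt (fun q => predT (padq q)) (real_oracle pk mS))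
      (fun pk _ _ => zero_oracle pk) predT).
      by rewrite -(skE _ _ (fun _ => predT)); apply: eq_sk_nest => t1 t2 r; rewrite all_predT.
    rewrite (game_tr _ _ _ (O3' := fun pk mS _ => filt predT (real_oracle pk mS))).
    + exact: eq_game.
    + by move=> pk mS j q; exact: sum_zero_oracle.
    + by move=> pk mS j q; rewrite filt_predT; exact: sum_real_oracle.
  have <- := ut_nest_game b predT (fun _ => predT) predT predT.
  by apply: eq_ut_nest => t1 t2 t3 r; rewrite !all_predT.
- transitivity (game b vm (fun m pk mS => filt (pA m) (real_oracle pk mS))
      (fun pk mS _ => filt predT (real_oracle pk mS)) predT).
    transitivity (game b vm (fun m pk mS => filt (fun q => p m (padq q)) (real_oracle pk mS))
      (fun pk _ _ => zero_oracle pk) predT).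
      by rewrite -(skE _ _ p); apply: eq_sk_nest => t1 t2 r; rewrite andbT.
    rewrite (game_tr _ _ _ (O3' := fun pk mS _ => filt predT (real_oracle pk mS))).
    + apply: eq_game => // m pk mS; congr (filt _ _).
      by apply/funext => q; exact: pE.
    + by move=> pk mS j q; exact: sum_zero_oracle.
    + by move=> pk mS j q; rewrite filt_predT; exact: sum_real_oracle.
  have <- := ut_nest_game b vm pA predT predT.
  by apply: eq_ut_nest => t1 t2 t3 r; rewrite all_predT andbT.
Qed.

End Scheme.

(** * Polynomial bounds and negligible functions *)

Section Growth.

(** A single power with base at least 2 grows with its exponent and multiplies by adding exponents,
    which makes sums and products immediate. *)
Lemma poly_boundedP f : poly_bounded f <-> exists c, forall t, (f t <= (t + 2) ^ c)%N.
Proof.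
split=> [[c h]|[c h]].
  exists c.+1 => t; apply: leq_trans (h t) _; rewrite expnS.
  apply: (@leq_trans (2 * (t + 2) ^ c)); last by rewrite leq_mul2r leq_addl orbT.
  rewrite mul2n -addnn; apply: leq_add; first by case: c {h} => // c; rewrite leq_exp2r ?leq_addr.
  by apply: leq_trans (ltnW (ltn_expl c (ltnSn 1))) _; case: c {h} => // c; rewrite leq_exp2r // leq_addl.
(* From t = 2 on, [t + 2 <= t ^ 2]; the summand [3 ^ c] covers t = 0 and t = 1. *)
exists (2 * c + 3 ^ c)%N => t; apply: leq_trans (h t) _.
case: t => [|[|t]].
- apply: leq_trans (leq_addl _ _); apply: leq_trans (leq_addl _ _); rewrite add0n.
  by case: (c) => // d; rewrite leq_exp2r.
- by apply: leq_trans (leq_addl _ _); rewrite leq_addl.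
apply: leq_trans (leq_addr _ _); rewrite expnD expnM.
apply: (@leq_trans ((t.+2 ^ 2) ^ c)); last by rewrite leq_pmulr // expn_gt0.
case: (c) => // d; rewrite leq_exp2r // -addn2 -mulnn; nia.
Qed.

Lemma poly_add f g : poly_bounded f -> poly_bounded g -> poly_bounded (fun t => f t + g t)%N.
Proof.
move=> /poly_boundedP[c hf] /poly_boundedP[d hg]; apply/poly_boundedP.
exists (c + d).+1 => t; apply: leq_trans (leq_add (hf t) (hg t)) _.
rewrite expnS; apply: (@leq_trans (2 * (t + 2) ^ (c + d))); last by rewrite leq_mul2r leq_addl orbT.
rewrite mul2n -addnn; apply: leq_add; rewrite leq_pexp2l ?leq_addr ?leq_addl //; lia.
Qed.

Lemma poly_mul f g : poly_bounded f -> poly_bounded g -> poly_bounded (fun t => f t * g t)%N.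
Proof.
move=> /poly_boundedP[c hf] /poly_boundedP[d hg]; apply/poly_boundedP.
by exists (c + d)%N => t; rewrite expnD leq_mul.
Qed.

Lemma poly_le f g : (forall t, f t <= g t)%N -> poly_bounded g -> poly_bounded f.
Proof. by move=> h [c hg]; exists c => t; exact: leq_trans (hg t). Qed.

Lemma poly_const n : poly_bounded (fun _ => n).
Proof. by exists n => t; rewrite leq_addl. Qed.

Lemma poly_id : poly_bounded id.
Proof. by exists 1%N => t; rewrite expn1 leq_addr. Qed.

Lemma poly_exp f c : poly_bounded f -> poly_bounded (fun t => f t ^ c)%N.
Proof.
move=> h; elim: c => [|c IH]; first exact: poly_const.
by under [X in poly_bounded X]funext do rewrite expnS; exact: poly_mul.
Qed.

Lemma poly_quad a b c f : poly_bounded f ->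
  poly_bounded (fun l => a * f l * f l + b * f l + c)%N.
Proof.
move=> hf; apply: poly_add (poly_const c).
apply: poly_add; last exact: poly_mul (poly_const b) hf.
exact: poly_mul (poly_mul (poly_const a) hf) hf.
Qed.

Lemma poly_in_comp T (mu f : T -> nat) (g : nat -> T) :
  poly_in mu f -> poly_bounded (fun l => mu (g l)) -> poly_bounded (fun l => f (g l)).
Proof.
move=> [c h] hm; apply: poly_le (fun l => h (g l)) _.
by apply: poly_add (poly_const c); exact: poly_exp.
Qed.

Variable R : realType.
Implicit Types (f g : nat -> R).

Lemma negl_le f g : (forall l, `|f l| <= `|g l|) -> negligible g -> negligible f.
Proof. by move=> h hg c; have [N hN] := hg c; exists N => l hl; apply: le_lt_trans (h l) (hN l hl). Qed.

Lemma negl_add f g : negligible f -> negligible g -> negligible (fun l => f l + g l).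
Proof.
(* One spare power of [l], which is at least 2, pays for the two summands. *)
move=> hf hg c; have [N hN] := hf c.+1; have [N' hN'] := hg c.+1.
exists (N + N' + 2)%N => l hl.
have h1 := hN l (leq_trans (leq_trans (leq_addr _ _) (leq_addr _ _)) hl).
have h2 := hN' l (leq_trans (leq_trans (leq_addl _ _) (leq_addr _ _)) hl).
apply: le_lt_trans (ler_normD _ _) _; apply: lt_le_trans (ltrD h1 h2) _.
have l2 : (2 : R) <= l%:R by rewrite ler_nat (leq_trans _ hl) // leq_addl.
have l0 : (0 : R) < l%:R by apply: lt_le_trans l2.
rewrite exprS invfM -mulrDl -[X in _ <= X]mul1r.
apply: ler_wpM2r; first by rewrite invr_ge0 exprn_ge0 // ltW.
have h3 : (l%:R : R)^-1 <= 2^-1 by rewrite lef_pV2 ?posrE.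
by rewrite [X in _ <= X]splitr mul1r; exact: lerD.
Qed.

Lemma negl_opp f : negligible f -> negligible (fun l => - f l).
Proof. by apply: negl_le => l; rewrite normrN. Qed.

Lemma negl_mul (n : nat -> nat) g : poly_bounded n -> negligible g ->
  negligible (fun l => (n l)%:R * `|g l|).
Proof.
(* The factor [n l] is at most [(l + 2) ^ k], hence at most [l ^ (2 * k)] once [l] is at least 2. *)
move=> /poly_boundedP[k hk] hg c; have [N hN] := hg (c + 2 * k)%N.
exists (N + 2)%N => l hl; have h1 := hN l (leq_trans (leq_addr _ _) hl).
have l2 : (2 <= l)%N by rewrite (leq_trans _ hl) // leq_addl.
have l0 : (0 : R) < l%:R by rewrite ltr0n (leq_trans _ l2).
rewrite normrM normr_id [`|_%:R|]ger0_norm ?ler0n //.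
have le1 : (n l)%:R <= l%:R ^+ (2 * k) :> R.
  rewrite -natrX ler_nat; apply: leq_trans (hk l) _; rewrite expnM.
  by case: (k) => // d; rewrite leq_exp2r // -mulnn; nia.
apply: le_lt_trans (ler_wpM2r (normr_ge0 _) le1) _.
have e : l%:R ^+ (2 * k) * (l%:R ^+ (c + 2 * k))^-1 = (l%:R ^+ c)^-1 :> R.
  by rewrite exprD invfM mulrCA divff ?mulr1 // expf_neq0 // gt_eqF.
by rewrite -e ltr_pM2l // exprn_gt0.
Qed.

End Growth.

(** * Security *)

(** The hardwired string enters the adjacency matrix only where gate [1 + i] is fed by gate 0, and
    this entry equals bit [i]; all other entries are constants, read off from the zero string. The
    description of [G[ct]] is thus obtained from [ct] by copying bits. *)
Definition hardwire_spec (I : finType) (n s : nat) (J : finType) (c : bcirc (I + 'I_n) s J) :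
  bspec 'I_n (bdesc I (1 + n + s) J) := fun rw =>
  let const := inl (hardwire c (zerob _) rw) in
  match rw.1 with
  | inl k => match split k with
             | inl k' => match split k' with
                         | inr i => if rw.2 is inr k0 then
                                      if k0 == 0%N :> nat then inr (i, i) else const
                                    else const
                         | inl _ => const
                         end
             | inr _ => const
             end
  | inr _ => const
  end.

Lemma bspec_eval_hardwire (I : finType) (n s : nat) (J : finType) (c : bcirc (I + 'I_n) s J) y :
  bspec_eval (hardwire_spec c) y = hardwire c y.
Proof.
apply/ffunP => -[r w]; rewrite !ffunE /hardwire_spec /=.
case: r => [k|j]; last by rewrite !ffunE.
case ek: (split k) => [k'|k']; last by rewrite !ffunE /= ek.
case ek': (split k') => [o|i]; first by rewrite !ffunE /= ek ek'.
case: w => [x|k0]; first by rewrite !ffunE /= ek ek' !andbF.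
case: eqP => e; first by rewrite /= andbb andbT.
by rewrite !ffunE /= ek ek'; move/eqP/negbTE: e => ->; rewrite !andbF.
Qed.

Lemma all_pmap (T U : Type) (f : T -> option U) (p : pred U) s :
  all p (pmap f s) = all (fun x => oapp p true (f x)) s.
Proof. by elim: s => //= x s IH; case: (f x) => //= u; rewrite IH. Qed.

Section Concrete.
Variables (R : realType) (FC : fclass) (S : skfe R FC) (F : feutk R (sk_keylen S) (olen FC)).
Variable A : ut_adversary (utskfe_of F).
Variable l : nat.

Let size_G := (1 + sk_ctlen S l + sk_decsize S l)%N.
Let setF := fe_setup F (l := l).
Let setS := sk_setup S (l := l).
Let kg := sk_keygen S (l := l).
Let encS := sk_enc S (l := l).
Let encF := fe_enc F (l := l).
Let key := fe_keygen F (l := l) (s := size_G).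
Let gS := hardwire_spec (sk_dec S l).

Definition msgs_ok (m : bits ('I_(mlen FC l) + 'I_(mlen FC l))) : bool :=
  (fstb m \in msgs FC l) && (sndb m \in msgs FC l).
Definition same_image (m : bits ('I_(mlen FC l) + 'I_(mlen FC l))) (f : bits 'I_(flen FC l)) : bool :=
  (f \in funs FC l) && (fev f (fstb m) == fev f (sndb m)).
Definition keyq_ok m (q : bits (unit + 'I_(flen FC l))) : bool := oapp (same_image m) true (optb q).
Definition keyq_in_funs (q : bits (unit + 'I_(flen FC l))) : bool :=
  oapp (fun f => f \in funs FC l) true (optb q).
Definition skq_ok m (q : bits (sk_query FC l)) : bool :=
  keyq_ok m (fstb q) && oapp (fun m => m \in msgs FC l) true (optb (sndb q)).

Lemma ut_gameE b (Z : pred (bool * bool)) :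
  Pr (ut_game A b l) Z = complex.Re (ut_nest setF setS kg encS encF key gS
    (uta_A1 A l) (uta_A2 A l) (uta_B A l) b (fun t1 t2 t3 r =>
      (Z ([&& msgs_ok t1.2, all (keyq_ok t1.2) (t1.1 ++ t2.1) & all keyq_in_funs t3.1], t3.2 tt))%:R * tr r)).
Proof.
rewrite PrE /ut_game mass_bind mass_draw; congr complex.Re.
rewrite big_pairb; apply: eq_bigr => kF _; apply: eq_bigr => mS _.
rewrite mass_bind.
have -> : ut_setup (utskfe_of F) (pairb kF mS) = setF kF * setS mS.
  by rewrite /= fstb_pairb sndb_pairb.
have -> : opt_oracle (ut_keygen (utskfe_of F) (pairb kF mS)) = real_oracle kg encF (fstb kF) mS.
  by rewrite /real_oracle; congr opt_oracle; apply/funext => f; apply/funext => a;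
    rewrite /= fstb_pairb sndb_pairb.
have sE m : ut_enc (utskfe_of F) (pairb kF mS) (if b then sndb m else fstb m) =
    enc_state encS key gS b mS (sndb kF) m.
  apply/opP => z z'; rewrite /= fstb_pairb sndb_pairb; apply: eq_bigr => ct _.
  by rewrite /gS bspec_eval_hardwire.
apply: eq_mass => t1 r1; rewrite mass_bind sE.
apply: eq_mass => t2 r2; rewrite mass_bind.
apply: eq_mass => t3 r3; rewrite mass_ret; congr ((Z (_, _))%:R * _).
rewrite !all_pmap /valid_challenge -!andbA; congr [&& _, _ & _].
by rewrite all_pmap.
Qed.

Lemma sk_gameE (D : sk_adversary S) b (Z : pred (bool * bool)) :
  Pr (sk_game D b l) Z = complex.Re (sk_nest setS kg encS (ska_A1 D l) (ska_A2 D l) b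
   (fun t1 t2 r => (Z (msgs_ok t1.2 && all (skq_ok t1.2) (t1.1 ++ t2.1), t2.2 tt))%:R * tr r)).
Proof.
rewrite PrE /sk_game mass_bind mass_draw; congr complex.Re.
apply: eq_bigr => mS _; rewrite mass_bind.
apply: eq_mass => t1 r1; rewrite mass_bind mass_draw.
apply: eq_bigr => ct _; rewrite mass_bind.
apply: eq_mass => t2 r2; rewrite mass_ret; congr ((Z (_, _))%:R * _).
rewrite !all_pmap /valid_challenge -!andbA; congr [&& _, _ & _].
rewrite all_pmap -all_predI; apply: eq_all => q /=.
by [].
Qed.

Lemma utk_gameE (D : utk_adversary F) b :
  Pr (utk_game D b l) id = complex.Re (\sum_kF \sum_f \sum_s \sum_m \sum_ct \sum_(y : bits unit)
    (y tt)%:R * tr (run (utka_B1 D l) ct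
    (scale_op (encF (fstb kF) (if b then sndb m else fstb m) ct)
      (run (utka_B0 D l) s (run (utka_A2 D l) (zerob void)
        (tens (run (utka_A1 D l) (fstb kF) (scale_op (setF kF) (unit_op R)) f)
              (fe_keygen F (sndb kF) f)) s) m)) y)).
Proof.
rewrite PrE /utk_game mass_bind mass_draw; congr complex.Re.
apply: eq_bigr => kF _; rewrite mass_bind mass_exec.
apply: eq_bigr => f _; rewrite mass_bind mass_exec.
apply: eq_bigr => s _; rewrite mass_bind mass_exec.
apply: eq_bigr => m _; rewrite mass_bind mass_draw.
apply: eq_bigr => ct _; rewrite mass_bind mass_exec.
by apply: eq_bigr => y _; rewrite mass_ret.
Qed.

End Concrete.

Lemma qsize_regs (I Q J Q' : finType) (a : qalg I Q J Q') :
  (#|I| + #|Q| + #|J| + #|Q'| <= qsize a)%N.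
Proof. exact: leq_trans (leq_addr _ _) (leq_addr _ _). Qed.

Lemma leq_add_sum4 a b c d e n : (b + c + d + e <= n -> a + b + c + d + e <= a + n)%N.
Proof. lia. Qed.

(** The circuits are found for each security parameter separately; choice assembles them into one
    nonuniform family. *)
Lemma dep_choice2 (T : Type) (T1 T2 : T -> Type) (Z : forall t, T1 t -> T2 t -> Prop) :
  (forall t, exists x1 x2, Z t x1 x2) ->
  exists x1 x2, forall t, Z t (x1 t) (x2 t).
Proof.
move=> H; pose f t := cid (H t); pose g t := cid (projT2 (f t)).
by exists (fun t => projT1 (f t)), (fun t => projT1 (g t)) => t; exact: (projT2 (g t)).
Qed.

Lemma dep_choice4 (T : Type) (T1 T2 T3 T4 : T -> Type)
    (Z : forall t, T1 t -> T2 t -> T3 t -> T4 t -> Prop) :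
  (forall t, exists x1 x2 x3 x4, Z t x1 x2 x3 x4) ->
  exists x1 x2 x3 x4, forall t, Z t (x1 t) (x2 t) (x3 t) (x4 t).
Proof.
move=> H; have [x1 [x2 H2]] := dep_choice2 H.
by have [x3 [x4 H4]] := dep_choice2 H2; exists x1, x2, x3, x4.
Qed.

Theorem theorem7p10 (R : realType) (FC : fclass)
    (S : skfe R FC) (F : feutk R (sk_keylen S) (olen FC)) :
  skfe_qpt S -> skfe_correct S ->
  feutk_qpt F -> feutk_correct F ->
  skfe_adaptive_secure S ->
  feutk_utk_secure F ->
  utskfe_single_ct_ut_secure (utskfe_of F).
Proof.
move=> [[aS [pS HS]] [akg [pkg Hkg]] [aenc [penc Henc]] pdec] _.
move=> [[aF [pF HF]] [akey [pkey Hkey]] [aencF [pencF HencF]] _] _ secS secF A polyA admA.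
pose sG l := (1 + sk_ctlen S l + sk_decsize S l)%N.
(* As registers count in the size of an algorithm, this number bounds them together with the
   circuits of the scheme and of the adversary. *)
pose sz l := (qsize (aF l) + qsize (aS l) + qsize (akg l) + qsize (aenc l) + qsize (aencF l)
  + qsize (akey (l, sG l)) + (msize (uta_A1 A l) + msize (uta_A2 A l) + msize (uta_B A l)))%N.
have psG : poly_bounded sG.
  apply: poly_add; last by apply: poly_le pdec => l; exact: leq_addr.
  apply: poly_add; first exact: poly_const.
  by apply: poly_le penc => l; rewrite /qsize card_ord; lia.
have psz : poly_bounded sz.
  apply: poly_add polyA; apply: poly_add; first exact: (poly_add (poly_add (poly_add (poly_add pF pS) pkg) penc) pencF).
  (* FE key generation is polynomial in the security parameter and the size of the queried circuit,
     so the size of [G[ct]] has to be polynomial. *)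
  apply: (@poly_in_comp _ _ (fun t => qsize (akey t)) (fun l => (l, sG l)) pkey).
  exact: (poly_add poly_id psG).
have szA l : (qsize (aF l) + qsize (aS l) + qsize (akg l) + qsize (aenc l) + qsize (aencF l)
  + qsize (akey (l, sG l)) <= sz l)%N by exact: leq_addr.
have szM l : (msize (uta_A1 A l) + msize (uta_A2 A l) + msize (uta_B A l) <= sz l)%N.
  exact: leq_addl.
have szR l : (#|'I_(fe_pklen F l)| + #|'I_(fe_msklen F l)| + #|'I_(sk_msklen S l)|
  + #|'I_(flen FC l)| + #|'I_(mlen FC l)| + #|'I_(sk_keylen S l)| + #|'I_(sk_ctlen S l)|
  + #|'I_(fe_ctlen F l)| + #|'I_(fe_keylen F l (sG l))|
  + #|bdesc 'I_(sk_keylen S l) (sG l) 'I_(olen FC l)| <= sz l)%N.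
  have h1 := qsize_regs (aF l); have h2 := qsize_regs (aS l); have h3 := qsize_regs (akg l).
  have h4 := qsize_regs (aenc l); have h5 := qsize_regs (aencF l).
  have h6 := qsize_regs (akey (l, sG l)).
  move: h1 h2 h3 h4 h5 h6 (szA l); rewrite /= !card_sum !card_ord !card_void.
  move: (qsize _) (qsize _) (qsize _) (qsize _) (qsize _) (qsize _) #|_| => *; lia.
have keyE l (x : bits ('I_(fe_msklen F l) + bdesc 'I_(sk_keylen S l) (sG l) 'I_(olen FC l))) :
    fe_keygen F (fstb x) (sndb x) = run (akey (l, sG l)) x (unit_op R) (zerob void).
  by apply/opP => z z'; exact: (Hkey (l, sG l)).
(* The intermediate experiment: A is served as in the real one, while B receives encryptions of 0
   only. *)
pose Z b l := complex.Re (game (fe_setup F (l := l)) (sk_setup S (l := l)) (sk_enc S (l := l))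
   (fe_keygen F (l := l) (s := sG l)) (hardwire_spec (sk_dec S l))
   (uta_A1 A l) (uta_A2 A l) (uta_B A l) b predT
   (fun _ => real_oracle (sk_keygen S (l := l)) (fe_enc F (l := l)))
   (fun pk _ _ => zero_oracle (FL := 'I_(flen FC l)) (fe_enc F (l := l)) pk) (fun y => y tt)).
have utkP b : negligible (fun l => Pr (ut_game A b l) (fun r => r.2) - Z b l).
  have H0 l := utk_hybrid (fe_setup F (l := l)) (fe_keygen F (l := l) (s := sG l)) (HS l) (Hkg l)
    (Henc l) (HencF l) (hardwire_spec (sk_dec S l)) (szA l) (szR l) (szM l) b.
  have [x1 [x2 [x3 [x4 H4]]]] := dep_choice4 H0.
  pose D := @UTKAdversary R _ _ F sG _ _ _ x1 x2 x3 x4.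
  have pD : utk_adversary_qpt D.
    apply: poly_le (poly_add psG (poly_quad 80 400 20 psz)) => l.
    by have [le _] := H4 l; exact: leq_add_sum4 le.
  have prounds : poly_bounded (fun l => rounds (uta_B A l)).
    apply: poly_le psz => l; apply: leq_trans (szM l); apply: leq_trans (leq_addl _ _).
    by apply: leq_trans (msize_start _); exact: leq_addl.
  apply: negl_le (negl_mul prounds (secF D pD)) => l; rewrite [X in _ <= X]ger0_norm ?mulr_ge0 //.
  by have [_ le] := H4 l; rewrite ut_gameE !utk_gameE; exact: le.
have skP : negligible (fun l => Z false l - Z true l).
  have H0 l := sk_simulation (HF l) (HS l) (Hkg l) (Henc l) (HencF l) (@keyE l)
    (hardwire_spec (sk_dec S l)) (szA l) (szR l) (szM l).
  have [x1 [x2 H2]] := dep_choice2 H0.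
  pose D := @SKAdversary R FC S _ x1 x2.
  have pD : sk_adversary_qpt D.
    by apply: poly_le (poly_quad 400 400 100 psz) => l; have [le _ _] := H2 l.
  have aD : sk_admissible D.
    move=> b l; have [_ _ H] := H2 l.
    rewrite sk_gameE; apply: (H b (@msgs_ok FC l) (@keyq_ok FC l) (@keyq_in_funs FC l) (@skq_ok FC l)).
      move=> m q; rewrite /skq_ok /padq fstb_pairb sndb_pairb /optb ffunE andbT //.
    by have := admA b l; rewrite ut_gameE.
  have E b l : Z b l = Pr (sk_game D b l) (fun r => r.2).
    by have [_ H _] := H2 l; rewrite sk_gameE /Z -H.
  by apply: negl_le (secS D pD aD) => l; rewrite !E.
(* The chain leads from the real experiment with b = 0 to its zero form, on to the zero form with b
   = 1, and back to the real experiment with b = 1. *)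
have := negl_add (utkP false) (negl_add skP (negl_opp (utkP true))).
apply: negl_le => l; rewrite le_eqVlt; apply/orP; left; apply/eqP; congr `|_|; ring.
Qed.
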